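(* Let $k$ be an odd integer. Let $(A,d_A)$, $(B,d_B)$ be DG commutative unitary algebras, $(\sigma,\tau,h)$ a contraction of $A$ onto $B$, extended $\mathbb{K}[[t]]$-linearly to a contraction of $(A[[t]],d_A)$ onto $(B[[t]],d_B)$. Let $\Delta=\sum_{n\ge0}t^n\Delta_n$ be a degree $k$ derived $BV$ algebra structure on $A$ with $\Delta_0=d_A$, put $\Delta_+=\sum_{n\ge1}t^n\Delta_n$, and let \[ \Delta'=d_B+\sum_{n\ge0}\sigma\Delta_+(h\Delta_+)^n\tau,\quad \breve\sigma=\sum_{n\ge0}\sigma(\Delta_+h)^n,\quad \breve\tau=\sum_{n\ge0}(h\Delta_+)^n\tau,\quad \breve h=\sum_{n\ge0}(h\Delta_+)^nh \] be the perturbed differential on $B[[t]]$ and the perturbed contraction of $(A[[t]],\Delta)$ onto $(B[[t]],\Delta')$ given by the standard perturbation lemma. If $(\sigma,\tau,h)$ is a semifull DG algebra contraction, then $\Delta'$ is a degree $k$ derived $BV$ algebra structure on $B$, and $\breve\tau$ is a morphism of derived $BV$ algebras from $(B,\Delta')$ to $(A,\Delta)$. Furthermore, the induced degree $k$ derived Poisson algebra structure $\mathcal{P}(\Delta')$ on $B$ and the induced morphism $\mathcal{P}(\breve\tau):(B,\mathcal{P}(\Delta'))\to(A,\mathcal{P}(\Delta))$ of derived Poisson algebras coincide with those induced via homotopy transfer along $(\sigma,\tau,h)$ from the derived Poisson algebra structure $\mathcal{P}(\Delta)$ on $A$.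
   Context: $\mathbb{K}$ is a field of characteristic zero; spaces are $\mathbb{Z}$-graded, $V[m]^i=V^{i+m}$, $\pm_K$ denotes Koszul signs, $S(i_1,\ldots,i_k)$ the set of unshuffles. $t$ is a central variable of (even) degree $1-k$. Koszul brackets: for $\Delta\in\operatorname{End}_u(A)$ (i.e. $\Delta(\mathbf{1}_A)=0$), $\mathcal{K}(\Delta)_n(a_1,\ldots,a_n)=\sum_{i=1}^n\sum_{\pi\in S(i,n-i)}\pm_K(-1)^{n-i}\Delta(a_{\pi(1)}\cdots a_{\pi(i)})a_{\pi(i+1)}\cdots a_{\pi(n)}$. Cumulants: for a degree zero $f$ with $f(\mathbf{1})=\mathbf{1}$, $\kappa(f)_n(a_1,\ldots,a_n)=\sum_{k=1}^n\sum_{I_1\sqcup\cdots\sqcup I_k=\{1,\ldots,n\}}(-1)^{k-1}(k-1)!\pm_K\prod_{j=1}^kf(\prod_{i\in I_j}a_i)$, summed over unordered partitions into nonempty subsets. Both are applied $\mathbb{K}[[t]]$-linearly. Degree $k$ derived $BV$ algebra: a graded commutative unitary algebra $A$ with a degree one $\mathbb{K}[[t]]$-linear map $\Delta=\sum_{n\ge0}t^n\Delta_n$ on $A[[t]]$, $\Delta_n\in\operatorname{End}_u(A)$, $|\Delta_n|=1+n(k-1)$, with $\Delta^2=0$ and $\mathcal{K}(\Delta)_n(a_1,\ldots,a_n)\equiv0\pmod{t^{n-1}}$ for all $n\ge2$, $a_i\in A$ (so $\Delta_0$ is a derivation). Morphism $(A,\Delta)\to(B,\Delta')$: a degree zero $\mathbb{K}[[t]]$-linear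 map $f:A[[t]]\to B[[t]]$ with $f(\mathbf{1}_A)=\mathbf{1}_B$, $f\circ\Delta=\Delta'\circ f$ and $\kappa(f)_n(a_1,\ldots,a_n)\equiv0\pmod{t^{n-1}}$ for all $n\ge2$, $a_i\in A$. Contraction $(\sigma,\tau,h)$ of $(A,d_A)$ onto $(B,d_B)$: DG maps $\sigma:A\to B$, $\tau:B\to A$ and a degree $-1$ map $h:A\to A$ with $\sigma\tau=\mathrm{id}_B$, $hd_A+d_Ah=\tau\sigma-\mathrm{id}_A$, $\sigma h=0$, $h\tau=0$, $h^2=0$. It is a semifull DG algebra contraction if $d_A$ is an algebra derivation and for all $a,b\in A$, $x,y\in B$: $h(h(a)h(b))=h(h(a)\tau(x))=h(\tau(x)\tau(y))=h(\mathbf{1}_A)=0$, $\sigma(h(a)h(b))=\sigma(h(a)\tau(x))=0$, $\sigma(\tau(x)\tau(y))=xy$, $\sigma(\mathbf{1}_A)=\mathbf{1}_B$. $L_\infty[1]$ algebra structure on $V$: degree one coderivation $Q$ of the symmetric coalgebra $S(V)$ with $Q(\mathbf{1})=0$, $Q^2=0$, determined by its Taylor coefficients $q_n:V^{\odot n}\to V$; $L_\infty[1]$ morphisms are morphisms of DG coalgebras between symmetric coalgebras. Degree $k$ derived Poisson algebra: a graded commutative algebra $A$ with an $L_\infty[1]$ structure on $A[1-k]$ whose Taylor coefficients are multiderivations; a morphism is an $L_\infty[1]$ morphism $S(A[1-k])\to S(B[1-k])$ whose Taylor coefficients $\phi_n:A^{\odot n}\to B$ satisfy $\phi_{n+1}(a_1,\ldots,a_n,bc)=\sum_{i=0}^n\sum_{\pi\in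 S(i,n-i)}\pm_K\phi_{i+1}(a_{\pi(1)},\ldots,a_{\pi(i)},b)\phi_{n-i+1}(a_{\pi(i+1)},\ldots,a_{\pi(n)},c)$. A derived $BV$ algebra $(A,\Delta)$ has the associated derived Poisson algebra structure $\mathcal{P}(\Delta)$ with Taylor coefficients $\mathcal{P}(\Delta)_n=\mathcal{K}(\Delta_{n-1})_n$, $n\ge1$, and a morphism $f$ of derived $BV$ algebras has an associated morphism $\mathcal{P}(f)$ of derived Poisson algebras with Taylor coefficients defined by $\kappa(f)_n(a_1,\ldots,a_n)\equiv t^{n-1}\mathcal{P}(f)_n(a_1,\ldots,a_n)\pmod{t^n}$. Homotopy transfer: the structure $R=(r_n)$ on $B[1-k]$ and the morphism $F=(f_n):B[1-k]\to A[1-k]$ induced along $(\sigma,\tau,h)$ from the structure $(q_n)$ on $A[1-k]$ with $q_1=d_A$ are given by $f_1=\tau$, $r_1=d_B$ and, for $n\ge2$, \[ f_n(x_1,\ldots,x_n)=\sum_{k\ge2,\ i_1,\ldots,i_k\ge1,\ i_1+\cdots+i_k=n}\ \sum_{\pi\in S(i_1,\ldots,i_k)}\pm_K\frac{1}{k!}\,h\,q_k\big(f_{i_1}(x_{\pi(1)},\ldots),\ldots,f_{i_k}(\ldots,x_{\pi(n)})\big), \] with $r_n$ given by the same expression with $h$ replaced by $\sigma$. *)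

(* Defs.v *)
From HB Require Import structures.
From mathcomp Require Import all_boot all_order all_fingroup all_algebra.
From mathcomp Require classical_sets.

Set Implicit Arguments.
Unset Strict Implicit.
Unset Printing Implicit Defensive.

Import GRing.Theory.

Local Open Scope ring_scope.

(* A Z-graded space is an internal direct sum: [g i x] means [x \in V^i]. *)
Definition grading (V : Type) := int -> V -> Prop.

Record graded (K : fieldType) (V : lmodType K) (g : grading V) : Prop := Graded {
  graded_linear : forall i (c : K) (x y : V), g i x -> g i y -> g i (c *: x + y);
  graded_span : forall x : V, exists (s : seq int) (c : int -> V),
    (forall i, g i (c i)) /\ x = \sum_(i <- s) c i;
  graded_indep : forall (s : seq int) (c : int -> V),
    uniq s -> (forall i, g i (c i)) -> \sum_(i <- s) c i = 0 ->
    {in s, forall i, c i = 0}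
}.

(* [V[m]^i = V^(i+m)] *)
Definition shift (V : Type) (m : int) (g : grading V) : grading V :=
  fun i x => g (i + m) x.

(* The degree of a nonzero homogeneous element. On [0] the value is arbitrary,
   which is harmless because the expressions it enters are multilinear. *)
Definition gdeg (V : Type) (g : grading V) (x : V) : int :=
  classical_sets.xget 0 (fun i => g i x).

Definition homogeneous (V : eqType) (g : grading V) (a : seq V) : Prop :=
  {in a, forall x, exists i, g i x}.

Definition has_degree (V W : Type) (gV : grading V) (gW : grading W)
    (e : int) (f : V -> W) : Prop :=
  forall i x, gV i x -> gW (i + e) (f x).

Record graded_comm_alg (K : fieldType) (A : algType K) (g : grading A) : Prop :=
  GradedCommAlg {
  gca_graded : graded g;
  gca_one : g 0 1;
  gca_mul : forall i j a b, g i a -> g j b -> g (i + j) (a * b);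
  gca_comm : forall i j a b, g i a -> g j b ->
    a * b = ((-1 : K) ^ (i * j)) *: (b * a)
}.

Definition derivation (K : fieldType) (A : algType K) (g : grading A)
    (d : A -> A) : Prop :=
  forall i a b, g i a -> d (a * b) = d a * b + ((-1 : K) ^ i) *: (a * d b).

Record dg_comm_alg (K : fieldType) (A : algType K) (g : grading A)
    (d : {linear A -> A}) : Prop := DGCommAlg {
  dg_alg : graded_comm_alg g;
  dg_deg : has_degree g g 1 d;
  dg_sq : forall a, d (d a) = 0;
  dg_der : derivation g d
}.

Definition plist (n : nat) (p : 'S_n) : seq nat :=
  [seq val (p i) | i <- enum 'I_n].

(* S(i_1,...,i_k) for [sh = [:: i_1; ...; i_k]] with i_1 + ... + i_k = n. *)
Definition unshuffles (n : nat) (sh : seq nat) : {set 'S_n} :=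
  [set p : 'S_n | (sumn sh == n) && all (sorted ltn) (reshape sh (plist p))].

Definition compositions (m n : nat) : {set m.-tuple 'I_n.+1} :=
  [set sh : m.-tuple 'I_n.+1 |
    (sumn [seq val i | i <- sh] == n) && all (fun i : 'I_n.+1 => (0 < i)%N) sh].

Definition pick_seq (V : nmodType) (a : seq V) (s : seq nat) : seq V :=
  [seq nth 0 a i | i <- s].

(* The sign relating a_0 a_1 ... to a_(s_0) a_(s_1) ... *)
Definition ksign (K : fieldType) (V : lmodType K) (g : grading V)
    (a : seq V) (s : seq nat) : K :=
  \prod_(p < size s)
    \prod_(q < size s | (p < q)%N && (nth 0%N s q < nth 0%N s p)%N)
      (-1) ^ (gdeg g (nth 0 a (nth 0%N s p)) * gdeg g (nth 0 a (nth 0%N s q))).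

(* A family of maps [q_n : V^{\odot n} -> W], n >= 1, is a function
   [q : seq V -> W] whose restriction to sequences of length n is [q_n]; only
   its values on nonempty sequences of homogeneous elements are meaningful. *)
Record taylor_family (K : fieldType) (V W : lmodType K) (gV : grading V)
    (gW : grading W) (e : int) (q : seq V -> W) : Prop := TaylorFamily {
  tf_degree : forall a, (0 < size a)%N -> homogeneous gV a ->
    gW (\sum_(x <- a) gdeg gV x + e) (q a);
  tf_multilinear : forall (s1 s2 : seq V) i (c : K) x y,
    homogeneous gV s1 -> homogeneous gV s2 -> gV i x -> gV i y ->
    q (s1 ++ (c *: x + y) :: s2) = c *: q (s1 ++ x :: s2) + q (s1 ++ y :: s2);
  tf_symmetric : forall (s1 s2 : seq V) i j x y,
    homogeneous gV s1 -> homogeneous gV s2 -> gV i x -> gV j y ->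
    q (s1 ++ x :: y :: s2) = ((-1 : K) ^ (i * j)) *: q (s1 ++ y :: x :: s2)
}.

(* Corestriction to W of the composite S(V) -> S(V) -> W of the coderivation
   with Taylor coefficients q and the linear map with components p. *)
Definition insertion (K : fieldType) (V W : lmodType K) (g : grading V)
    (p : seq V -> W) (q : seq V -> V) (a : seq V) : W :=
  let n := size a in
  \sum_(1 <= i < n.+1) \sum_(s in unshuffles n [:: i; (n - i)%N])
    let b := pick_seq a (plist s) in
    ksign g a (plist s) *: p (q (take i b) :: drop i b).

(* Corestriction to U of the composite S(V) -> S(W) -> U of the coalgebra
   morphism with Taylor coefficients f (of degree 0) and the linear map with
   components q_m, m >= lo. *)
Definition composition (K : fieldType) (V W U : lmodType K) (g : grading V)
    (lo : nat) (q : seq W -> U) (f : seq V -> W) (a : seq V) : U :=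
  let n := size a in
  \sum_(lo <= m < n.+1) \sum_(sh in compositions m n)
    let l := [seq val i | i <- sh] in
    \sum_(s in unshuffles n l)
      ((m`!)%:R^-1 * ksign g a (plist s)) *:
        q [seq f b | b <- reshape l (pick_seq a (plist s))].

(* A coderivation Q of degree 1 (resp. a coalgebra morphism F) is given by its
   Taylor coefficients. Since Q^2 is again a coderivation, and Q F - F R is a
   coderivation along F, the equations Q^2 = 0 and Q F = F R amount to the
   vanishing of the corestrictions. *)
Record Linfty1 (K : fieldType) (V : lmodType K) (g : grading V)
    (q : seq V -> V) : Prop := LInfty1 {
  linf_taylor : taylor_family g g 1 q;
  linf_square : forall a, (0 < size a)%N -> homogeneous g a ->
    insertion g q q a = 0
}.

Record Linfty1_morphism (K : fieldType) (V W : lmodType K) (gV : grading V)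
    (gW : grading W) (r : seq V -> V) (q : seq W -> W) (f : seq V -> W) : Prop :=
  LInfty1Morphism {
  linfm_taylor : taylor_family gV gW 0 f;
  linfm_comm : forall a, (0 < size a)%N -> homogeneous gV a ->
    composition gV 1 q f a = insertion gV f r a
}.

(* q_n has degree 1 on A[1-k], that is 1 + (n-1)(k-1) on A. *)
Definition multiderivation (K : fieldType) (A : algType K) (k : int)
    (g : grading A) (q : seq A -> A) : Prop :=
  forall (a : seq A) i j b c, homogeneous g a -> g i b -> g j c ->
  q (rcons a (b * c)) = q (rcons a b) * c
    + ((-1 : K) ^ (i * (\sum_(x <- a) gdeg g x + 1 + (size a)%:Z * (k - 1)))) *:
        (b * q (rcons a c)).

Record derived_Poisson (K : fieldType) (A : algType K) (k : int)
    (g : grading A) (q : seq A -> A) : Prop := DerivedPoisson {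
  dp_linf : Linfty1 (shift (1 - k) g) q;
  dp_mder : multiderivation k g q
}.

(* The sign is that of
   a_1, ..., a_n, b, c |-> a_s(1), ..., a_s(i), b, a_s(i+1), ..., a_s(n), c. *)
Record derived_Poisson_morphism (K : fieldType) (A B : algType K) (k : int)
    (gA : grading A) (gB : grading B) (qA : seq A -> A) (qB : seq B -> B)
    (f : seq A -> B) : Prop := DerivedPoissonMorphism {
  dpm_linf : Linfty1_morphism (shift (1 - k) gA) (shift (1 - k) gB) qA qB f;
  dpm_mul : forall (a : seq A) d e b c, homogeneous gA a -> gA d b -> gA e c ->
    let n := size a in
    f (rcons a (b * c)) =
    \sum_(0 <= i < n.+1) \sum_(s in unshuffles n [:: i; (n - i)%N])
      let l := plist s in
      ksign gA (a ++ [:: b; c]) (take i l ++ n :: drop i l ++ [:: n.+1]) *: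
        (f (rcons (pick_seq a (take i l)) b) * f (rcons (pick_seq a (drop i l)) c))
}.

(* [x : pser V] stands for \sum_n t^n x_n. All sequences of elements of V are
   allowed, whereas the graded space V[[t]] consists of the finite sums of
   sequences that are homogeneous for [ps_homog]. A K[[t]]-linear map of given
   degree is, on either space, determined by its coefficients [tcoef], which are
   arbitrary linear maps of the appropriate degrees; so both spaces have the
   same such maps, with the same identities between them. *)
Definition pser (V : Type) := nat -> V.

Definition ps_const (V : nmodType) (v : V) : pser V :=
  fun n => if n == 0%N then v else 0.

Definition ps_mul (R : pzRingType) (x y : pser R) : pser R :=
  fun n => \sum_(i < n.+1) x i * y (n - i)%N.

Definition ps_scale (K : fieldType) (V : lmodType K) (c : pser K) (x : pser V) :
    pser V :=
  fun n => \sum_(i < n.+1) c i *: x (n - i)%N.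

Definition ps_linear (K : fieldType) (V W : lmodType K)
    (f : pser V -> pser W) : Prop :=
  forall (c : pser K) (x y : pser V) n,
    f (fun m => ps_scale c x m + y m) n = ps_scale c (f x) n + f y n.

(* [x] is homogeneous of degree p, for t of degree 1 - k. *)
Definition ps_homog (V : Type) (k : int) (g : grading V) (p : int)
    (x : pser V) : Prop :=
  forall n : nat, g (p + n%:Z * (k - 1)) (x n).

Definition ps_degree (V W : Type) (k : int) (gV : grading V) (gW : grading W)
    (e : int) (f : pser V -> pser W) : Prop :=
  forall p x, ps_homog k gV p x -> ps_homog k gW (p + e) (f x).

Definition tcoef (V W : nmodType) (f : pser V -> pser W) (n : nat) (v : V) : W :=
  f (ps_const v) n.

Definition ps_ext (V W : Type) (f : V -> W) (x : pser V) : pser W :=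
  fun n => f (x n).

(* The sum of a series whose i-th term is divisible by t^i. *)
Definition ps_sum (V : nmodType) (x : nat -> pser V) : pser V :=
  fun n => \sum_(i < n.+1) x i n.

Definition koszul (K : fieldType) (A : algType K) (g : grading A) (D : A -> A)
    (a : seq A) : A :=
  let n := size a in
  \sum_(1 <= i < n.+1) \sum_(s in unshuffles n [:: i; (n - i)%N])
    let b := pick_seq a (plist s) in
    (ksign g a (plist s) * (-1) ^+ (n - i)) *:
      (D (\prod_(x <- take i b) x) * \prod_(x <- drop i b) x).

(* An unordered partition is a set of blocks. Both the sign and the product
   follow the order of [enum P], whose choice does not matter since f has
   degree 0. *)
Definition cumulant (K : fieldType) (A B : algType K) (g : grading A)
    (f : pser A -> pser B) (a : seq A) : pser B :=
  fun m =>
  \sum_(P : {set {set 'I_(size a)}} | partition P [set: 'I_(size a)])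
    let l := flatten [seq [seq val i | i <- enum (T : {set _})] | T <- enum P] in
    ((-1) ^+ (#|P|.-1) * ((#|P|.-1)`!)%:R * ksign g a l) *:
      (\big[@ps_mul B/ps_const 1]_(T <- enum P)
         f (ps_const (\prod_(i <- enum (T : {set _})) nth 0 a i))) m.

(* K(D) = \sum_m t^m K(D_m) *)
Record derived_BV (K : fieldType) (A : algType K) (k : int) (g : grading A)
    (D : pser A -> pser A) : Prop := DerivedBV {
  dbv_linear : ps_linear D;
  dbv_degree : ps_degree k g g 1 D;
  dbv_one : forall n, tcoef D n 1 = 0;
  dbv_square : forall x n, D (D x) n = 0;
  dbv_order : forall a, (2 <= size a)%N -> homogeneous g a ->
    forall m, (m < (size a).-1)%N -> koszul g (tcoef D m) a = 0
}.

Record derived_BV_morphism (K : fieldType) (A B : algType K) (k : int)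
    (gA : grading A) (gB : grading B) (DA : pser A -> pser A)
    (DB : pser B -> pser B) (f : pser A -> pser B) : Prop := DerivedBVMorphism {
  dbvm_linear : ps_linear f;
  dbvm_degree : ps_degree k gA gB 0 f;
  dbvm_one : forall n, f (ps_const 1) n = ps_const (1 : B) n;
  dbvm_comm : forall x n, f (DA x) n = DB (f x) n;
  dbvm_order : forall a, (2 <= size a)%N -> homogeneous gA a ->
    forall m, (m < (size a).-1)%N -> cumulant gA f a m = 0
}.

Definition Poisson_str (K : fieldType) (A : algType K) (g : grading A)
    (D : pser A -> pser A) (a : seq A) : A :=
  koszul g (tcoef D (size a).-1) a.

Definition Poisson_mor (K : fieldType) (A B : algType K) (g : grading A)
    (f : pser A -> pser B) (a : seq A) : B :=
  cumulant g f a (size a).-1.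

Record contraction (K : fieldType) (V W : lmodType K) (gV : grading V)
    (gW : grading W) (dV : {linear V -> V}) (dW : {linear W -> W})
    (sigma : {linear V -> W}) (tau : {linear W -> V}) (h : {linear V -> V}) :
    Prop := Contraction {
  ctr_sigma_deg : has_degree gV gW 0 sigma;
  ctr_tau_deg : has_degree gW gV 0 tau;
  ctr_h_deg : has_degree gV gV (-1) h;
  ctr_sigma_dg : forall a, sigma (dV a) = dW (sigma a);
  ctr_tau_dg : forall x, tau (dW x) = dV (tau x);
  ctr_retract : forall x, sigma (tau x) = x;
  ctr_homotopy : forall a, h (dV a) + dV (h a) = tau (sigma a) - a;
  ctr_sigma_h : forall a, sigma (h a) = 0;
  ctr_h_tau : forall x, h (tau x) = 0;
  ctr_h_sq : forall a, h (h a) = 0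
}.

Record semifull (K : fieldType) (A B : algType K) (gA : grading A)
    (dA : {linear A -> A}) (sigma : {linear A -> B}) (tau : {linear B -> A})
    (h : {linear A -> A}) : Prop := Semifull {
  sf_der : derivation gA dA;
  sf_h_hh : forall a b, h (h a * h b) = 0;
  sf_h_ht : forall a x, h (h a * tau x) = 0;
  sf_h_tt : forall x y, h (tau x * tau y) = 0;
  sf_h_one : h 1 = 0;
  sf_s_hh : forall a b, sigma (h a * h b) = 0;
  sf_s_ht : forall a x, sigma (h a * tau x) = 0;
  sf_s_tt : forall x y, sigma (tau x * tau y) = x * y;
  sf_s_one : sigma 1 = 1
}.

Definition plus_part (V W : nmodType) (D : pser V -> pser W) (x : pser V) :
    pser W :=
  fun n => \sum_(1 <= i < n.+1) tcoef D i (x (n - i)%N).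

Definition perturbed_tau (K : fieldType) (V W : lmodType K)
    (tau : {linear W -> V}) (h : {linear V -> V}) (D : pser V -> pser V)
    (x : pser W) : pser V :=
  ps_sum (fun n => iter n (ps_ext h \o plus_part D) (ps_ext tau x)).

Definition perturbed_diff (K : fieldType) (V W : lmodType K)
    (dW : {linear W -> W}) (sigma : {linear V -> W}) (tau : {linear W -> V})
    (h : {linear V -> V}) (D : pser V -> pser V) (x : pser W) : pser W :=
  fun m => dW (x m) +
    ps_sum (fun n => ps_ext sigma
      (plus_part D (iter n (ps_ext h \o plus_part D) (ps_ext tau x)))) m.

(* [transfer_rec N] computes f_n for 1 <= n <= N: the formula for f_n only
   involves f_i with i < n. *)
Fixpoint transfer_rec (K : fieldType) (V W : lmodType K) (gW : grading W)
    (tau : {linear W -> V}) (h : {linear V -> V}) (q : seq V -> V) (N : nat)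
    (a : seq W) {struct N} : V :=
  if N is N'.+1 then
    if (size a <= 1)%N then tau (head 0 a)
    else composition gW 2 (fun b => h (q b)) (transfer_rec gW tau h q N') a
  else 0.

Definition transfer_mor (K : fieldType) (V W : lmodType K) (gW : grading W)
    (tau : {linear W -> V}) (h : {linear V -> V}) (q : seq V -> V)
    (a : seq W) : V :=
  transfer_rec gW tau h q (size a) a.

Definition transfer_str (K : fieldType) (V W : lmodType K) (gW : grading W)
    (dW : {linear W -> W}) (sigma : {linear V -> W}) (tau : {linear W -> V})
    (h : {linear V -> V}) (q : seq V -> V) (a : seq W) : W :=
  if (size a <= 1)%N then dW (head 0 a)
  else composition gW 2 (fun b => sigma (q b)) (transfer_mor gW tau h q) a.

(* Main.v *)
(* Words of homogeneous letters x_1 ... x_n carry the signed deconcatenation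
   coproduct, hence functions on words with values in a commutative superalgebra
   carry a convolution product. For a unital f put G(x_1 ... x_n) = f(x_1 ... x_n),
   the value at the product; the cumulants F of f are the convolution logarithm
   of G, that is, G(b w) = (F(b -) * G)(w), and the function D(G(w)) factors as
   (K(D) F) * G, where K(D) F sums the Koszul brackets K(D)_m(F, ..., F).
   Since convolution with G is injective, identities between brackets and
   cumulants follow from identities between values at products.

   For f = breve tau one has h G = 0 and sigma G(w) = the product of w. The
   semifull conditions say that Ker h is a subalgebra on which sigma is
   multiplicative, so h F = 0, and sigma F is the identity on letters and
   vanishes on longer words. Comparing D(G) with (K(D) F) * G for D = d_A and
   D = Delta_+ gives F = tau sigma F + h K(Delta_+) F and
   K(Delta' - d_B) = sigma K(Delta_+) F. By induction on the length of w, F(w)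
   is divisible by t^(|w|-1), and the leading coefficients of these two equations
   are the recursions of homotopy transfer. *)

Require Import Defs.
From HB Require Import structures.
From mathcomp Require Import all_boot all_order all_fingroup all_algebra.
From mathcomp Require Import boolp zify ring.
From mathcomp Require classical_sets.

Set Implicit Arguments.
Unset Strict Implicit.
Unset Printing Implicit Defensive.

Import GRing.Theory.

Local Open Scope ring_scope.

(** * Words and Koszul signs *)

(** The order of F(w) in t does not follow by induction on the length of w alone: the bracket with a
    single block, h Delta_+ F(w), involves F at w itself. Since Delta_+ raises the order in t, an
    inner induction on that order removes this term, while the blocks of all other brackets are
    shorter than w. A second obstacle: neither d_A F nor K(Delta_+) F need lie in Ker h. Their sum
    does, because its convolution with G is Delta(G). So h and sigma are applied to the sum, and the
    contribution of the derivation is subtracted afterwards. Sums over subwords are defined by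
    recursion on words, which makes associativity and symmetry inductive; only then are they matched
    with unshuffles and set partitions. Ordered and unordered decompositions into m blocks differ by
    the factor m!, the one cancelled by the factorials of homotopy transfer. As k is odd, t is even
    and the shift by 1 - k preserves parities, so the same signs serve A, A[[t]] and A[1-k]. Signs
    are booleans, and sign identities become truth tables. *)

Definition sg (V : zmodType) (b : bool) (x : V) : V := if b then - x else x.

Section Sign.
Variable V : zmodType.
Implicit Types (b : bool) (x y : V).

Lemma sgD b x y : sg b (x + y) = sg b x + sg b y.
Proof. by case: b => //=; rewrite opprD. Qed.

Lemma sg0 b : sg b 0 = 0 :> V.
Proof. by case: b => //=; rewrite oppr0. Qed.

Lemma sgN b x : sg b (- x) = - sg b x.
Proof. by case: b. Qed.

Lemma sgA b c x : sg b (sg c x) = sg (b (+) c) x.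
Proof. by case: b; case: c => //=; rewrite opprK. Qed.

Lemma sgMn b x n : sg b (x *+ n) = sg b x *+ n.
Proof. by case: b => //=; rewrite mulNrn. Qed.

Lemma sg_sum b (I : Type) (r : seq I) (P : pred I) (F : I -> V) :
  sg b (\sum_(i <- r | P i) F i) = \sum_(i <- r | P i) sg b (F i).
Proof. by case: b => //=; rewrite sumrN. Qed.

End Sign.

Lemma sgMl (R : pzRingType) b (x y : R) : sg b x * y = sg b (x * y).
Proof. by case: b => //=; rewrite mulNr. Qed.

Lemma sgMr (R : pzRingType) b (x y : R) : x * sg b y = sg b (x * y).
Proof. by case: b => //=; rewrite mulrN. Qed.

Lemma sgZ (K : pzRingType) (V : lmodType K) b c (x : V) :
  c *: sg b x = sg b (c *: x).
Proof. by case: b => //=; rewrite scalerN. Qed.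

Lemma sgE (K : pzRingType) (V : lmodType K) (b : bool) (x : V) : (-1) ^+ b *: x = sg b x.
Proof. by case: b => /=; rewrite ?expr1 ?scaleN1r // expr0 scale1r. Qed.

(** A predicate rather than a bundled morphism: the operators met here, such as iterated commutators
    and coefficients of series, are bare functions. *)
Definition addmap (V W : zmodType) (f : V -> W) := {morph f : x y / x + y}.

Section Addmap.
Variables (V W : zmodType) (f : V -> W).
Hypothesis f_add : addmap f.

Lemma addmap0 : f 0 = 0.
Proof. by apply: (addrI (f 0)); rewrite -f_add !addr0. Qed.

Lemma addmapN : {morph f : x / - x}.
Proof.
by move=> x; apply: (addrI (f x)); rewrite -f_add !subrr addmap0.
Qed.

Lemma addmapB : {morph f : x y / x - y}.
Proof. by move=> x y; rewrite f_add addmapN. Qed.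

Lemma addmap_sg b x : f (sg b x) = sg b (f x).
Proof. by case: b => //=; rewrite addmapN. Qed.

Lemma addmap_sum (I : Type) (r : seq I) (P : pred I) (F : I -> V) :
  f (\sum_(i <- r | P i) F i) = \sum_(i <- r | P i) f (F i).
Proof. exact: (big_morph f f_add addmap0). Qed.

Lemma addmapMn n x : f (x *+ n) = f x *+ n.
Proof. by elim: n => [|n IH]; rewrite ?mulr0n ?addmap0 // !mulrS f_add IH. Qed.

End Addmap.

Lemma addmap_lin (K : pzRingType) (V W : lmodType K) (f : {linear V -> W}) :
  addmap f.
Proof. exact: raddfD. Qed.

Lemma addmap_comp (U V W : zmodType) (f : V -> W) (g : U -> V) :
  addmap f -> addmap g -> addmap (f \o g).
Proof. by move=> Hf Hg x y /=; rewrite Hg Hf. Qed.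

Structure parType := ParType { par_sort :> Type; lpar : par_sort -> bool }.

Section Words.
Variable T : parType.
Implicit Types (u v w s : seq T) (b : T).

Definition wpar w : bool := foldr (fun b p => lpar b (+) p) false w.

Lemma wpar_cat u v : wpar (u ++ v) = wpar u (+) wpar v.
Proof. by elim: u => //= b u ->; rewrite addbA. Qed.

(** Describes the pairs of subwords visited by [S2], so that summands can be compared knowing the
    size, parity and degree of the pieces. *)
Inductive shuffle : seq T -> seq T -> seq T -> Prop :=
| shuffle_nil : shuffle [::] [::] [::]
| shuffle_l b u v w : shuffle u v w -> shuffle (b :: u) v (b :: w)
| shuffle_r b u v w : shuffle u v w -> shuffle u (b :: v) (b :: w).

Lemma shuffle_size u v w : shuffle u v w -> (size u + size v)%N = size w.
Proof. by elim=> //= b {}u {}v {}w _ <-; rewrite ?addSn ?addnS. Qed.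

Lemma shuffle_par u v w : shuffle u v w -> wpar w = wpar u (+) wpar v.
Proof.
elim=> //= b {}u {}v {}w _ ->; first by rewrite addbA.
by case: (lpar b); case: (wpar u); case: (wpar v).
Qed.

(* [S2 Phi w] is the sum of the values of [Phi] on the deconcatenations of [w]
   into two complementary subwords, with Koszul signs. *)
Fixpoint S2 (V : zmodType) (Phi : seq T -> seq T -> V) w : V :=
  if w is b :: w' then
    S2 (fun u v => Phi (b :: u) v) w' +
    S2 (fun u v => sg (lpar b && wpar u) (Phi u (b :: v))) w'
  else Phi [::] [::].

Lemma S2_cons (V : zmodType) (Phi : seq T -> seq T -> V) b w : S2 Phi (b :: w) =
  S2 (fun u v => Phi (b :: u) v) w +
  S2 (fun u v => sg (lpar b && wpar u) (Phi u (b :: v))) w.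
Proof. by []. Qed.

Lemma eq_S2 (V : zmodType) (Phi Psi : seq T -> seq T -> V) w :
  (forall u v, shuffle u v w -> Phi u v = Psi u v) ->
  S2 Phi w = S2 Psi w.
Proof.
elim: w Phi Psi => [|b w IH] Phi Psi H /=; first by apply: H; constructor.
by congr (_ + _); apply: IH => u v Huv; rewrite H //; constructor.
Qed.

Section S2theory.
Variable V : zmodType.
Implicit Types (Phi Psi : seq T -> seq T -> V).

Lemma S2D Phi Psi w :
  S2 (fun u v => Phi u v + Psi u v) w = S2 Phi w + S2 Psi w.
Proof.
elim: w Phi Psi => //= b w IH Phi Psi; rewrite IH -!addrA; congr (_ + _).
rewrite [RHS]addrCA; congr (_ + _); rewrite -IH.
by apply: eq_S2 => u v _; rewrite sgD.
Qed.

Lemma S2_morph (W : zmodType) (f : V -> W) Phi w : addmap f ->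
  f (S2 Phi w) = S2 (fun u v => f (Phi u v)) w.
Proof.
move=> f_add; elim: w Phi => //= b w IH Phi; rewrite f_add !IH.
by congr (_ + _); apply: eq_S2 => u v _; rewrite addmap_sg.
Qed.

Lemma S2_sg c Phi w : sg c (S2 Phi w) = S2 (fun u v => sg c (Phi u v)) w.
Proof. by apply: S2_morph => x y; rewrite sgD. Qed.

Lemma S2N Phi w : - S2 Phi w = S2 (fun u v => - Phi u v) w.
Proof. exact: (S2_sg true). Qed.

Lemma S2B Phi Psi w :
  S2 (fun u v => Phi u v - Psi u v) w = S2 Phi w - S2 Psi w.
Proof. by rewrite S2D S2N. Qed.

Lemma S2Mn n Phi w : S2 Phi w *+ n = S2 (fun u v => Phi u v *+ n) w.
Proof. by apply: (@S2_morph V (fun x => x *+ n)) => x y; rewrite mulrnDl. Qed.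

Lemma S2_0 Phi w : (forall u v, shuffle u v w -> Phi u v = 0) -> S2 Phi w = 0.
Proof.
move=> H; rewrite (eq_S2 (Psi := fun u v => Phi u v *+ 0)).
  by rewrite -S2Mn mulr0n.
by move=> u v Huv; rewrite H // mulr0n.
Qed.

Lemma S2_sum (I : Type) (r : seq I) (P : pred I) (F : I -> seq T -> seq T -> V) w :
  S2 (fun u v => \sum_(i <- r | P i) F i u v) w =
  \sum_(i <- r | P i) S2 (F i) w.
Proof.
elim: r => [|i r IH].
  by rewrite big_nil; apply: S2_0 => u v _; rewrite big_nil.
rewrite big_cons -IH; case: ifP => Pi; last first.
  by apply: eq_S2 => u v _; rewrite big_cons Pi.
by rewrite -S2D; apply: eq_S2 => u v _; rewrite big_cons Pi.
Qed.

Lemma S2_stable (Z : V -> Prop) Phi w :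
  (forall x y, Z x -> Z y -> Z (x + y)) -> (forall x, Z x -> Z (- x)) ->
  (forall u v, shuffle u v w -> Z (Phi u v)) -> Z (S2 Phi w).
Proof.
move=> ZD ZN; elim: w Phi => [|b w IH] Phi H /=; first by apply: H; constructor.
apply: ZD; apply: IH => u v Huv; first by apply: H; constructor.
by case: (_ && _) => /=; [apply: ZN|]; apply: H; constructor.
Qed.

(** Cocommutativity of the coproduct. *)
Lemma S2C Phi w : S2 Phi w = S2 (fun u v => sg (wpar u && wpar v) (Phi v u)) w.
Proof.
elim: w Phi => //= b w IH Phi; rewrite addrC; congr (_ + _); rewrite IH /=.
  by apply: eq_S2 => u v _; rewrite !sgA; congr sg; 
    case: (lpar b); case: (wpar u); case: (wpar v).
by apply: eq_S2 => u v _; rewrite !sgA; congr sg; 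
    case: (lpar b); case: (wpar u); case: (wpar v).
Qed.

(** Coassociativity: both sides distribute the letters over three subwords. *)
Lemma S2A (Phi : seq T -> seq T -> seq T -> V) w :
  S2 (fun u v => S2 (fun u1 u2 => Phi u1 u2 v) u) w =
  S2 (fun u v => S2 (fun v1 v2 => Phi u v1 v2) v) w.
Proof.
elim: w Phi => //= b w IH Phi.
rewrite S2D IH -addrA; congr (_ + _).
(* The first letter falls into the middle subword in [Phi2], into the last one in [Phi3]. *)
pose Phi2 x y z := sg (lpar b && wpar x) (Phi x (b :: y) z).
pose Phi3 x y z := sg (lpar b && (wpar x (+) wpar y)) (Phi x y (b :: z)).
have := IH Phi2; rewrite /Phi2 => ->.
have E u v : shuffle u v w ->
    sg (lpar b && wpar u) (S2 (fun u1 u2 => Phi u1 u2 (b :: v)) u) =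
    S2 (fun u1 u2 => Phi3 u1 u2 v) u.
  move=> _; rewrite S2_sg; apply: eq_S2 => u1 u2 /shuffle_par Hu.
  by rewrite /Phi3 Hu.
rewrite (eq_S2 E) (IH Phi3) -S2D; apply: eq_S2 => u v _.
rewrite sgD !S2_sg; congr (_ + _); apply: eq_S2 => v1 v2 _.
by rewrite /Phi3 sgA; congr sg; case: (lpar b); case: (wpar u); case: (wpar v1).
Qed.

Lemma S2CA (Phi : seq T -> seq T -> seq T -> V) w :
  S2 (fun u v => S2 (fun v1 v2 => Phi u v1 v2) v) w =
  S2 (fun u v => S2 (fun v1 v2 => sg (wpar u && wpar v1) (Phi v1 u v2)) v) w.
Proof.
rewrite -S2A -[RHS](S2A (fun u v1 v2 => sg (wpar u && wpar v1) (Phi v1 u v2))).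
by apply: eq_S2 => u v _; rewrite S2C.
Qed.

Lemma S2_nilr Phi w :
  S2 Phi w = Phi w [::] + S2 (fun u v => if nilp v then 0 else Phi u v) w.
Proof.
elim: w Phi => [|b w IH] Phi /=; first by rewrite addr0.
by rewrite IH /= -addrA.
Qed.

Lemma S2_nill Phi w :
  S2 Phi w = Phi [::] w + S2 (fun u v => if nilp u then 0 else Phi u v) w.
Proof.
elim: w Phi => [|b w IH] Phi /=; first by rewrite addr0.
rewrite [X in _ + X = _]IH /= andbF /= addrCA; congr (_ + (_ + _)).
by apply: eq_S2 => u v _; case: nilp => //; rewrite sg0.
Qed.

End S2theory.

Section LetterIdentities.
Variables (V : zmodType) (L : T -> T -> T -> Prop).
Variable rel : V -> V -> V -> Prop.
Hypothesis rel_add : forall x y z x' y' z',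
  rel x y z -> rel x' y' z' -> rel (x + x') (y + y') (z + z').
Hypothesis rel_opp : forall x y z, rel x y z -> rel (- x) (- y) (- z).
Hypothesis L_par : forall a b c, L a b c -> lpar a = lpar b /\ lpar a = lpar c.

(** Instantiated below with the relation x = c y + z, for which it is multilinearity in each
    letter. *)
Definition letter_stable (F : seq T -> V) := forall a b c s1 s2, L a b c ->
  rel (F (s1 ++ a :: s2)) (F (s1 ++ b :: s2)) (F (s1 ++ c :: s2)).

Let rel_sg p x y z : rel x y z -> rel (sg p x) (sg p y) (sg p z).
Proof. by case: p => //; apply: rel_opp. Qed.

Let S2_rel (w : seq T) (Phi Psi Xi : seq T -> seq T -> V) :
  (forall u v, rel (Phi u v) (Psi u v) (Xi u v)) ->
  rel (S2 Phi w) (S2 Psi w) (S2 Xi w).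
Proof.
elim: w Phi Psi Xi => [|d w IH] Phi Psi Xi H //=.
by apply: rel_add; apply: IH => u v; rewrite //=; apply: rel_sg.
Qed.

Let wpar_L a b c s1 s2 : L a b c -> wpar (s1 ++ a :: s2) = wpar (s1 ++ b :: s2)
  /\ wpar (s1 ++ a :: s2) = wpar (s1 ++ c :: s2).
Proof. by move=> /L_par [E1 E2]; rewrite !wpar_cat /= -E1 -E2. Qed.

Lemma letter_stable_S2 (Phi : seq T -> seq T -> V) :
  (forall u, letter_stable (Phi u)) ->
  (forall v, letter_stable (fun u => Phi u v)) -> letter_stable (S2 Phi).
Proof.
move=> H1 H2 a b c s1 s2 Labc; have [E1 E2] := L_par Labc.
elim: s1 Phi H1 H2 => [|d s1 IH] Phi H1 H2 /=.
  apply: rel_add; apply: S2_rel => u v.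
    exact: (H2 v a b c [::] u).
  rewrite -E1 -E2; apply: rel_sg; exact: (H1 u a b c [::] v).
apply: rel_add; apply: IH => u a' b' c' t1 t2 L'.
- exact: H1.
- exact: (H2 u a' b' c' (d :: t1) t2).
- apply: rel_sg; exact: (H1 u a' b' c' (d :: t1) t2).
have [F1 F2] := wpar_L t1 t2 L'; rewrite -F1 -F2; apply: rel_sg.
exact: (H2 (d :: u) a' b' c').
Qed.

End LetterIdentities.

Definition word_sym (V : zmodType) (F : seq T -> V) := forall s1 s2 a b,
  F (s1 ++ a :: b :: s2) = sg (lpar a && lpar b) (F (s1 ++ b :: a :: s2)).

(** If both letters fall into the same subword, the hypotheses apply; the two terms that separate
    them are exchanged. *)
Lemma word_sym_S2 (V : zmodType) (Phi : seq T -> seq T -> V) :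
  (forall u, word_sym (Phi u)) ->
  (forall v, word_sym (fun u => Phi u v)) -> word_sym (S2 Phi).
Proof.
move=> H1 H2 s1 s2 a b; elim: s1 Phi H1 H2 => [|d s1 IH] Phi H1 H2 /=.
  rewrite !sgD -!addrA !S2_sg; congr (_ + _); last rewrite addrCA.
    by apply: eq_S2 => u v _; exact: (H2 v [::] u).
  congr (_ + _); [|congr (_ + _)]; apply: eq_S2 => u v _.
  - by rewrite !sgA; congr sg; case: (lpar a); case: (lpar b); case: (wpar u).
  - by rewrite !sgA; congr sg; case: (lpar a); case: (lpar b); case: (wpar u).
  - rewrite (H1 u [::] v a b) /= !sgA; congr sg.
    by case: (lpar a); case: (lpar b); case: (wpar u).
rewrite sgD; congr (_ + _); apply: IH => u t1 t2 a' b'.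
- exact: H1.
- exact: (H2 u (d :: t1) t2).
- by rewrite (H1 u (d :: t1) t2) !sgA addbC.
rewrite (H2 (d :: u)) !sgA !wpar_cat /=; congr sg.
by case: (lpar d); case: (wpar t1); case: (lpar a'); case: (lpar b'); case: (wpar t2).
Qed.

End Words.

(** * Decompositions of words and convolution *)

Section Blocks.
Variables (T : parType).
Implicit Types (u v w : seq T) (b : T) (L : seq (seq T)).

(** Only those consequences of being a decomposition of [w] on which the size and parity arguments
    rely. *)
Definition is_blocks m L w := [/\ size L = m, all (fun l => ~~ nilp l) L,
  size (flatten L) = size w & wpar (flatten L) = wpar w].

(* Sums over the decompositions of a word into [m] nonempty subwords: ordered
   ones for [OS], unordered ones (listed by increasing first letter) for [US]. *)
Fixpoint OS (V : zmodType) m (Phi : seq (seq T) -> V) w : V :=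
  if m is m'.+1 then
    S2 (fun u v => if nilp u then 0 else OS m' (fun L => Phi (u :: L)) v) w
  else if nilp w then Phi [::] else 0.

Fixpoint US (V : zmodType) m (Phi : seq (seq T) -> V) w : V :=
  match m, w with
  | 0, _ => if nilp w then Phi [::] else 0
  | m'.+1, [::] => 0
  | m'.+1, b :: w' => S2 (fun u v => US m' (fun L => Phi ((b :: u) :: L)) v) w'
  end.

Lemma OS_S (V : zmodType) m (Phi : seq (seq T) -> V) w : OS m.+1 Phi w =
  S2 (fun u v => if nilp u then 0 else OS m (fun L => Phi (u :: L)) v) w.
Proof. by []. Qed.

Lemma is_blocks_cons m L l u v w : ~~ nilp l -> size l = size u ->
  wpar l = wpar u ->
  shuffle u v w -> is_blocks m L v -> is_blocks m.+1 (l :: L) w.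
Proof.
move=> Hl Sl Pl Hs [S1 S2 S3 S4]; split=> //=; first by rewrite S1.
- by rewrite Hl.
- by rewrite size_cat S3 Sl (shuffle_size Hs).
- by rewrite wpar_cat S4 Pl (shuffle_par Hs).
Qed.

Lemma eq_OS (V : zmodType) m (Phi Psi : seq (seq T) -> V) w :
  (forall L, is_blocks m L w -> Phi L = Psi L) -> OS m Phi w = OS m Psi w.
Proof.
elim: m Phi Psi w => [|m IH] Phi Psi w H /=.
  by case: nilP => // w0; rewrite H //; rewrite w0.
apply: eq_S2 => u v Huv; case: ifPn => // Hu.
by apply: IH => L HL; apply/H/(is_blocks_cons Hu _ _ Huv HL).
Qed.

Lemma eq_US (V : zmodType) m (Phi Psi : seq (seq T) -> V) w :
  (forall L, is_blocks m L w -> Phi L = Psi L) -> US m Phi w = US m Psi w.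
Proof.
elim: m Phi Psi w => [|m IH] Phi Psi w H /=.
  by case: nilP => // w0; rewrite H //; rewrite w0.
case: w H => // b w H; apply: eq_S2 => u v Huv.
apply: IH => L HL; apply: H.
by apply: is_blocks_cons (shuffle_l b Huv) HL.
Qed.

Lemma US_morph (V W : zmodType) (f : V -> W) m Phi w : addmap f ->
  f (US m Phi w) = US m (fun L => f (Phi L)) w.
Proof.
move=> f_add; elim: m Phi w => [|m IH] Phi [|b w] //=; try exact: addmap0.
rewrite (S2_morph _ _ f_add); apply: eq_S2 => u v _; exact: IH.
Qed.

Lemma OS_morph (V W : zmodType) (f : V -> W) m Phi w : addmap f ->
  f (OS m Phi w) = OS m (fun L => f (Phi L)) w.
Proof.
move=> f_add; elim: m Phi w => [|m IH] Phi w /=.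
  by case: nilp => //; exact: addmap0.
rewrite (S2_morph _ _ f_add); apply: eq_S2 => u v _.
by rewrite -IH; case: nilp => //; exact: addmap0.
Qed.

Lemma US_0 (V : zmodType) m (Phi : seq (seq T) -> V) w :
  (forall L, is_blocks m L w -> Phi L = 0) -> US m Phi w = 0.
Proof.
move=> H; rewrite (eq_US (Psi := fun L => Phi L *+ 0)).
  rewrite -(@US_morph _ _ (fun x => x *+ 0)); first by rewrite mulr0n.
  by move=> x y; rewrite mulrnDl.
by move=> L HL; rewrite H // mulr0n.
Qed.

Lemma size_flatten_nonnil L : all (fun l => ~~ nilp l) L ->
  (size L <= size (flatten L))%N.
Proof.
elim: L => //= l L IH /andP[Hl /IH H]; rewrite size_cat -add1n leq_add //.
by move: Hl; rewrite /nilp lt0n.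
Qed.

Lemma US_big (V : zmodType) m (Phi : seq (seq T) -> V) w :
  (size w < m)%N -> US m Phi w = 0.
Proof.
move=> Hm; apply: US_0 => L [E1 /size_flatten_nonnil E2 E3 _].
by move: Hm; rewrite -E1 -E3 ltnNge E2.
Qed.

Lemma US1 (V : zmodType) (Phi : seq (seq T) -> V) w :
  US 1 Phi w = if nilp w then 0 else Phi [:: w].
Proof.
case: w => //= b w; rewrite S2_nilr /= S2_0 ?addr0 // => u v _.
by case: nilp.
Qed.

Definition block_sym (V : zmodType) (Phi : seq (seq T) -> V) :=
  forall L1 u v L2, Phi (L1 ++ u :: v :: L2) =
    sg (wpar u && wpar v) (Phi (L1 ++ v :: u :: L2)).

(** By symmetry the block containing the first letter can be moved to the front, and each of its
    m.+1 possible places contributes equally. *)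
Lemma OS_cons (V : zmodType) m (Phi : seq (seq T) -> V) b w : block_sym Phi ->
  OS m.+1 Phi (b :: w) =
  S2 (fun u v => OS m (fun L => Phi ((b :: u) :: L)) v) w *+ m.+1.
Proof.
elim: m Phi w => [|m IH] Phi w Hsym.
  rewrite mulr1n /= [X in _ + X]S2_0 ?addr0 // => u v _.
  by case: nilp; rewrite sg0.
rewrite mulrS OS_S S2_cons; congr (_ + _).
(* [x] completes the block of [b], which is moved to the front past the former first block [y]; the
   guard in [Psi] keeps [y] nonempty. *)
pose Xi x y z := OS m (fun L => Phi ((b :: x) :: y :: L)) z.
pose Psi x y z : V := if nilp y then 0 else Xi x y z.
transitivity (S2 (fun u v => S2 (fun v1 v2 =>
    sg (wpar u && wpar v1) (Psi v1 u v2)) v) w *+ m.+1).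
  rewrite S2Mn; apply: eq_S2 => u v _; rewrite /Psi.
  case: ifP => Hu; first by rewrite sg0 S2_0 ?mul0rn // => v1 v2 _; rewrite sg0.
  rewrite IH => [|L1 u' v' L2]; last exact: (Hsym (u :: L1)).
  rewrite sgMn; congr (_ *+ _); rewrite S2_sg; apply: eq_S2 => v1 v2 _.
  rewrite /Xi !(@OS_morph _ _ (sg _)); try by move=> x y; rewrite sgD.
  apply: eq_OS => L _; rewrite (Hsym [::] u) /= sgA; congr sg.
  by case: (lpar b); case: (wpar u); case: (wpar v1).
by rewrite -S2CA.
Qed.

Lemma OS_US (V : zmodType) m (Phi : seq (seq T) -> V) w : block_sym Phi ->
  OS m Phi w = US m Phi w *+ m`!.
Proof.
elim: m Phi w => [|m IH] Phi w Hsym; first by rewrite mulr1n.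
case: w => [|b w]; first by rewrite /= mul0rn.
rewrite OS_cons //= factS mulnC mulrnA; congr (_ *+ _).
rewrite S2Mn; apply: eq_S2 => u v _; apply: IH => L1 u' v' L2.
exact: (Hsym ((b :: u) :: L1)).
Qed.

Section Convolution.
Variable R : pzRingType.
Implicit Types (F G H J : seq T -> R).

Definition conv F G w : R := S2 (fun u v => F u * G v) w.

Definition conv1 w : R := if nilp w then 1 else 0.

Lemma convA F G H w : conv F (conv G H) w = conv (conv F G) H w.
Proof.
rewrite /conv.
under eq_S2 => u v _.
  rewrite (S2_morph (f := fun x => F u * x)); last by move=> x y; rewrite mulrDr.
  over.
rewrite -S2A; apply: eq_S2 => u v _.
rewrite (S2_morph (f := fun x => x * H v)); last by move=> x y; rewrite mulrDl.
by apply: eq_S2 => u1 u2 _; rewrite mulrA.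
Qed.

Lemma eq_conv F F' G G' w : (forall u, (size u <= size w)%N -> F u = F' u) ->
  (forall u, (size u <= size w)%N -> G u = G' u) -> conv F G w = conv F' G' w.
Proof.
move=> HF HG; apply: eq_S2 => u v /shuffle_size Hs.
congr (_ * _); [apply: HF | apply: HG]; by rewrite -Hs ?leq_addr ?leq_addl.
Qed.

Lemma conv_1l F w : conv conv1 F w = F w.
Proof.
rewrite /conv S2_nill /= mul1r S2_0 ?addr0 // => u v _.
by rewrite /conv1; case: (nilp u); rewrite ?mul0r.
Qed.

Lemma conv_1r F w : conv F conv1 w = F w.
Proof.
rewrite /conv S2_nilr /= mulr1 S2_0 ?addr0 // => u v _.
by rewrite /conv1; case: (nilp v); rewrite ?mulr0.
Qed.

Lemma conv_last F G w : G [::] = 1 ->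
  conv F G w = F w + S2 (fun u v => if nilp v then 0 else F u * G v) w.
Proof. by move=> G1; rewrite /conv S2_nilr G1 mulr1. Qed.

(** As G is 1 on the empty word, F(w) is the convolution at [w] minus terms with F on proper
    subwords. With Z = 0 this gives injectivity of convolution with G, with Z = Ker h the vanishing
    of h on cumulants. *)
Lemma conv_stable (Z : R -> Prop) F G :
  (forall x y, Z x -> Z y -> Z (x + y)) -> (forall x, Z x -> Z (- x)) ->
  (forall x v, Z x -> Z (x * G v)) -> G [::] = 1 ->
  (forall w, Z (conv F G w)) -> forall w, Z (F w).
Proof.
move=> ZD ZN ZM G1 HZ w; have [n] := ubnP (size w).
elim: n w => // n IH w Hw.
rewrite -[F w](addrK (S2 (fun u v => if nilp v then 0 else F u * G v) w)).
rewrite -conv_last //; apply: (ZD) => //; apply: (ZN).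
apply: S2_stable => // u v /shuffle_size Hs; case: ifPn => Hv.
  (* 0 lies in Z as a difference of two elements of Z. *)
  by rewrite -(subrr (conv F G w)); apply: ZD => //; apply: ZN.
apply/ZM/IH; rewrite ltnS in Hw; apply: leq_trans Hw.
by rewrite -Hs -addn1 leq_add2l lt0n.
Qed.

Lemma convBl F F' G w : conv (fun u => F u - F' u) G w = conv F G w - conv F' G w.
Proof. by rewrite /conv -S2B; apply: eq_S2 => u v _; rewrite mulrBl. Qed.

Lemma convDl F F' G w : conv (fun u => F u + F' u) G w = conv F G w + conv F' G w.
Proof. by rewrite /conv -S2D; apply: eq_S2 => u v _; rewrite mulrDl. Qed.

Lemma convDr F G G' w : conv F (fun u => G u + G' u) w = conv F G w + conv F G' w.
Proof. by rewrite /conv -S2D; apply: eq_S2 => u v _; rewrite mulrDr. Qed.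

Lemma conv_inj F F' G : G [::] = 1 ->
  (forall w, conv F G w = conv F' G w) -> forall w, F w = F' w.
Proof.
move=> G1 E w; apply/eqP; rewrite -subr_eq0; apply/eqP; move: w.
apply: (conv_stable (Z := fun x => x = 0) (G := G)) => //.
- by move=> x y -> ->; rewrite addr0.
- by move=> x ->; rewrite oppr0.
- by move=> x v ->; rewrite mul0r.
- by move=> w; rewrite convBl E subrr.
Qed.

Definition off_nil G w : R := if nilp w then 0 else G w.

Fixpoint cpow G m : seq T -> R :=
  if m is m'.+1 then conv G (cpow G m') else conv1.

Lemma cpowC G m w : conv G (cpow G m) w = conv (cpow G m) G w.
Proof.
elim: m w => [|m IH] w; first by rewrite conv_1l conv_1r.
rewrite [cpow _ _.+1]/= -convA; apply: eq_conv => // u _; exact: IH.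
Qed.

Lemma OS_prod G m w :
  OS m (fun L => \prod_(l <- L) G l) w = cpow (off_nil G) m w.
Proof.
elim: m w => [|m IH] w /=; first by rewrite big_nil.
apply: eq_S2 => u v _; rewrite -IH /off_nil; case: ifP; first by rewrite mul0r.
rewrite (OS_morph (f := fun x => G u * x)); last by move=> x y; rewrite mulrDr.
by move=> _; apply: eq_OS => L _; rewrite big_cons.
Qed.

Lemma cpow_big G m w : G [::] = 0 -> (size w < m)%N -> cpow G m w = 0.
Proof.
move=> G0; elim: m w => // m IH w Hw /=; apply: S2_0 => u v /shuffle_size Hs.
case: u Hs => [|b u] Hs; first by rewrite G0 mul0r.
rewrite IH ?mulr0 // -ltnS; apply: leq_trans Hw.
by rewrite -Hs ltnS addSn ltnS leq_addl.
Qed.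

(** The Neumann series of the convolution inverse of 1 + [off_nil G]; higher powers vanish on
    [w]. *)
Definition conv_inv G w : R :=
  \sum_(m < (size w).+1) sg (odd m) (cpow (off_nil G) m w).

Lemma conv_invE G w N : (size w < N)%N ->
  conv_inv G w = \sum_(m < N) sg (odd m) (cpow (off_nil G) m w).
Proof.
move=> HN; rewrite -(big_mkord xpredT (fun m => sg (odd m) (cpow (off_nil G) m w))).
rewrite (big_cat_nat (n := (size w).+1)) //= big_mkord.
rewrite -[X in X + _]/(conv_inv G w) big1_seq ?addr0 // => m.
rewrite mem_index_iota => /andP[_ /andP[Hm _]].
by rewrite cpow_big // sg0.
Qed.

(** The alternating series telescopes, and its last term vanishes by size. *)
Lemma conv_invl G w : G [::] = 1 -> conv (conv_inv G) G w = conv1 w.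
Proof.
move=> G1; have GE v : G v = conv1 v + off_nil G v.
  by rewrite /conv1 /off_nil; case: nilP => [->|]; rewrite ?G1 ?addr0 ?add0r.
rewrite (eq_conv (F' := conv_inv G) (G' := fun v => conv1 v + off_nil G v)) //.
rewrite convDr conv_1r.
pose c m := cpow (off_nil G) m w.
have -> : conv (conv_inv G) (off_nil G) w =
    \sum_(m < (size w).+1) sg (odd m) (c m.+1).
  rewrite /conv.
  transitivity (S2 (fun u v => \sum_(m < (size w).+1)
      sg (odd m) (cpow (off_nil G) m u) * off_nil G v) w).
    apply: eq_S2 => u v /shuffle_size Hs; rewrite -mulr_suml.
    by rewrite (@conv_invE G u (size w).+1) // ltnS -Hs leq_addr.
  rewrite S2_sum; apply: eq_bigr => m _; rewrite /c /= cpowC /conv S2_sg.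
  by apply: eq_S2 => u v _; rewrite sgMl.
rewrite -[conv_inv G w]/(\sum_(m < _) sg _ (c m)) big_ord_recl /=.
rewrite -[RHS]addr0 -addrA; congr (_ + _).
rewrite [X in _ + X]big_ord_recr /= [X in _ + (_ + sg _ X)]/c cpow_big //.
rewrite sg0 addr0 -big_split /= big1 // => i _.
by rewrite /bump /=; case: odd => /=; rewrite ?subrr ?addNr.
Qed.

(* The convolution logarithm of G. *)
Definition cum G w : R :=
  \sum_(m < size w) sg (odd m) (US m.+1 (fun L => \prod_(l <- L) G l) w *+ m`!).

Lemma cum_nil G : cum G [::] = 0.
Proof. by rewrite /cum big_ord0. Qed.

(** Once the block of [b] is fixed, the weight m! counts the orders of the m other blocks; they sum
    to the Neumann series, as in the logarithmic derivative G' G^(-1). *)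
Lemma cum_cons G b w : block_sym (fun L => \prod_(l <- L) G l) ->
  cum G (b :: w) = conv (fun u => G (b :: u)) (conv_inv G) w.
Proof.
move=> Hsym; rewrite /cum /=.
transitivity (S2 (fun u v => \sum_(m < (size w).+1)
    G (b :: u) * sg (odd m) (cpow (off_nil G) m v)) w).
  rewrite S2_sum; apply: eq_bigr => m _; rewrite S2Mn S2_sg.
  apply: eq_S2 => u v _; rewrite sgMr; congr sg.
  rewrite -OS_prod OS_US // mulrnAr; congr (_ *+ _).
  rewrite (US_morph (f := fun x => G (b :: u) * x)).
    by apply: eq_US => L _; rewrite big_cons.
  by move=> x y; rewrite mulrDr.
apply: eq_S2 => u v /shuffle_size Hs; rewrite -mulr_sumr.
by rewrite (@conv_invE G v (size w).+1) // ltnS -Hs leq_addl.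
Qed.

Lemma conv_cum G b w : G [::] = 1 -> block_sym (fun L => \prod_(l <- L) G l) ->
  conv (fun u => cum G (b :: u)) G w = G (b :: w).
Proof.
move=> G1 Hsym.
rewrite (eq_conv (F' := conv (fun u => G (b :: u)) (conv_inv G)) (G' := G)) //.
  rewrite -convA -[RHS](conv_1r (fun u => G (b :: u))).
  by apply: eq_conv => // u _; rewrite conv_invl.
by move=> u _; rewrite cum_cons.
Qed.

End Convolution.
End Blocks.

(** * Koszul brackets *)

Definition par (i : int) : bool := odd `|i|%N.

Lemma parD i j : par (i + j) = par i (+) par j.
Proof. rewrite /par; lia. Qed.

Lemma parN i : par (- i) = par i.
Proof. by rewrite /par abszN. Qed.

Lemma parM i j : par (i * j) = par i && par j.
Proof. by rewrite /par abszM oddM. Qed.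

(** The common setting of an algebra and of its power series. A general sequence of elements is not
    a sum of homogeneous series, so the laws are stated on homogeneous elements. *)
Record superring (R : pzRingType) (gr : int -> R -> Prop) : Prop := Superring {
  sr_0 : forall i, gr i 0;
  sr_D : forall i x y, gr i x -> gr i y -> gr i (x + y);
  sr_N : forall i x, gr i x -> gr i (- x);
  sr_1 : gr 0 1;
  sr_M : forall i j x y, gr i x -> gr j y -> gr (i + j) (x * y);
  sr_C : forall i j x y, gr i x -> gr j y -> x * y = sg (par i && par j) (y * x)
}.

(* A letter records a degree of its value, so that signs and linearity make
   sense for the value 0 too, on which [gdeg] is arbitrary. *)
Record letter (R : Type) (gr : int -> R -> Prop) :=
  Letter { ldeg : int; lval : R; lgr : gr ldeg lval }.

Canonical letter_parType (R : Type) (gr : int -> R -> Prop) :=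
  ParType (fun l : letter gr => par (ldeg l)).

Definition wdeg (R : Type) (gr : int -> R -> Prop) (w : seq (letter gr)) : int :=
  \sum_(l <- w) ldeg l.

Section WDeg.
Variables (R : Type) (gr : int -> R -> Prop).
Implicit Types (u v w : seq (letter gr)).

Lemma wdeg_nil : wdeg ([::] : seq (letter gr)) = 0.
Proof. by rewrite /wdeg big_nil. Qed.

Lemma wdeg_cons l w : wdeg (l :: w) = ldeg l + wdeg w.
Proof. by rewrite /wdeg big_cons. Qed.

Lemma wdeg_cat u v : wdeg (u ++ v) = wdeg u + wdeg v.
Proof. by rewrite /wdeg big_cat. Qed.

Lemma wpar_wdeg w : wpar w = par (wdeg w).
Proof.
elim: w => [|l w IH]; first by rewrite wdeg_nil.
by rewrite wdeg_cons parD -IH.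
Qed.

Lemma shuffle_wdeg u v w : shuffle u v w -> wdeg w = wdeg u + wdeg v.
Proof.
elim=> [|b {}u {}v {}w _ IH|b {}u {}v {}w _ IH].
- by rewrite wdeg_nil addr0.
- by rewrite !wdeg_cons IH addrA.
- by rewrite !wdeg_cons IH addrCA.
Qed.

Lemma letter_eq (l l' : letter gr) : ldeg l = ldeg l' -> lval l = lval l' -> l = l'.
Proof.
case: l => d x p; case: l' => d' x' p' /= E E'; subst d' x'.
by rewrite (Prop_irrelevance p p').
Qed.

End WDeg.

Definition wprod (R : pzRingType) (gr : int -> R -> Prop)
    (w : seq (letter gr)) : R := \prod_(l <- w) lval l.

Lemma wprod_cons (R : pzRingType) (gr : int -> R -> Prop)
  (l : letter gr) (w : seq (letter gr)) : wprod (l :: w) = lval l * wprod w.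
Proof. by rewrite /wprod big_cons. Qed.

Lemma wprod_nil (R : pzRingType) (gr : int -> R -> Prop) :
  wprod ([::] : seq (letter gr)) = 1.
Proof. by rewrite /wprod big_nil. Qed.

Section WordFunctions.
Variables (S : Type) (grS : int -> S -> Prop).
Variables (R : pzRingType) (gr : int -> R -> Prop).
Hypothesis HR : superring gr.
Implicit Types (u v w : seq (letter grS)).
Implicit Types (F G : seq (letter grS) -> R).

Definition has_wdeg e F := forall w, gr (wdeg w + e) (F w).

Lemma S2_wdeg i (Phi : seq (letter grS) -> seq (letter grS) -> R) w :
  (forall u v, shuffle u v w -> gr i (Phi u v)) -> gr i (S2 Phi w).
Proof.
by move=> H; apply: S2_stable H; [exact: sr_D|exact: sr_N].
Qed.

Lemma US_wdeg i m (Phi : seq (seq (letter grS)) -> R) w :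
  (forall L, is_blocks m L w -> wdeg (flatten L) = wdeg w -> gr i (Phi L)) ->
  gr i (US m Phi w).
Proof.
elim: m Phi w => [|m IH] Phi [|b w] H /=; try exact: (sr_0 HR).
  exact: H.
apply: S2_wdeg => u v Huv; apply: IH => L HL dL; apply: H.
  by apply: is_blocks_cons (shuffle_l b Huv) HL.
by rewrite -[flatten _]/((b :: u) ++ _) wdeg_cat dL (shuffle_wdeg (shuffle_l b Huv)).
Qed.

Lemma sr_sg i b x : gr i x -> gr i (sg b x).
Proof. by case: b => // /(sr_N HR). Qed.

Lemma sr_sum i (I : Type) (r : seq I) (P : pred I) (f : I -> R) :
  (forall j, P j -> gr i (f j)) -> gr i (\sum_(j <- r | P j) f j).
Proof.
move=> H; elim/big_ind: _ => //; [exact: (sr_0 HR)|exact: (sr_D HR)].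
Qed.

Lemma sr_Mn i n x : gr i x -> gr i (x *+ n).
Proof.
move=> H; elim: n => [|n IH]; first by rewrite mulr0n; exact: sr_0.
by rewrite mulrS; apply: sr_D.
Qed.

Lemma prod_wdeg F L : has_wdeg 0 F ->
  gr (wdeg (flatten L)) (\prod_(l <- L) F l).
Proof.
move=> HF; elim: L => [|l L IH]; first by rewrite big_nil wdeg_nil; exact: sr_1.
rewrite big_cons /= wdeg_cat; apply: sr_M => //.
by rewrite -[wdeg l]addr0.
Qed.

Lemma block_sym_prod F : has_wdeg 0 F -> block_sym (fun L => \prod_(l <- L) F l).
Proof.
move=> HF L1 u v L2; rewrite !big_cat !big_cons /= -sgMr; congr (_ * _).
rewrite !mulrA (sr_C HR (HF u) (HF v)) !addr0 -!wpar_wdeg.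
by rewrite sgMl.
Qed.

Lemma cum_wdeg F : has_wdeg 0 F -> has_wdeg 0 (cum F).
Proof.
move=> HF w; apply: sr_sum => m _; apply: sr_sg; apply: sr_Mn.
by rewrite addr0; apply: US_wdeg => L _ <-; apply: prod_wdeg.
Qed.

(** Turns cumulants into arguments of brackets; the transport along [addr0] removes the + 0 of
    [has_wdeg]. *)
Definition word_letter F (HF : has_wdeg 0 F) w : letter gr :=
  @Letter R gr (wdeg w) (F w) (eq_rect _ (fun i => gr i (F w)) (HF w) _ (addr0 _)).

Lemma wdeg_map_letter F (HF : has_wdeg 0 F) L :
  wdeg (map (word_letter HF) L) = wdeg (flatten L).
Proof.
elim: L => [|l L IH]; first by rewrite !wdeg_nil.
by rewrite /= wdeg_cons IH wdeg_cat.
Qed.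

End WordFunctions.

Section Koszul.
Variables (R : pzRingType) (gr : int -> R -> Prop).
Hypothesis HR : superring gr.
Implicit Types (D : R -> R) (l : letter gr) (w u v : seq (letter gr)) (p : bool).

(* The Koszul brackets of an operator D of parity [p] are obtained from it by
   successive graded commutators with the left multiplications by the letters. *)
Definition ad p D l x : R := D (lval l * x) - sg (p && lpar l) (lval l * D x).

Fixpoint KK p D w : R :=
  if w is l :: w' then KK (p (+) lpar l) (ad p D l) w' else D 1.

Definition op_deg e D := forall i x, gr i x -> gr (i + e) (D x).

Lemma ad_addmap p D l : addmap D -> addmap (ad p D l).
Proof.
move=> HD x y; rewrite /ad mulrDr !HD mulrDr sgD opprD.
by rewrite addrACA.
Qed.

Lemma ad_deg p D l e : op_deg e D -> op_deg (e + ldeg l) (ad p D l).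
Proof.
move=> HD i x Hx; rewrite /ad; apply: (sr_D HR).
  by rewrite [e + _]addrC addrA [i + _]addrC; apply/HD/(sr_M HR) => //; exact: lgr.
apply/(sr_N HR)/(sr_sg HR); rewrite addrA addrC; apply: (sr_M HR); first exact: lgr.
exact: HD.
Qed.

Lemma eq_KK p D D' w : D =1 D' -> KK p D w = KK p D' w.
Proof.
elim: w p D D' => [|l w IH] p D D' E //=; apply: IH => x.
by rewrite /ad !E.
Qed.

Lemma KK_0 p w : KK p (fun _ => 0) w = 0.
Proof.
elim: w p => //= l w IH p; rewrite -[RHS](IH (p (+) lpar l)); apply: eq_KK => x.
by rewrite /ad mulr0 sg0 subrr.
Qed.

Lemma KK_D p D D' w : KK p (fun x => D x + D' x) w = KK p D w + KK p D' w.
Proof.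
elim: w p D D' => //= l w IH p D D'; rewrite -IH; apply: eq_KK => x.
by rewrite /ad mulrDr sgD opprD addrACA.
Qed.

Lemma KK_sum p (I : Type) (r : seq I) (P : pred I) (D : I -> R -> R) w :
  KK p (fun x => \sum_(i <- r | P i) D i x) w = \sum_(i <- r | P i) KK p (D i) w.
Proof.
elim: r => [|i r IH].
  by rewrite big_nil -[RHS](KK_0 p w); apply: eq_KK => x; rewrite big_nil.
rewrite big_cons -IH; case: ifP => Pi; last first.
  by apply: eq_KK => x; rewrite big_cons Pi.
by rewrite -KK_D; apply: eq_KK => x; rewrite big_cons Pi.
Qed.

Lemma KK_deg p D e : op_deg e D -> has_wdeg gr e (KK p D).
Proof.
move=> HD w; elim: w p D e HD => [|l w IH] p D e HD /=.
  by rewrite wdeg_nil; apply: HD; exact: sr_1.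
rewrite wdeg_cons [ldeg l + _]addrC -addrA [ldeg l + _]addrC.
by apply: IH; apply: ad_deg.
Qed.

(** The first letter l enters the bracket, giving [ad p D l], or stays outside, giving l D up to
    sign; these two add up to D composed with multiplication by l. *)
Lemma conv_KK p e D w : addmap D -> op_deg e D -> p = par e ->
  conv (KK p D) (@wprod _ gr) w = D (wprod w).
Proof.
elim: w p e D => [|l w IH] p e D aD dD Hp.
  by rewrite /conv /= wprod_nil mulr1.
rewrite /conv S2_cons /=.
rewrite -[S2 _ w]/(conv (KK (p (+) lpar l) (ad p D l)) (@wprod _ gr) w).
rewrite (IH _ (e + ldeg l)); first 1 last.
- exact: ad_addmap.
- exact: ad_deg.
- by rewrite Hp parD.
rewrite /ad -wprod_cons -[RHS]addr0 -addrA; congr (_ + _).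
rewrite -(IH p e D aD dD Hp) /conv.
rewrite (S2_morph (f := fun x => lval l * x)); last by move=> x y; rewrite mulrDr.
rewrite S2_sg addrC; apply/eqP; rewrite subr_eq0; apply/eqP; apply: eq_S2 => u v _.
rewrite wprod_cons !mulrA (sr_C HR (KK_deg p dD u) (lgr l)) sgMl sgA; congr sg.
rewrite parD -wpar_wdeg -Hp /=.
by case: (par _); case: (wpar _); case: p {Hp}.
Qed.

(** Once all commutators are expanded, each letter is inside D or outside it with a factor -1: this
    is the alternating sum defining the Koszul brackets. *)
Lemma KK_S2 p e D w : addmap D -> op_deg e D -> p = par e ->
  KK p D w = S2 (fun u v => sg (odd (size v)) (D (wprod u) * wprod v)) w.
Proof.
elim: w p e D => [|l w IH] p e D aD dD Hp.
  by rewrite /= wprod_nil mulr1.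
rewrite S2_cons /= (IH _ (e + ldeg l)); first 1 last.
- exact: ad_addmap.
- exact: ad_deg.
- by rewrite Hp parD.
rewrite -S2D; apply: eq_S2 => u v _; rewrite /ad -!wprod_cons mulrBl sgD.
congr (_ + _); rewrite wprod_cons.
have du : gr (wdeg u) (wprod u).
  elim: u => [|a u IHu]; first by rewrite wdeg_nil wprod_nil; exact: sr_1.
  by rewrite wdeg_cons wprod_cons; apply: (sr_M HR) => //; exact: lgr.
rewrite mulrA (sr_C HR (dD _ _ du) (lgr l)).
rewrite -[- (_ * _)]/(sg true _) !sgMl !sgA; congr sg.
rewrite parD -wpar_wdeg -Hp /=.
by case: (par _); case: (wpar _); case: p {Hp}; case: odd.
Qed.

Lemma ad_ad p D a b x : addmap D -> ad (p (+) lpar a) (ad p D a) b x =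
  D (lval a * lval b * x) + sg (~~ (p && lpar a)) (lval a * D (lval b * x)) +
  sg (~~ ((p (+) lpar a) && lpar b)) (lval b * D (lval a * x)) +
  sg (p && lpar a (+) p && lpar b) (lval a * lval b * D x).
Proof.
move=> aD; rewrite /ad !mulrBr !mulrA !sgMr -!addrA; congr (_ + (_ + _)).
  by case: (_ && _) => //=; rewrite opprK.
rewrite [X in _ - sg _ X]mulrA (sr_C HR (lgr b) (lgr a)) !sgMl sgD sgN !sgA /= opprD opprK.
congr (_ + _); first by case: (_ && _) => //=; rewrite opprK.
by congr sg; case: (par _); case: (par _); case: p.
Qed.

(** Left multiplications by letters supercommute, which makes the double commutator graded
    symmetric. *)
Lemma ad_sym p D a b x : addmap D -> ad (p (+) lpar a) (ad p D a) b x =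
  sg (lpar a && lpar b) (ad (p (+) lpar b) (ad p D b) a x).
Proof.
move=> aD; rewrite !ad_ad // (sr_C HR (lgr b) (lgr a)) !sgMl !sgD !sgA.
rewrite (addmap_sg aD) sgA [X in _ = X + _]addrAC [_ && par _]andbC addbb /=.
by congr (_ + _); first congr (_ + _ + _); congr sg;
  case: (par _); case: (par _); case: p.
Qed.

Lemma KK_sg p b D w : KK p (fun x => sg b (D x)) w = sg b (KK p D w).
Proof.
elim: w p D => //= l w IH p D; rewrite -IH; apply: eq_KK => x.
by rewrite /ad sgMr sgD sgN !sgA [b (+) _]addbC.
Qed.

Lemma KK_sym p D : addmap D -> word_sym (KK p D).
Proof.
move=> aD s1 s2 a b; elim: s1 p D aD => [|l s1 IH] p D aD /=; last first.
  by apply: IH; apply: ad_addmap.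
rewrite -KK_sg addbAC; apply: eq_KK => x; exact: ad_sym.
Qed.

(** The defect of a bracket from being a derivation in its last argument is the next bracket.
    Replacing D by its commutators reduces this to the empty word. *)
Lemma KK_der p e D w b c bc : addmap D -> op_deg e D -> p = par e ->
  lval bc = lval b * lval c -> ldeg bc = ldeg b + ldeg c ->
  KK p D (rcons w bc) = KK p D (rcons w b) * lval c +
    sg (lpar b && (p (+) wpar w)) (lval b * KK p D (rcons w c)) +
    KK p D (rcons (rcons w b) c).
Proof.
move=> aD dD Hp Ebc dbc; elim: w p e D aD dD Hp => [|l w IH] p e D aD dD Hp /=.
  (* [x1] stands for D(bc), [x2] for D(b) c, [x3] for b D(c) up to sign, [x4] and [x5] for bc D(1)
     up to sign. *)
  have E (x1 x2 x3 x4 x5 : R) :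
      x2 - x4 + (x3 - x5) + (x1 - x3 - x2 + x5) = x1 - x4.
    have -> : x1 - x3 - x2 + x5 = x1 - (x2 + (x3 - x5)).
      by rewrite opprD opprB -!addrA; congr (_ + _); rewrite addrCA [x5 - _]addrC.
    by rewrite (addrAC x2) [LHS]addrC addrA subrK.
  rewrite ad_ad // /ad /= !mulr1 addbF Ebc dbc parD.
  rewrite mulrBl mulrBr sgD sgN !sgMl !sgMr sgA -!mulrA.
  have d1 : gr e (D 1) by rewrite -[e]add0r; apply: dD; exact: sr_1.
  have db : gr (ldeg b + e) (D (lval b)) by apply: dD; exact: lgr.
  rewrite (sr_C HR d1 (lgr c)) (sr_C HR (lgr c) db) sgMr !sgA.
  rewrite -[LHS](E _ (D (lval b) * lval c) (sg (p && par (ldeg b)) (lval b * D (lval c)))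
    _ (sg (p && par (ldeg b) (+) p && par (ldeg c)) (lval b * (lval c * D 1)))).
  rewrite -[- sg _ (_ * D (lval c))]/(sg true _) -[- (D _ * _)]/(sg true _) !sgA.
  rewrite parD -Hp.
  congr (_ - sg _ _ + (sg _ _ - sg _ _) + (_ + sg _ _ + sg _ _ + _));
    by case: (par _); case: (par _); case: p {Hp}.
rewrite (IH _ (e + ldeg l)) ?addbA //; first exact: ad_addmap.
  exact: ad_deg.
by rewrite Hp parD.
Qed.

End Koszul.

(** * Brackets evaluated on cumulants *)

Section Exponential.
Variables (S : Type) (grS : int -> S -> Prop).
Variables (R : pzRingType) (gr : int -> R -> Prop).
Hypothesis HR : superring gr.
Variables (F G : seq (letter grS) -> R).
Hypothesis F_deg : has_wdeg gr 0 F.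
Hypothesis G_nil : G [::] = 1.
(* This recursion says that G is the convolution exponential of F. *)
Hypothesis G_cons : forall b w, conv (fun u => F (b :: u)) G w = G (b :: w).

Let lF := word_letter F_deg.

(** The bound N on the number of blocks is free because splitting off the first block lowers it by
    one; [brackets] takes it large enough to include every block count that occurs. *)
Definition bracket_sum N p D w : R :=
  \sum_(m < N) US m (fun L => KK p D (map lF L)) w.

Lemma bracket_sum_deg N p D e : op_deg gr e D -> has_wdeg gr e (bracket_sum N p D).
Proof.
move=> dD w; apply: (sr_sum HR) => m _; apply: (US_wdeg HR) => L _ <-.
by rewrite -(wdeg_map_letter F_deg); apply: (KK_deg HR).
Qed.

Lemma bracket_sum_cons N p D b w :
  bracket_sum N.+1 p D (b :: w) =
  S2 (fun u v => bracket_sum N (p (+) wpar (b :: u)) (ad p D (lF (b :: u))) v) w.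
Proof.
rewrite /bracket_sum big_ord_recl /= add0r S2_sum; apply: eq_bigr => m _ /=.
by apply: eq_S2 => u v _; apply: eq_US => L _; rewrite /= -wpar_wdeg.
Qed.

(** Induction on the length. If b lies in the block b::u, the induction hypothesis for the
    commutator of D with F(b::u) yields D(F(b::u) G(v)) minus F(b::u) D(G(v)) up to sign. The first
    terms sum to D(G(b::w)); the second ones cancel the part where b is outside the brackets. *)
Lemma bracket_sum_conv N p e D w : addmap D -> op_deg gr e D -> p = par e ->
  (size w < N)%N -> conv (bracket_sum N p D) G w = D (G w).
Proof.
have [n] := ubnP (size w); elim: n w N p e D => // n IH w N p e D Hn aD dD Hp HN.
case: w Hn HN => [|b w] Hn HN.
  case: N HN => // N _; rewrite /conv /= /bracket_sum big_ord_recl /=.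
  by rewrite big1 ?addr0 // G_nil mulr1.
case: N HN => // N HN; rewrite /= !ltnS in Hn HN.
rewrite /conv S2_cons.
pose X := bracket_sum N.+1 p D.
pose Y u := bracket_sum N (p (+) wpar (b :: u)) (ad p D (lF (b :: u))).
have -> : S2 (fun u v => X (b :: u) * G v) w =
    D (G (b :: w)) -
    S2 (fun u v => sg (p && wpar (b :: u)) (F (b :: u) * D (G v))) w.
  transitivity (S2 (fun u v => S2 (fun v1 v2 => Y u v1 * G v2) v) w).
    rewrite -S2A; apply: eq_S2 => u v _; rewrite /X bracket_sum_cons.
    by rewrite (S2_morph (f := fun x => x * G v)) // => x y; rewrite mulrDl.
  rewrite -G_cons /conv (S2_morph _ _ aD) -S2B.
  apply: eq_S2 => u v /shuffle_size Hs.
  rewrite -[LHS]/(conv (Y u) G v) (IH _ _ _ (e + wdeg (b :: u))).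
  - by rewrite /ad /= -wpar_wdeg.
  - by apply: leq_ltn_trans Hn; rewrite -Hs leq_addl.
  - exact: ad_addmap.
  - exact: (@ad_deg _ _ HR p D (lF (b :: u)) e dD).
  - by rewrite parD Hp wpar_wdeg.
  - by apply: leq_ltn_trans HN; rewrite -Hs leq_addl.
rewrite -[RHS]addr0 -addrA; congr (_ + _).
apply/eqP; rewrite addrC subr_eq0; apply/eqP.
transitivity (S2 (fun u v => S2 (fun v1 v2 =>
    sg (p && wpar (b :: u)) (F (b :: u) * (X v1 * G v2))) v) w); last first.
  apply: eq_S2 => u v /shuffle_size Hs.
  rewrite -S2_sg -(S2_morph (f := fun x => F (b :: u) * x)); last first.
    by move=> x y; rewrite mulrDr.
  rewrite -[S2 _ v]/(conv X G v) (IH _ _ _ e) //.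
    by apply: leq_ltn_trans Hn; rewrite -Hs leq_addl.
  by rewrite ltnS; apply: leq_trans (ltnW HN); rewrite -Hs leq_addl.
(* On the side where b is outside the brackets, G(b::v) is expanded by [G_cons] and the cumulant
   containing b is moved to the front. *)
transitivity (S2 (fun u v => S2 (fun v1 v2 =>
    sg (lpar b && wpar u) (X u * (F (b :: v1) * G v2))) v) w).
  apply: eq_S2 => u v _; rewrite -G_cons /conv -/X -S2_sg.
  by rewrite (S2_morph (f := fun x => X u * x)) // => x y; rewrite mulrDr.
rewrite S2CA; apply: eq_S2 => u v _; apply: eq_S2 => v1 v2 _.
have dX : gr (wdeg v1 + e) (X v1) by apply: bracket_sum_deg.
have dF : gr (wdeg (b :: u)) (F (b :: u)) by rewrite -[wdeg _]addr0.
rewrite sgA mulrA (sr_C HR dX dF) sgMl sgA -mulrA parD -Hp -!wpar_wdeg /=.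
by congr sg; case: (par _); case: (wpar u); case: (wpar v1); case: p {Hp X Y IH dX}.
Qed.

Definition brackets p D w : R := bracket_sum (size w).+1 p D w.

Lemma bracketsE N p D w : (size w < N)%N -> bracket_sum N p D w = brackets p D w.
Proof.
move=> Hw; rewrite /brackets /bracket_sum.
rewrite -!(big_mkord xpredT (fun m => US m (fun L => KK p D (map lF L)) w)).
rewrite (big_cat_nat (n := (size w).+1)) //= [X in _ + X]big1_seq ?addr0 // => m.
by rewrite mem_index_iota => /andP[_ /andP[Hm _]]; apply: US_big.
Qed.

Lemma brackets_conv p e D w : addmap D -> op_deg gr e D -> p = par e ->
  conv (brackets p D) G w = D (G w).
Proof.
move=> aD dD Hp; rewrite -(@bracket_sum_conv (size w).+1 p e D w) //.
by apply: eq_conv => // u Hu; rewrite bracketsE.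
Qed.

End Exponential.

(** * Brackets of composite operators *)

Section Jacobi.
Variables (R : pzRingType) (gr : int -> R -> Prop).
Hypothesis HR : superring gr.
Implicit Types (w u v : seq (letter gr)).

Definition KK_letter p e D (dD : op_deg gr e D) w : letter gr :=
  Letter (KK_deg HR p dD w).

(** Two uses of [conv_KK]: in D D' at a product, the bracket of D' either becomes an argument of a
    bracket of D or stands beside it, and the latter terms are subtracted. *)
Lemma KK_KK p e e' D D' w (dD' : op_deg gr e' D') : addmap D -> addmap D' ->
  op_deg gr e D -> p = par e -> p = par e' ->
  conv (fun w => S2 (fun u v => KK p D (KK_letter p dD' u :: v)) w)
    (@wprod _ gr) w =
  D (D' (wprod w)) - conv (fun w => S2 (fun u v =>
     sg (p && (wpar u (+) p)) (KK p D' u * KK p D v)) w) (@wprod _ gr) w.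
Proof.
move=> aD aD' dD Hp Hp'.
rewrite /conv; under eq_S2 => u v _.
  rewrite (S2_morph (f := fun x => x * wprod v)); last first.
    by move=> x y; rewrite mulrDl.
  over.
rewrite S2A.
rewrite -(conv_KK HR _ aD' dD' Hp') /conv (S2_morph _ _ aD).
under [X in _ = _ - X]eq_S2 => u v _.
  rewrite (S2_morph (f := fun x => x * wprod v)); last first.
    by move=> x y; rewrite mulrDl.
  over.
rewrite S2A -S2B; apply: eq_S2 => u v _.
rewrite -[LHS]/(conv (KK _ (ad p D (KK_letter p dD' u))) (@wprod _ gr) v).
rewrite (conv_KK HR v (e := e + (wdeg u + e'))); first 1 last.
- exact: ad_addmap.
- exact: (@ad_deg _ _ HR p D (KK_letter p dD' u)).
- by rewrite parD Hp.
rewrite /ad /= parD -wpar_wdeg -Hp'; congr (_ - _).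
rewrite -(conv_KK HR _ aD dD Hp) /conv.
rewrite (S2_morph (f := fun x => KK p D' u * x)); last first.
  by move=> x y; rewrite mulrDr.
rewrite S2_sg; apply: eq_S2 => v1 v2 _.
by rewrite sgMl mulrA.
Qed.

End Jacobi.

Section LetterLinear.
Variables (K : fieldType) (R : algType K) (gr : int -> R -> Prop).

Definition lin_letters (c : K) (x y z : letter gr) :=
  [/\ lval x = c *: lval y + lval z, ldeg x = ldeg y & ldeg x = ldeg z].

Definition word_lin (V : lmodType K) (F : seq (letter gr) -> V) :=
  forall c, letter_stable (lin_letters c) (fun x y z => x = c *: y + z) F.

Lemma lin_rel_add (V : lmodType K) (c : K) (x y z x' y' z' : V) :
  x = c *: y + z -> x' = c *: y' + z' -> x + x' = c *: (y + y') + (z + z').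
Proof. by move=> -> ->; rewrite scalerDr addrACA. Qed.

Lemma lin_rel_opp (V : lmodType K) (c : K) (x y z : V) :
  x = c *: y + z -> - x = c *: (- y) + (- z).
Proof. by move=> ->; rewrite opprD scalerN. Qed.

Lemma lin_letters_par c (x y z : letter gr) : lin_letters c x y z ->
  lpar x = lpar y /\ lpar x = lpar z.
Proof. by case=> _ /= <- <-. Qed.

Lemma word_lin_S2 (V : lmodType K) (Phi : seq (letter gr) -> seq (letter gr) -> V) :
  (forall u, word_lin (Phi u)) -> (forall v, word_lin (fun u => Phi u v)) ->
  word_lin (S2 Phi).
Proof.
move=> H1 H2 c; apply: letter_stable_S2.
- exact: lin_rel_add.
- exact: lin_rel_opp.
- exact: lin_letters_par.
- by move=> u; exact: H1.
by move=> v; exact: H2.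
Qed.

(** A letter of value 0 equals 1 times itself plus itself, so F is twice its own value. This holds
    whatever degree the letter carries. *)
Lemma word_lin_0 (V : lmodType K) (F : seq (letter gr) -> V) s1 s2 l :
  word_lin F -> lval l = 0 -> F (s1 ++ l :: s2) = 0.
Proof.
move=> HF l0; have /HF H : lin_letters 1 l l l.
  by split=> //; rewrite l0 scaler0 addr0.
by move: (H s1 s2); rewrite scale1r -[LHS]addr0 => /addrI.
Qed.

End LetterLinear.

(** * Power series *)

Section PowerSeries.

HB.instance Definition _ (V : choiceType) := Choice.copy (pser V) (nat -> V).

Section Zmod.
Variable V : zmodType.
Implicit Types x y z : pser V.

Definition ps_zero : pser V := fun _ => 0.
Definition ps_opp x : pser V := fun n => - x n.
Definition ps_add x y : pser V := fun n => x n + y n.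

Lemma ps_addA : associative ps_add.
Proof. by move=> x y z; apply: funext => n; rewrite /ps_add addrA. Qed.
Lemma ps_addC : commutative ps_add.
Proof. by move=> x y; apply: funext => n; rewrite /ps_add addrC. Qed.
Lemma ps_add0 : left_id ps_zero ps_add.
Proof. by move=> x; apply: funext => n; rewrite /ps_add add0r. Qed.
Lemma ps_addN : left_inverse ps_zero ps_opp ps_add.
Proof. by move=> x; apply: funext => n; rewrite /ps_add addNr. Qed.

HB.instance Definition _ :=
  GRing.isZmodule.Build (pser V) ps_addA ps_addC ps_add0 ps_addN.

Lemma ps_D x y n : (x + y) n = x n + y n. Proof. by []. Qed.
Lemma ps_0 n : (0 : pser V) n = 0. Proof. by []. Qed.
Lemma ps_N x n : (- x) n = - x n. Proof. by []. Qed.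

Lemma addmap_coef n : addmap (fun x : pser V => x n).
Proof. by []. Qed.

Lemma ps_sumE (I : Type) (r : seq I) (P : pred I) (F : I -> pser V) n :
  (\sum_(i <- r | P i) F i) n = \sum_(i <- r | P i) F i n.
Proof. exact: (addmap_sum (addmap_coef n)). Qed.

Lemma ps_sg b x n : (sg b x) n = sg b (x n).
Proof. by case: b. Qed.

Lemma ps_Mn x m n : (x *+ m) n = x n *+ m.
Proof. exact: (addmapMn (addmap_coef n)). Qed.

Lemma sum_triangle (F : nat -> nat -> nat -> V) n :
  \sum_(i < n.+1) \sum_(j < (n - i).+1) F i j (n - i - j)%N =
  \sum_(m < n.+1) \sum_(i < m.+1) F i (m - i)%N (n - m)%N.
Proof.
elim: n F => [|n IH] F; first by rewrite !big_ord1.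
rewrite big_ord_recl /= subn0.
under [X in _ + X]eq_bigr => i _ do rewrite /bump /= add1n subSS.
rewrite (IH (fun i => F i.+1)).
under [RHS]eq_bigr => m _ do rewrite big_ord_recl subn0.
rewrite big_split /=; congr (_ + _).
rewrite [RHS]big_ord_recl /= big_ord0 add0r; apply: eq_bigr => m _.
by rewrite /bump /= add1n subSS; apply: eq_bigr => i _; rewrite /bump /= add1n subSS.
Qed.

Lemma sum_ord_rev (F : nat -> nat -> V) n :
  \sum_(i < n.+1) F i (n - i)%N = \sum_(i < n.+1) F (n - i)%N i.
Proof.
rewrite (reindex_inj rev_ord_inj) /=; apply: eq_bigr => i _.
by rewrite subSS subKn // -ltnS.
Qed.

End Zmod.

Section Ring.
Variable A : pzRingType.
Implicit Types x y z : pser A.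

Lemma ps_mulA : associative (@ps_mul A).
Proof.
move=> x y z; apply: funext => n; rewrite /ps_mul.
under eq_bigr => i _ do rewrite mulr_sumr.
rewrite (sum_triangle (fun i j l => x i * (y j * z l))); apply: eq_bigr => m _.
by rewrite mulr_suml; apply: eq_bigr => i _; rewrite mulrA.
Qed.

Lemma ps_mul1 : left_id (ps_const 1) (@ps_mul A).
Proof.
move=> x; apply: funext => n; rewrite /ps_mul big_ord_recl subn0 mul1r.
by rewrite big1 ?addr0 // => i _; rewrite mul0r.
Qed.

Lemma ps_mulr1 : right_id (ps_const 1) (@ps_mul A).
Proof.
move=> x; apply: funext => n.
rewrite /ps_mul (sum_ord_rev (fun i j => x i * ps_const 1 j)).
rewrite big_ord_recl subn0 mulr1.
by rewrite big1 ?addr0 // => i _; rewrite mulr0.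
Qed.

Lemma ps_mulDl : left_distributive (@ps_mul A) +%R.
Proof.
move=> x y z; apply: funext => n; rewrite ps_D /ps_mul -big_split /=.
by apply: eq_bigr => i _; rewrite mulrDl.
Qed.

Lemma ps_mulDr : right_distributive (@ps_mul A) +%R.
Proof.
move=> x y z; apply: funext => n; rewrite ps_D /ps_mul -big_split /=.
by apply: eq_bigr => i _; rewrite mulrDr.
Qed.

HB.instance Definition _ := GRing.Zmodule_isPzRing.Build (pser A)
  ps_mulA ps_mul1 ps_mulr1 ps_mulDl ps_mulDr.

Lemma ps_M x y n : (x * y) n = \sum_(i < n.+1) x i * y (n - i)%N.
Proof. by []. Qed.

Lemma ps_M_const x (a : A) n : (x * ps_const a) n = x n * a.
Proof.
rewrite ps_M (sum_ord_rev (fun i j => x i * ps_const a j)).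
rewrite big_ord_recl subn0 big1 ?addr0 // => i _; exact: mulr0.
Qed.

Lemma ps_const_M (a : A) x n : (ps_const a * x) n = a * x n.
Proof.
by rewrite ps_M big_ord_recl subn0 big1 ?addr0 // => i _; exact: mul0r.
Qed.

End Ring.
End PowerSeries.

(** * Gradings of an algebra and of its power series *)

Section Graded.
Variables (K : fieldType) (A : algType K) (g : grading A).
Hypothesis HA : graded_comm_alg g.

Lemma sign_par (i : int) : (-1 : K) ^ i = (-1) ^+ par i.
Proof.
rewrite /par; case: i => n /=; first by rewrite signr_odd.
by rewrite NegzE -exprnN -[in LHS]signr_odd invr_sign.
Qed.

Lemma sgZsign (i j : int) (V : lmodType K) (x : V) :
  (-1 : K) ^ (i * j) *: x = sg (par i && par j) x.
Proof. by rewrite sign_par parM sgE. Qed.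

Lemma graded_0 i : g i 0.
Proof.
have [s [c [Hc _]]] := graded_span (gca_graded HA) 0.
have := graded_linear (gca_graded HA) (-1) (Hc i) (Hc i).
by rewrite scaleN1r addNr.
Qed.

Lemma graded_Z i c x : g i x -> g i (c *: x).
Proof.
move=> Hx; rewrite -[_ *: _]addr0.
by apply: (graded_linear (gca_graded HA)) => //; exact: graded_0.
Qed.

Lemma graded_superring : superring g.
Proof.
split.
- exact: graded_0.
- move=> i x y Hx Hy; rewrite -[x]scale1r.
  exact: (graded_linear (gca_graded HA)).
- by move=> i x Hx; rewrite -scaleN1r; apply: graded_Z.
- exact: gca_one HA.
- move=> i j x y; exact: (gca_mul HA).
- by move=> i j x y Hx Hy; rewrite (gca_comm HA Hx Hy) sgZsign.
Qed.

Variable k : int.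
Hypothesis k_odd : odd `|k|%N.

(** This is where the oddness of k enters: t is even, so all coefficients of a homogeneous series
    have the same parity. *)
Lemma par_shift i n : par (i + n%:Z * (k - 1)) = par i.
Proof.
rewrite parD parM; have -> : par (k - 1) = false; last by rewrite andbF addbF.
by rewrite parD parN /par k_odd.
Qed.

Lemma ps_superring : superring (ps_homog k g).
Proof.
have HS := graded_superring; split.
- by move=> i n; exact: (sr_0 HS).
- by move=> i x y Hx Hy n; apply: (sr_D HS).
- by move=> i x Hx n; apply: (sr_N HS).
- case=> [|n]; last exact: (sr_0 HS).
  by rewrite /= mul0r addr0; exact: (sr_1 HS).
- move=> i j x y Hx Hy n; apply: (sr_sum HS) => m _.
  have -> : i + j + n%:Z * (k - 1) =
      (i + m%:Z * (k - 1)) + (j + (n - m)%N%:Z * (k - 1)).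
    by rewrite addrACA -mulrDl -PoszD subnKC // -ltnS.
  exact: (sr_M HS).
- move=> i j x y Hx Hy; apply: funext => n.
  rewrite ps_sg !ps_M (sum_ord_rev (fun i j => x i * y j)) sg_sum.
  apply: eq_bigr => m _; rewrite (sr_C HS (Hx _) (Hy _)).
  by rewrite !par_shift.
Qed.

Definition coef_letter (x : letter (ps_homog k g)) i : letter g :=
  Letter (lgr x i).

Lemma lpar_coef x i : lpar (coef_letter x i) = lpar x.
Proof. exact: par_shift. Qed.

Lemma ps_const_homog i x : g i x -> ps_homog k g i (ps_const x).
Proof.
move=> Hx [|n] /=; last exact: graded_0.
by rewrite mul0r addr0.
Qed.

End Graded.

Definition ps_op (V W : zmodType) (D : nat -> V -> W) (x : pser V) : pser W :=
  fun n => \sum_(j < n.+1) D j (x (n - j)%N).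

Lemma ps_op_addmap (V W : zmodType) (D : nat -> V -> W) :
  (forall j, addmap (D j)) -> addmap (ps_op D).
Proof.
move=> HD x y; apply: funext => n; rewrite ps_D /ps_op -big_split /=.
by apply: eq_bigr => j _; rewrite HD.
Qed.

(** * Leading coefficients of brackets of series *)

Section Leading.
Variables (K : fieldType) (A : algType K) (g : grading A).
Hypothesis HA : graded_comm_alg g.
Variable k : int.
Hypothesis k_odd : odd `|k|%N.
Implicit Types (D : nat -> A -> A).

Lemma ps_op_deg D e : (forall j, op_deg g (e + j%:Z * (k - 1)) (D j)) ->
  op_deg (ps_homog k g) e (ps_op D).
Proof.
move=> HD i x Hx n; apply: (sr_sum (graded_superring HA)) => m _.
have -> : i + e + n%:Z * (k - 1) =
    (i + (n - m)%N%:Z * (k - 1)) + (e + m%:Z * (k - 1)).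
  by rewrite addrACA -mulrDl -PoszD subnK // -ltnS.
exact: HD.
Qed.

(** The coefficient of t^N in the commutator with the series [x], as an operator on A: commutators
    of operator series are again operator series, so induction on the word applies. *)
Definition ad_coef p D (x : letter (ps_homog k g)) N y : A :=
  \sum_(i < N.+1) ad p (D (N - i)%N) (coef_letter x i) y.

Lemma ad_ps_op p D x : (forall j, addmap (D j)) ->
  ad p (ps_op D) x =1 ps_op (ad_coef p D x).
Proof.
move=> aD y; apply: funext => n; rewrite /ad.
rewrite ps_D ps_N ps_sg ps_M {1}/ps_op.
under eq_bigr => j _ do rewrite ps_M (addmap_sum (aD j)).
rewrite (sum_triangle (fun j i l => D j (lval x i * y l))).
under [X in _ - sg _ X]eq_bigr => i _ do rewrite /ps_op mulr_sumr.
rewrite (sum_triangle (fun i j l => lval x i * D j (y l))).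
rewrite sg_sum -sumrB; apply: eq_bigr => m _; rewrite /ad_coef.
rewrite (sum_ord_rev (fun j i => D j (lval x i * y (n - m)%N))).
rewrite sg_sum -sumrB; apply: eq_bigr => i _.
by rewrite /ad lpar_coef.
Qed.

Lemma ad_coef_addmap p D x N : (forall j, addmap (D j)) -> addmap (ad_coef p D x N).
Proof.
move=> aD y z; rewrite /ad_coef -big_split; apply: eq_bigr => i _.
exact: ad_addmap.
Qed.

Fixpoint vanish_below (w : seq (letter (ps_homog k g) * nat)) : Prop :=
  if w is x :: w' then
    (forall j, (j < x.2)%N -> lval x.1 j = 0) /\ vanish_below w'
  else True.

(** Orders in t add up: a letter of order i raises the order r of the operator series to r + i in
    its commutator, and only leading coefficients meet at the total order. *)
Lemma KK_lead p D r (w : seq (letter (ps_homog k g) * nat)) :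
  (forall j, addmap (D j)) ->
  (forall j c, (j < r)%N -> size c = size w -> KK p (D j) (c : seq (letter g)) = 0) ->
  vanish_below w ->
  (forall N, (N < r + sumn (map snd w))%N ->
     KK p (ps_op D) (map fst w) N = 0) /\
  KK p (ps_op D) (map fst w) (r + sumn (map snd w))%N =
    KK p (D r) [seq coef_letter x.1 x.2 | x <- w].
Proof.
elim: w p D r => [|[x i] w IH] p D r aD.
  move=> Hr _ /=; rewrite addn0 /ps_op.
  have E N : (\sum_(j < N.+1) D j ((1 : pser A) (N - j)%N)) = D N 1.
    rewrite (sum_ord_rev (fun j i => D j ((1 : pser A) i))) big_ord_recl subn0.
    by rewrite big1 ?addr0 // => i _; exact: addmap0.
  by split=> [N HN|]; rewrite E //; apply: (Hr N [::]).
move=> Hr [/= x0 Hv].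
have E N (c : seq (letter g)) : KK (p (+) lpar x) (ad_coef p D x N) c =
    \sum_(j < N.+1) KK p (D (N - j)%N) (coef_letter x j :: c).
  rewrite KK_sum; apply: eq_bigr => j _.
  by rewrite -[RHS]/(KK (p (+) lpar (coef_letter x j)) _ c) (lpar_coef k_odd).
(* A summand vanishes unless letter and operator have both reached their orders i and r; at N = r +
   i only j = i is left. *)
have vanish N j (c : seq (letter g)) : (j < i)%N || (N - j < r)%N ->
    size c = size w -> KK p (D (N - j)%N) (coef_letter x j :: c) = 0.
  move=> HN Hc; case: (ltnP j i) HN => /= Hji HN; last first.
    by apply: (Hr _ (coef_letter x j :: c)); rewrite //= Hc.
  rewrite /= -[RHS](KK_0 (p (+) lpar (coef_letter x j)) c); apply: eq_KK => y.
  by rewrite /ad /= x0 // !mul0r (addmap0 (aD _)) sg0 subrr.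
have [||//|H1 H2] := IH (p (+) lpar x) (ad_coef p D x) (r + i)%N.
- by move=> j; apply: ad_coef_addmap.
- move=> N c HN Hc; rewrite E // big1 // => j _.
  by apply: vanish => //; have := ltn_ord j; lia.
have EE N : KK (p (+) lpar x) (ad p (ps_op D) x) (map fst w) N =
    KK (p (+) lpar x) (ps_op (ad_coef p D x)) (map fst w) N.
  by rewrite (eq_KK _ _ (ad_ps_op p x aD)).
split=> [N HN|]; rewrite EE.
  by apply: H1; rewrite -addnA.
rewrite addnA H2 E.
have Hi : (i < (r + i).+1)%N by rewrite ltnS leq_addl.
rewrite (bigD1 (Ordinal Hi)) //= addnK big1 ?addr0 // => j Hj.
have {}Hj : (j : nat) != i by [].
apply: vanish; last by rewrite size_map.
by have := ltn_ord j; lia.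
Qed.

End Leading.

(** * Unshuffles and set partitions *)

Section PositionSplits.
Implicit Types (s u v : seq nat) (L : seq (seq nat)).

(** The sum [S2] as a list of pairs of positions; like [osplits] and [usplits], it mediates between
    the recursive sums and sums over permutations or partitions. *)
Fixpoint splits2 s : seq (seq nat * seq nat) :=
  if s is b :: s' then
    [seq (b :: p.1, p.2) | p <- splits2 s'] ++ [seq (p.1, b :: p.2) | p <- splits2 s']
  else [:: ([::], [::])].

Lemma splits2_perm s p : p \in splits2 s -> perm_eq (p.1 ++ p.2) s.
Proof.
elim: s p => [|b s IH] p /=; first by rewrite inE => /eqP->.
rewrite mem_cat => /orP[] /mapP[q /IH Hq ->] /=; first by rewrite perm_cons.
by rewrite -cat1s perm_catCA /= perm_cons.
Qed.

Lemma sorted_ltn_cons b s : sorted ltn (b :: s) = all (ltn b) s && sorted ltn s.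
Proof. by rewrite /= (path_sortedE ltn_trans). Qed.

Lemma mem_splits2 s u v : sorted ltn s -> ((u, v) \in splits2 s) =
  [&& sorted ltn u, sorted ltn v & perm_eq (u ++ v) s].
Proof.
elim: s u v => [|b s IH] u v Hs.
  rewrite /= inE; apply/eqP/and3P => [[-> ->]|[_ _ /perm_nilP]]; first by [].
  by case: u v => [|? ?] [].
move: (Hs); rewrite sorted_ltn_cons => /andP[Hb Hs'].
rewrite [splits2 _]/= mem_cat; apply/orP/and3P.
  case=> /mapP[[u' v'] Hp [-> ->]]; move: (Hp); rewrite IH //= => /and3P[S1 S2 P];
  have /= Hm := perm_mem (splits2_perm Hp).
  - rewrite perm_cons; split=> //; rewrite -/(sorted ltn (b :: u')) sorted_ltn_cons S1 andbT.
    by apply/allP => x Hx; apply: (allP Hb); rewrite -Hm mem_cat Hx.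
  - split=> //; last by rewrite -cat1s perm_catCA /= perm_cons.
    rewrite -/(sorted ltn (b :: v')) sorted_ltn_cons S2 andbT.
    by apply/allP => x Hx; apply: (allP Hb); rewrite -Hm mem_cat Hx orbT.
case=> S1 S2 P; have Hm := perm_mem P.
have Hmin x : x \in u ++ v -> (b <= x)%N.
  by rewrite Hm inE => /orP[/eqP->//|/(allP Hb)/ltnW].
have head_b t : sorted ltn t -> {subset t <= u ++ v} -> b \in t ->
    t = b :: behead t.
  case: t => // x t /=; rewrite (path_sortedE ltn_trans) => /andP[Hx _] Ht.
  rewrite inE => /orP[/eqP->//|/(allP Hx) /= xb].
  by have := Hmin x (Ht _ (mem_head _ _)); rewrite leqNgt xb.
have : b \in u ++ v by rewrite Hm mem_head.
rewrite mem_cat => /orP[bu|bv].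
  have Eu := head_b _ S1 (mem_subseq (prefix_subseq u v)) bu.
  left; apply/mapP; exists (behead u, v); rewrite -?Eu // IH // S2 /=.
  move: S1 P; rewrite Eu sorted_ltn_cons /= perm_cons => /andP[_ ->] ->.
  by [].
have Ev := head_b _ S2 (mem_subseq (suffix_subseq u v)) bv.
right; apply/mapP; exists (u, behead v); rewrite -?Ev // IH // S1 /=.
move: S2 P; rewrite Ev sorted_ltn_cons -cat1s perm_catCA /= perm_cons.
by move=> /andP[_ ->] ->.
Qed.

Lemma uniq_splits2 s : uniq s -> uniq (splits2 s).
Proof.
elim: s => //= b s IH /andP[bs /IH Us]; rewrite cat_uniq !map_inj_uniq ?Us //.
- rewrite andbT; apply/hasPn => _ /mapP[p Hp ->]; apply/mapP => -[q Hq [E _]].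
  move: bs; rewrite -(perm_mem (splits2_perm Hp)) E mem_cat mem_head.
  by [].
- by move=> [x y] [x' y'] [-> ->].
by move=> [x y] [x' y'] [-> ->].
Qed.

Fixpoint osplits m s : seq (seq (seq nat)) :=
  if m is m'.+1 then
    [seq p.1 :: L | p <- [seq p <- splits2 s | ~~ nilp p.1], L <- osplits m' p.2]
  else if nilp s then [:: [::]] else [::].

Fixpoint usplits m s : seq (seq (seq nat)) :=
  match m, s with
  | 0, _ => if nilp s then [:: [::]] else [::]
  | m'.+1, [::] => [::]
  | m'.+1, b :: s' =>
    [seq (b :: p.1) :: L | p <- splits2 s', L <- usplits m' p.2]
  end.

Lemma sorted_perm_sub u v s : sorted ltn s -> perm_eq (u ++ v) s ->
  exists2 v', sorted ltn v' & perm_eq v v'.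
Proof.
move=> Hs P; exists (sort leq v); last by rewrite perm_sym perm_sort.
rewrite ltn_sorted_uniq_leq sort_sorted ?andbT; last exact: leq_total.
have : uniq (u ++ v) by rewrite (perm_uniq P) (sorted_uniq ltn_trans ltnn).
by rewrite cat_uniq sort_uniq => /and3P[].
Qed.

Lemma mem_osplits m s L : sorted ltn s -> (L \in osplits m s) =
  [&& size L == m, all (fun l => ~~ nilp l) L, all (sorted ltn) L
    & perm_eq (flatten L) s].
Proof.
elim: m s L => [|m IH] s L Hs.
  rewrite /=; case: nilP => [->|s0]; rewrite ?inE.
    by case: L.
  rewrite in_nil; case: L => //=; apply/esym/negbTE; rewrite perm_sym.
  by apply/perm_nilP.
rewrite [osplits _ _]/=; apply/allpairsPdep/and4P.
  case=> [[u v] [L' [/= Hp HL ->]]]; move: Hp; rewrite mem_filter => /andP[/= u0].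
  rewrite mem_splits2 // => /and3P[S1 S2 P].
  move: HL; rewrite IH // => /and4P[/eqP <- H2 H3 H4].
  rewrite /= u0 S1 H2 H3 eqxx; split=> //.
  by apply: perm_trans P; rewrite perm_cat2l.
case: L => [[]//|u L] [/= /eqP[sL] /andP[u0 HL] /andP[Su SL] P].
have [v Sv Pv] := sorted_perm_sub Hs P.
exists (u, v); exists L; split=> //.
  rewrite mem_filter /= u0 mem_splits2 // Su Sv /=.
  by apply: perm_trans P; rewrite perm_cat2l perm_sym.
by rewrite IH // sL eqxx HL SL Pv.
Qed.

(** The head of a sorted block is its least element, so increasing heads single out one listing of
    each set partition. *)
Definition head_lt (l l' : seq nat) : bool := (head 0 l < head 0 l')%N.

Lemma head_lt_trans : transitive head_lt.
Proof. by move=> x y z; apply: ltn_trans. Qed.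

Lemma mem_usplits m s L : sorted ltn s -> (L \in usplits m s) =
  [&& size L == m, all (fun l => ~~ nilp l) L, all (sorted ltn) L,
    perm_eq (flatten L) s & sorted head_lt L].
Proof.
elim: m s L => [|m IH] s L Hs.
  rewrite /=; case: nilP => [->|s0]; rewrite ?inE.
    by case: L.
  rewrite in_nil; case: L => //=; apply/esym/negbTE; rewrite perm_sym andbT.
  by apply/perm_nilP.
case: s Hs => [|b s] Hs.
  rewrite [usplits _ _]/= in_nil; apply/esym/negbTE/and5P => -[/eqP sL HL _ /perm_nilP].
  by case: L sL HL => // -[|? ?] L.
move: (Hs); rewrite sorted_ltn_cons => /andP[Hb Hs'].
rewrite [usplits _ _]/=; apply/allpairsPdep/and5P.
  case=> [[u v] [L' [/= Hp HL ->]]]; move: Hp.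
  rewrite mem_splits2 // => /and3P[S1 S2 P].
  move: HL; rewrite IH // => /and5P[/eqP <- H2 H3 H4 H5].
  have Hin x : x \in u ++ v -> (b < x)%N.
    by rewrite (perm_mem P) => /(allP Hb).
  split; [by rewrite /= eqxx | by rewrite /= H2 | | |].
  - rewrite [all _ _]/= H3 andbT -/(sorted ltn (b :: u)) sorted_ltn_cons S1 andbT.
    by apply/allP => x Hx; apply: Hin; rewrite mem_cat Hx.
  - by rewrite /= perm_cons; apply: perm_trans P; rewrite perm_cat2l.
  - rewrite /= (path_sortedE head_lt_trans) H5 andbT; apply/allP => -[|x l] Hl.
      by move: (allP H2 _ Hl).
    apply: Hin; rewrite mem_cat -(perm_mem H4); apply/orP; right.
    by apply/flattenP; exists (x :: l) => //; rewrite mem_head.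
case: L => [[]//|u L] [/= /eqP[sL] /andP[u0 HL] /andP[Su SL] P].
rewrite (path_sortedE head_lt_trans) => /andP[Hh SLh].
(* The head of the first block is the least position of all, since blocks are sorted and ordered by
   their heads; hence it is b. *)
have {Hh} Eu : u = b :: behead u.
  case: u u0 Su P Hh => // x u _ Su P Hh /=; congr (_ :: _).
  have Hx y : y \in (x :: u) ++ flatten L -> (x <= y)%N.
    rewrite mem_cat inE -orbA => /or3P[/eqP->//| |].
      by move: Su; rewrite /= (path_sortedE ltn_trans) => /andP[/allP H _] /H /ltnW.
    case/flattenP => -[|z l] Hl //; rewrite inE => /orP[/eqP->|yl].
      by apply: ltnW; exact: (allP Hh _ Hl).
    apply: ltnW; apply: ltn_trans (allP Hh _ Hl) _ => /=.
    by move: (allP SL _ Hl); rewrite /= (path_sortedE ltn_trans) => /andP[/allP/(_ _ yl)].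
  apply/eqP; rewrite eqn_leq Hx ?(perm_mem P) ?mem_head //=.
  have : x \in b :: s by rewrite -(perm_mem P) mem_head.
  by rewrite inE => /orP[/eqP->//|/(allP Hb)/ltnW].
move: Su P; rewrite Eu sorted_ltn_cons /= perm_cons => /andP[_ Su] P.
have [v Sv Pv] := sorted_perm_sub Hs' P.
exists (behead u, v); exists L; split=> //; last by rewrite IH // sL eqxx HL SL Pv.
rewrite mem_splits2 // Su Sv /=.
by apply: perm_trans P; rewrite perm_cat2l perm_sym.
Qed.

Lemma uniq_osplits m s : sorted ltn s -> uniq (osplits m s).
Proof.
elim: m s => [|m IH] s Hs /=; first by case: nilp.
apply: allpairs_uniq_dep.
- apply: filter_uniq; apply: uniq_splits2; exact: sorted_uniq ltn_trans ltnn _ Hs.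
- move=> [u v]; rewrite mem_filter => /andP[_]; rewrite mem_splits2 // => /and3P[_ ? _].
  exact: IH.
move=> _ _ /allpairsPdep[[u v] [L [Hp HL ->]]] /allpairsPdep[[u' v'] [L' [Hp' HL' ->]]].
move=> [/= Eu EL]; move: Hp Hp'; rewrite !mem_filter /= => /andP[_ Hp] /andP[_ Hp'].
have E : v = v'.
  move: Hp Hp' HL HL'; rewrite !mem_splits2 // => /and3P[_ S1 _] /and3P[_ S2 _].
  rewrite !mem_osplits //= => /and4P[_ _ _ P1] /and4P[_ _ _ P2].
  apply: (irr_sorted_eq ltn_trans ltnn S1 S2) => x.
  by rewrite -(perm_mem P1) -(perm_mem P2) EL.
by subst.
Qed.

Lemma uniq_usplits m s : sorted ltn s -> uniq (usplits m s).
Proof.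
elim: m s => [|m IH] [|b s] Hs //=.
move: (Hs); rewrite sorted_ltn_cons => /andP[_ Hs'].
apply: allpairs_uniq_dep.
- apply: uniq_splits2; exact: sorted_uniq ltn_trans ltnn _ Hs'.
- move=> [u v]; rewrite mem_splits2 // => /and3P[_ ? _]; exact: IH.
move=> _ _ /allpairsPdep[[u v] [L [Hp HL ->]]] /allpairsPdep[[u' v'] [L' [Hp' HL' ->]]].
move=> [/= Eu EL].
have E : v = v'.
  move: Hp Hp' HL HL'; rewrite !mem_splits2 // => /and3P[_ S1 _] /and3P[_ S2 _].
  rewrite !mem_usplits //= => /and5P[_ _ _ P1 _] /and5P[_ _ _ P2 _].
  apply: (irr_sorted_eq ltn_trans ltnn S1 S2) => x.
  by rewrite -(perm_mem P1) -(perm_mem P2) EL.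
by subst.
Qed.

End PositionSplits.

(** * Koszul signs as parities of inversions *)

Section PositionSigns.
Variable pd : nat -> bool.
Implicit Types (s u v : seq nat) (L : seq (seq nat)).

(** For sorted [u] and [v] these are all the inversions of [u ++ v], hence the sign of the
    unshuffle. *)
Definition cross u v : bool :=
  \big[addb/false]_(x <- u) \big[addb/false]_(y <- v | (y < x)%N) (pd x && pd y).

Fixpoint inversions s : bool :=
  if s is x :: s' then
    \big[addb/false]_(y <- s' | (y < x)%N) (pd x && pd y) (+) inversions s'
  else false.

Lemma inversions_cat u v :
  inversions (u ++ v) = inversions u (+) cross u v (+) inversions v.
Proof.
elim: u => [|x u IH] /=; first by rewrite /cross big_nil.
rewrite IH big_cat /cross big_cons /= -!addbA; congr (_ (+) _).
by rewrite !addbA; congr (_ (+) _ (+) _); rewrite addbC.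
Qed.

Lemma inversions_sorted s : sorted ltn s -> inversions s = false.
Proof.
elim: s => // x s IH; rewrite sorted_ltn_cons /= => /andP[/allP Hx /IH->].
by rewrite addbF big1_seq // => y /andP[yx /Hx /=]; rewrite ltnNge (ltnW yx).
Qed.

Lemma cross_perm u v v' : perm_eq v v' -> cross u v = cross u v'.
Proof. by move=> P; apply: eq_bigr => x _; apply: perm_big. Qed.

Variables (T : parType) (f : nat -> T).
Hypothesis Hf : forall i, lpar (f i) = pd i.

Lemma S2_splits (V : zmodType) (Phi : seq T -> seq T -> V) s : sorted ltn s ->
  S2 Phi (map f s) = \sum_(p <- splits2 s)
    sg (cross p.1 p.2) (Phi (map f p.1) (map f p.2)).
Proof.
elim: s Phi => [|b s IH] Phi; first by rewrite big_seq1 /cross big_nil.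
rewrite sorted_ltn_cons => /andP[Hb Hs].
rewrite /= big_cat !big_map /= !IH //; congr (_ + _); apply: eq_big_seq => -[u v] Hp /=.
  have Hm x : x \in u ++ v -> (b < x)%N.
    by rewrite (perm_mem (splits2_perm Hp)) => /(allP Hb).
  congr sg; rewrite /cross [RHS]big_cons [X in _ = X (+) _]big1_seq // => y /andP[yb Hy].
  by have := Hm y; rewrite mem_cat Hy orbT ltnNge (ltnW yb) => /(_ isT).
rewrite sgA; congr sg.
have Hm x : x \in u -> (b < x)%N.
  by move=> Hx; apply: (allP Hb); rewrite -(perm_mem (splits2_perm Hp)) mem_cat Hx.
elim: u Hm {Hp} => [|x u IHu] Hm.
  by rewrite /cross !big_nil /= andbF.
rewrite /cross !big_cons -/(cross u v) -/(cross u (b :: v)) -IHu; last first.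
  by move=> y Hy; apply: Hm; rewrite inE Hy orbT.
rewrite Hm ?mem_head // /= !Hf andb_addr -!addbA.
move: (\big[_/_]_(_ <- v | _) _) (cross u v) => c d.
by case: c; case: d; case: (pd b); case: (pd x); case: wpar.
Qed.

Lemma OS_osplits (V : zmodType) m (Phi : seq (seq T) -> V) s : sorted ltn s ->
  OS m Phi (map f s) = \sum_(L <- osplits m s)
    sg (inversions (flatten L)) (Phi (map (map f) L)).
Proof.
elim: m Phi s => [|m IH] Phi s Hs.
  by rewrite /= /nilp size_map; case: (_ == _); rewrite ?big_seq1 ?big_nil.
rewrite OS_S S2_splits // [osplits _ _]/= big_allpairs_dep big_filter.
rewrite [RHS]big_mkcond; apply: eq_big_seq => -[u v] Hp /=.
rewrite /nilp size_map; case: ifP => u0; first by rewrite sg0.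
move: (Hp); rewrite mem_splits2 // => /and3P[Su Sv _].
rewrite IH // sg_sum; apply: eq_big_seq => L HL; rewrite sgA; congr sg.
rewrite inversions_cat (inversions_sorted Su) /= (@cross_perm u v (flatten L)) //.
by move: HL; rewrite mem_osplits // => /and4P[_ _ _]; rewrite perm_sym.
Qed.

Lemma US_usplits (V : zmodType) m (Phi : seq (seq T) -> V) s : sorted ltn s ->
  US m Phi (map f s) = \sum_(L <- usplits m s)
    sg (inversions (flatten L)) (Phi (map (map f) L)).
Proof.
elim: m Phi s => [|m IH] Phi s Hs.
  by rewrite /= /nilp size_map; case: (_ == _); rewrite ?big_seq1 ?big_nil.
case: s Hs => [|b s]; first by rewrite /= big_nil.
rewrite sorted_ltn_cons => /andP[Hb Hs].
rewrite [LHS]/= S2_splits // [usplits _ _]/= big_allpairs_dep.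
apply: eq_big_seq => -[u v] Hp /=.
move: (Hp); rewrite mem_splits2 // => /and3P[Su Sv P].
rewrite IH // sg_sum; apply: eq_big_seq => L HL; rewrite sgA; congr sg.
have PL : perm_eq v (flatten L).
  by move: HL; rewrite mem_usplits // => /and5P[_ _ _]; rewrite perm_sym.
rewrite inversions_cat (inversions_sorted Su) /= (@cross_perm u v (flatten L)) //.
rewrite big1_seq // => y /andP[yb]; rewrite mem_cat -(perm_mem PL) -mem_cat (perm_mem P).
by move=> /(allP Hb) /=; rewrite ltnNge (ltnW yb).
Qed.

End PositionSigns.

Section UnshuffleLists.
Variable n : nat.
Implicit Types (p : 'S_n).

Lemma size_plist p : size (plist p) = n.
Proof. by rewrite size_map size_enum_ord. Qed.

Lemma plist_perm p : perm_eq (plist p) (iota 0 n).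
Proof.
rewrite -val_enum_ord /plist map_comp; apply: perm_map.
apply: uniq_perm; rewrite ?(map_inj_uniq (@perm_inj _ p)) ?enum_uniq //.
move=> i; rewrite mem_enum; apply/mapP; exists (p^-1%g i); rewrite ?mem_enum //.
by rewrite permKV.
Qed.

Lemma plist_inj : injective (@plist n).
Proof.
move=> p q E; apply/permP => i; apply: val_inj.
have := congr1 (fun s => nth 0%N s i) E.
by rewrite !(nth_map i) -?enumT ?size_enum_ord // !nth_ord_enum.
Qed.

Lemma plist_surj s : perm_eq s (iota 0 n) -> exists p, plist p = s.
Proof.
move=> P; have sz : size s = n by rewrite (perm_size P) size_iota.
have Us : uniq s by rewrite (perm_uniq P) iota_uniq.
have Hlt (i : 'I_n) : (nth 0 s i < n)%N.
  have : nth 0%N s i \in s by rewrite mem_nth // sz.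
  by rewrite (perm_mem P) mem_iota.
have inj : injective (fun i : 'I_n => Ordinal (Hlt i)).
  move=> i j [] /eqP; rewrite nth_uniq ?sz // => /eqP; exact: val_inj.
exists (perm inj); apply: (@eq_from_nth _ 0%N); rewrite size_plist ?sz // => i Hi.
by rewrite (nth_map (Ordinal Hi)) -?enumT ?size_enum_ord // permE /= nth_enum_ord.
Qed.

Lemma sum_unshuffles (V : nmodType) sh (F : seq nat -> V) : sumn sh = n ->
  \sum_(s in unshuffles n sh) F (plist s) =
  \sum_(x <- [seq x <- permutations (iota 0 n) | all (sorted ltn) (reshape sh x)]) F x.
Proof.
move=> Hsh; rewrite -big_enum -(big_map (@plist n) xpredT F).
apply: perm_big; apply: uniq_perm.
- by rewrite map_inj_uniq ?enum_uniq //; exact: plist_inj.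
- by rewrite filter_uniq ?permutations_uniq.
move=> x; rewrite mem_filter mem_permutations; apply/mapP/andP.
  case=> p; rewrite mem_enum inE => /andP[_ Hp] ->; split=> //; exact: plist_perm.
case=> Hx /plist_surj[p Ep]; exists p => //.
by rewrite mem_enum inE Hsh eqxx Ep.
Qed.

(** An unshuffle is determined by its two increasing runs, which form a split of the positions. *)
Lemma sum_unshuffles2 (V : nmodType) i (F : seq nat -> seq nat -> V) : (i <= n)%N ->
  \sum_(s in unshuffles n [:: i; (n - i)%N]) F (take i (plist s)) (drop i (plist s)) =
  \sum_(p <- splits2 (iota 0 n) | size p.1 == i) F p.1 p.2.
Proof.
move=> Hi; rewrite (sum_unshuffles (fun x => F (take i x) (drop i x))); last first.
  by rewrite /= addn0 subnKC.
rewrite -[RHS]big_filter.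
rewrite -(big_map (fun x => (take i x, drop i x)) xpredT (fun y => F y.1 y.2)).
have Hs : sorted ltn (iota 0 n) by apply: iota_ltn_sorted.
apply: perm_big; apply: uniq_perm.
- rewrite map_inj_in_uniq ?filter_uniq ?permutations_uniq // => x y _ _ [E1 E2].
  by rewrite -(cat_take_drop i x) E1 E2 cat_take_drop.
- by rewrite filter_uniq // uniq_splits2 // iota_uniq.
move=> [u v]; rewrite mem_filter /= mem_splits2 //; apply/mapP/and4P.
  case=> x; rewrite mem_filter mem_permutations /= => /andP[] /and3P[S1 S2 _] P [-> ->].
  have sx : size x = n by rewrite (perm_size P) size_iota.
  rewrite S1 cat_take_drop P size_takel ?sx ?eqxx //.
  by move: S2; rewrite take_oversize // size_drop sx.
case=> /eqP Eu Su Sv P; exists (u ++ v).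
  rewrite mem_filter mem_permutations P andbT /= -Eu take_size_cat // drop_size_cat //.
  rewrite Su take_oversize ?Sv //.
  by have := perm_size P; rewrite size_cat size_iota => <-; rewrite addKn.
by rewrite -Eu take_size_cat // drop_size_cat.
Qed.

Lemma sum_unshuffles_all (V : nmodType) (F : seq nat -> seq nat -> V) lo :
  \sum_(lo <= i < n.+1) \sum_(s in unshuffles n [:: i; (n - i)%N])
     F (take i (plist s)) (drop i (plist s)) =
  \sum_(p <- splits2 (iota 0 n) | (lo <= size p.1)%N) F p.1 p.2.
Proof.
rewrite big_nat; under eq_bigr => i /andP[_ Hi] do rewrite sum_unshuffles2 //.
rewrite -big_nat; under eq_bigr => i _ do rewrite big_mkcond.
rewrite exchange_big [RHS]big_mkcond; apply: eq_big_seq => -[u v] /= Hp.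
rewrite -big_mkcond.
have su : (size u <= n)%N.
  by have := perm_size (splits2_perm Hp); rewrite size_cat size_iota => <-; apply: leq_addr.
case: ifPn => [lu|]; last first.
  rewrite -ltnNge => lu; rewrite big_nat_cond big1 // => i.
  by rewrite -andbA => /and3P[/(leq_trans lu) + _ /eqP E]; rewrite E ltnn.
rewrite -(big_filter _ (fun i => size u == i)).
rewrite (_ : [seq _ <- _ | _] = [:: size u]) ?big_seq1 //.
apply: perm_small_eq => //; apply: uniq_perm => //.
  by rewrite filter_uniq // iota_uniq.
move=> i; rewrite mem_filter mem_index_iota inE eq_sym.
by case: eqP => //= ->; rewrite lu ltnS.
Qed.

(** Composition and unshuffle are recovered from the list of blocks as its shape and its flattening,
    so the double sum is a single one. *)
Lemma sum_compositions (V : nmodType) m (F : seq (seq nat) -> V) :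
  \sum_(sh in compositions m n) \sum_(s in unshuffles n [seq val i | i <- sh])
    F (reshape [seq val i | i <- sh] (plist s)) =
  \sum_(L <- osplits m (iota 0 n)) F L.
Proof.
have Hsh (sh : m.-tuple 'I_n.+1) : sh \in compositions m n ->
    sumn [seq val i | i <- sh] = n by rewrite inE => /andP[/eqP].
pose P (sh : m.-tuple 'I_n.+1) := [seq x <- permutations (iota 0 n) |
  all (sorted ltn) (reshape [seq val i | i <- sh] x)].
transitivity (\sum_(sh <- enum (compositions m n)) \sum_(x <- P sh)
    F (reshape [seq val i | i <- sh] x)).
  rewrite big_enum; apply: eq_bigr => sh /Hsh E.
  exact: (sum_unshuffles (fun x => F (reshape [seq val i | i <- sh] x)) E).
rewrite -(big_allpairs_dep (h := fun (sh : m.-tuple 'I_n.+1) x =>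
  reshape [seq val i | i <- sh] x) (r1 := enum (compositions m n)) (r2 := P) (F := F)).
have Hs : sorted ltn (iota 0 n) by apply: iota_ltn_sorted.
have HP sh x : x \in P sh -> perm_eq x (iota 0 n).
  by rewrite mem_filter mem_permutations => /andP[].
have Hx sh x : x \in P sh -> size x = n.
  by move=> /HP/perm_size; rewrite size_iota.
apply: perm_big; apply: uniq_perm.
- apply: allpairs_uniq_dep; first exact: enum_uniq.
    by move=> sh _; rewrite filter_uniq ?permutations_uniq.
  move=> _ _ /allpairsPdep[sh [x [H1 H2 ->]]] /allpairsPdep[sh' [x' [H1' H2' ->]]] /= E.
  rewrite !mem_enum in H1 H1'.
  have Esh : sh = sh'.
    apply: val_inj; apply: (inj_map val_inj).
    rewrite -[LHS](@reshapeKl _ _ x) ?Hsh ?(Hx _ _ H2) //.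
    by rewrite E reshapeKl // Hsh ?(Hx _ _ H2').
  move: E H2'; rewrite -Esh => E H2'; congr existT.
  rewrite -[LHS](@reshapeKr _ [seq val i | i <- sh]) ?Hsh ?(Hx _ _ H2) //.
  by rewrite E reshapeKr // Hsh ?(Hx _ _ H2').
- exact: uniq_osplits.
move=> L; rewrite mem_osplits //; apply/allpairsPdep/and4P.
  case=> sh [x [H1 H2 ->]]; rewrite mem_enum in H1.
  have E := Hsh _ H1; have sx := Hx _ _ H2.
  have EL : shape (reshape [seq val i | i <- sh] x) = [seq val i | i <- sh].
    by rewrite reshapeKl // E sx.
  split.
  - by rewrite -(size_map size) -/(shape _) EL size_map size_tuple.
  - rewrite -(all_map size (fun i => i != 0%N)) -/(shape _) EL all_map.
    move: H1; rewrite inE => /andP[_]; apply: sub_all => i /=.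
    by rewrite lt0n.
  - by move: H2; rewrite mem_filter => /andP[].
  by rewrite reshapeKr ?E ?sx // (HP _ _ H2).
case=> /eqP sL HL SL PL.
have sn : sumn (shape L) = n.
  by rewrite -size_flatten (perm_size PL) size_iota.
have Hlt l : l \in L -> (size l < n.+1)%N.
  move=> Hl; rewrite ltnS -sn.
  have := (perm_to_rem Hl); move=> /(perm_map size)/perm_sumn ->.
  by rewrite /= leq_addr.
have Hsz : size (map (fun l => inord (size l) : 'I_n.+1) L) == m by rewrite size_map sL.
have Eval : [seq val i | i <- Tuple Hsz] = shape L.
  rewrite /= -map_comp; apply/eq_in_map => l Hl /=.
  by rewrite inordK // Hlt.
exists (Tuple Hsz), (flatten L); split.
- rewrite mem_enum inE Eval sn eqxx /=.
  rewrite -(all_map val (fun i => 0 < i)%N) Eval all_map.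
  by apply: sub_all HL => l /=; rewrite lt0n.
- by rewrite mem_filter mem_permutations PL Eval flattenK SL.
by rewrite Eval flattenK.
Qed.

End UnshuffleLists.

Lemma eq_inversions (pd pd' : nat -> bool) s :
  pd =1 pd' -> inversions pd s = inversions pd' s.
Proof.
move=> E; elim: s => //= x s ->; congr (_ (+) _).
by apply: eq_bigr => y _; rewrite !E.
Qed.

Lemma ksign_inversions (K : fieldType) (V : lmodType K) (g : grading V)
  (a : seq V) s :
  ksign g a s = (-1) ^+ inversions (fun i => par (gdeg g (nth 0 a i))) s.
Proof.
elim: s => [|x s IH]; first by rewrite /ksign big_ord0.
rewrite /ksign big_ord_recl /= signr_addb; congr (_ * _); last first.
  rewrite -IH; apply: eq_bigr => i _.
  by rewrite [LHS]big_mkcond big_ord_recl /= mul1r -big_mkcond.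
rewrite big_mkcond big_ord_recl /= mul1r.
elim: s {IH} => [|y s IH]; first by rewrite big_ord0 big_nil.
rewrite big_ord_recl big_cons /= IH; case: ifP => _ /=; last by rewrite mul1r.
by rewrite signr_addb -parM sign_par.
Qed.

(** * Homogeneous sequences as words *)

Section GradedDegree.
Variables (K : fieldType) (A : algType K) (g : grading A).
Hypothesis HA : graded_comm_alg g.

Lemma gdegP i x : g i x -> g (gdeg g x) x.
Proof. by move=> Hx; rewrite /gdeg; case: classical_sets.xgetP => [j _ //|/(_ i)]. Qed.

Lemma gdeg_uniq i j x : x != 0 -> g i x -> g j x -> i = j.
Proof.
move=> x0 Hi Hj; apply/eqP; apply: contraNT x0 => ij.
(* The components x in degree i and - x in degree j sum to 0, against the independence of
   homogeneous parts. *)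
pose c l := if l == i then x else if l == j then - x else 0.
have Hc l : g l (c l).
  rewrite /c; case: eqP => [->//|_]; case: eqP => [->|_]; last exact: graded_0.
  by rewrite -scaleN1r; apply: graded_Z.
have U : uniq [:: i; j] by rewrite /= inE ij.
have := graded_indep (gca_graded HA) U Hc; rewrite !big_cons big_nil /c !eqxx.
rewrite [j == i]eq_sym (negbTE ij) addr0 subrr => /(_ (erefl _) i (mem_head _ _)).
by rewrite eqxx => ->.
Qed.

Definition par_compat (g' : grading A) :=
  forall i x, g i x -> par (gdeg g' x) = par (gdeg g x).

Lemma par_compat_shift m : par m = false -> par_compat (shift m g).
Proof.
move=> Hm i x Hx; have [->|x0] := eqVneq x 0.
  (* On 0 both degrees are chosen from the same predicate, true everywhere, so even the arbitrary
     choices coincide. *)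
  congr (par _); rewrite /gdeg; congr (classical_sets.xget _ _).
  by apply: funext => j; apply: propext; split=> _; exact: (graded_0 HA).
have Hx' : shift m g (i - m) x by rewrite /shift subrK.
have H : g (gdeg (shift m g) x + m) x.
  by rewrite /gdeg; case: classical_sets.xgetP => [j _ //|/(_ (i - m))].
by rewrite (gdeg_uniq x0 (gdegP Hx) H) parD Hm addbF.
Qed.

Lemma par_compat_id : par_compat g. Proof. by []. Qed.

(** Words whose letters carry the degrees used by [ksign]; on them the signs of the definitions
    agree with those of words. *)
Definition tagged (w : seq (letter g)) :=
  map (@ldeg _ g) w = map (gdeg g) (map (@lval _ g) w).

Lemma tagged_exists a : homogeneous g a ->
  exists2 w : seq (letter g), map (@lval _ g) w = a & tagged w.
Proof.
elim: a => [|x a IH] Ha; first by exists [::].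
have [|w Ew Tw] := IH; first by move=> y Hy; apply: Ha; rewrite inE Hy orbT.
have [i Hi] := Ha x (mem_head _ _).
exists (Letter (gdegP Hi) :: w); first by rewrite /= Ew.
by rewrite /tagged /= Tw.
Qed.

Lemma tagged_deg w : tagged w -> wdeg w = \sum_(x <- map (@lval _ g) w) gdeg g x.
Proof.
by move=> Tw; rewrite /wdeg -(big_map (@ldeg _ g) xpredT id) Tw !big_map.
Qed.

Lemma letters_homogeneous (w : seq (letter g)) : homogeneous g (map (@lval _ g) w).
Proof.
elim: w => // l w IH x; rewrite inE => /orP[/eqP->|/IH//].
by exists (ldeg l); apply: lgr.
Qed.

(** A nonzero value determines its degree, and a letter of value 0 makes F vanish. Hence results for
    tagged words extend to all words. *)
Lemma word_lin_retag (V : lmodType K) (F : seq (letter g) -> V) (w w' : seq (letter g)) :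
  word_lin F -> map (@lval _ g) w = map (@lval _ g) w' -> F w = F w'.
Proof.
move=> HF E; suff H s : F (s ++ w) = F (s ++ w') by exact: (H [::]).
elim: w w' E s => [|l w IH] [|l' w'] //= [El Ew] s.
have [l0|l0] := eqVneq (lval l) 0.
  by rewrite !(word_lin_0 _ _ HF) // -El.
have -> : l = l'.
  by apply: letter_eq => //; apply: (gdeg_uniq l0 (lgr l)); rewrite El; apply: lgr.
by rewrite -!cat_rcons (IH _ Ew).
Qed.

Section WordSums.
Variables (w : seq (letter g)) (g' : grading A).
Hypothesis Tw : tagged w.
Hypothesis Hg' : par_compat g'.
Let a := map (@lval _ g) w.
Let l0 : letter g := Letter (graded_0 HA (gdeg g 0)).
Let f i := nth l0 w i.

Let nth_a i : nth 0 a i = lval (f i).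
Proof.
rewrite /f; case: (ltnP i (size w)) => Hi; first by rewrite (nth_map l0).
by rewrite !nth_default // size_map.
Qed.

Let par_f i : lpar (f i) = par (gdeg g' (nth 0 a i)).
Proof.
rewrite nth_a (Hg' (lgr (f i))); congr par; rewrite /f.
case: (ltnP i (size w)) => Hi; last by rewrite nth_default.
have := congr1 (fun s => nth 0 s i) Tw.
by rewrite (nth_map l0) // -map_comp (nth_map l0).
Qed.

Let mapf : map f (iota 0 (size a)) = w.
Proof. by rewrite size_map -/(mkseq f (size w)) mkseq_nth. Qed.

Let pick s : pick_seq a s = map (@lval _ g) (map f s).
Proof. by rewrite /pick_seq -map_comp; apply: eq_map => i; rewrite nth_a. Qed.

Let sign s (V : lmodType K) (x : V) :
  ksign g' a s *: x = sg (inversions (fun i => lpar (f i)) s) x.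
Proof.
rewrite ksign_inversions sgE; congr sg; apply: eq_inversions => i.
by rewrite par_f.
Qed.

Let iota_ltn n : sorted ltn (iota 0 n).
Proof. exact: iota_ltn_sorted. Qed.

Lemma sum_unshuffles_S2 (V : lmodType K) lo (Phi : seq A -> seq A -> V) :
  \sum_(lo <= i < (size a).+1) \sum_(s in unshuffles (size a) [:: i; (size a - i)%N])
    ksign g' a (plist s) *: Phi (take i (pick_seq a (plist s)))
                                (drop i (pick_seq a (plist s))) =
  S2 (fun u v => if (lo <= size u)%N then
                   Phi (map (@lval _ g) u) (map (@lval _ g) v) else 0) w.
Proof.
pose F u v := ksign g' a (u ++ v) *:
  Phi (map (@lval _ g) (map f u)) (map (@lval _ g) (map f v)).
transitivity (\sum_(lo <= i < (size a).+1)
    \sum_(s in unshuffles (size a) [:: i; (size a - i)%N])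
      F (take i (plist s)) (drop i (plist s))).
  apply: eq_bigr => i _; apply: eq_bigr => s _.
  by rewrite /F cat_take_drop !pick !map_take !map_drop.
rewrite sum_unshuffles_all -[in RHS]mapf (S2_splits (pd := fun i => lpar (f i))) //.
rewrite big_mkcond; apply: eq_big_seq => -[u v] /= Hp.
rewrite size_map; case: ifP; rewrite ?sg0 // => _; rewrite /F sign; congr sg.
move: Hp; rewrite mem_splits2 // => /and3P[Su Sv _].
by rewrite inversions_cat !inversions_sorted // addbF.
Qed.

Lemma composition_OS (U W : lmodType K) lo (q : seq W -> U) (F : seq A -> W) :
  composition g' lo q F a = \sum_(lo <= m < (size a).+1)
    (m`!)%:R^-1 *: OS m (fun L => q [seq F (map (@lval _ g) l) | l <- L]) w.
Proof.
rewrite /composition; apply: eq_bigr => m _.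
rewrite -[in RHS]mapf (OS_osplits (pd := fun i => lpar (f i))) //.
rewrite -sum_compositions scaler_sumr; apply: eq_bigr => sh Hsh.
rewrite scaler_sumr; apply: eq_bigr => s _.
rewrite reshapeKr; last first.
  by move: Hsh; rewrite inE size_plist => /andP[/eqP -> _].
rewrite -scalerA sign; congr (_ *: sg _ (q _)).
by rewrite pick -!map_reshape -!map_comp.
Qed.

End WordSums.
End GradedDegree.

(** * Set partitions as lists of blocks *)

Section SetPartitions.
Variable n : nat.
Implicit Types (S : {set 'I_n}) (P : {set {set 'I_n}}) (L : seq (seq nat)).

Definition set_block S : seq nat := [seq val i | i <- enum S].

Definition blocks P : seq (seq nat) := [seq set_block Z | Z <- enum P].

Lemma mem_set_block S (i : 'I_n) : (val i \in set_block S) = (i \in S).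
Proof. by rewrite mem_map ?mem_enum //; exact: val_inj. Qed.

Lemma set_block_lt S x : x \in set_block S -> (x < n)%N.
Proof. by case/mapP => i _ ->; exact: ltn_ord. Qed.

Lemma sorted_set_block S : sorted ltn (set_block S).
Proof.
have /(subseq_sorted ltn_trans) : subseq (set_block S) (iota 0 n).
  rewrite -val_enum_ord /set_block; apply: map_subseq.
  have -> : enum S = [seq i <- enum 'I_n | i \in S] by rewrite enumT.
  exact: filter_subseq.
by apply; exact: iota_ltn_sorted.
Qed.

Lemma set_block_inj : injective set_block.
Proof. by move=> S S' E; apply/setP => i; rewrite -!mem_set_block E. Qed.

Lemma uniq_flatten_eq (L : seq (seq nat)) l l' x : uniq (flatten L) ->
  l \in L -> l' \in L -> x \in l -> x \in l' -> l = l'.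
Proof.
elim: L => //= m L IH; rewrite cat_uniq => /and3P[_ /hasPn H U].
have H' y k : y \in m -> k \in L -> y \in k -> False.
  move=> ym kL yk; have /H : y \in flatten L by apply/flattenP; exists k.
  by rewrite /= ym.
rewrite !inE => /orP[/eqP->|lL] /orP[/eqP->|l'L] // xl xl'.
- by have := H' _ _ xl l'L xl'.
- by have := H' _ _ xl' lL xl.
exact: IH.
Qed.

Lemma uniq_blocks L : all (fun l => ~~ nilp l) L -> uniq (flatten L) ->
  uniq (map (head 0%N) L).
Proof.
elim: L => [//|l L IH] /andP[Hl HL]; rewrite [flatten _]/= cat_uniq => /and3P[_ /hasPn H U].
rewrite [map _ _]/= cons_uniq IH // andbT; apply/mapP => -[l' Hl' E].
have hl' : head 0%N l' \in l' by move: (allP HL _ Hl'); case: (l') => // x k _; exact: mem_head.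
have /H /= : head 0%N l' \in flatten L by apply/flattenP; exists l'.
by rewrite -E; move: Hl; case: (l) => //= x k _; rewrite mem_head.
Qed.

Section OnePartition.
Variable P : {set {set 'I_n}}.
Hypothesis HP : partition P [set: 'I_n].

Lemma blocks_nonnil : all (fun l => ~~ nilp l) (blocks P).
Proof.
rewrite all_map; apply/allP => S; rewrite mem_enum => HS /=.
rewrite /nilp size_map -cardE cards_eq0; apply: contraTneq HS => ->.
by case/and3P: HP.
Qed.

Lemma blocks_perm : perm_eq (flatten (blocks P)) (iota 0 n).
Proof.
case/and3P: HP => /eqP Pc Pt _.
have sub : {subset iota 0 n <= flatten (blocks P)}.
  move=> x; rewrite mem_iota => /= Hx.
  have : Ordinal Hx \in cover P by rewrite Pc inE.
  case/bigcupP => S HS xS; apply/flattenP; exists (set_block S).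
    by apply: map_f; rewrite mem_enum.
  by rewrite -[x]/(val (Ordinal Hx)) mem_set_block.
have sz : size (flatten (blocks P)) = n.
  move: Pt; rewrite /trivIset Pc cardsT card_ord => /eqP <-.
  rewrite size_flatten /shape -map_comp sumnE big_map big_enum.
  by apply: eq_bigr => S _; rewrite /= size_map -cardE.
have U : uniq (flatten (blocks P)).
  by apply: (leq_size_uniq (iota_uniq 0 n)) => //; rewrite size_iota sz.
apply: uniq_perm; rewrite ?iota_uniq // => x; apply/idP/idP; last exact: sub.
by case/flattenP => _ /mapP[S _ ->] /set_block_lt; rewrite mem_iota.
Qed.

Lemma blocks_usplits :
  sort (relpre (head 0%N) leq) (blocks P) \in usplits #|P| (iota 0 n).
Proof.
rewrite mem_usplits; last exact: iota_ltn_sorted.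
have Pe : perm_eq (sort (relpre (head 0%N) leq) (blocks P)) (blocks P).
  by rewrite perm_sort.
have F : perm_eq (flatten (sort (relpre (head 0%N) leq) (blocks P))) (iota 0 n).
  by apply: perm_trans blocks_perm; apply: perm_flatten.
rewrite size_sort size_map -cardE eqxx F (perm_all _ Pe) blocks_nonnil (perm_all _ Pe) /=.
have -> : all (sorted ltn) (blocks P).
  by rewrite all_map; apply/allP => S _; exact: sorted_set_block.
rewrite /= -[sorted _ _]/(sorted (relpre (head 0%N) ltn) _) -sorted_map.
rewrite ltn_sorted_uniq_leq uniq_blocks /=; first 1 last.
- by rewrite (perm_all _ Pe) blocks_nonnil.
- by rewrite (perm_uniq F) iota_uniq.
by rewrite sorted_map; apply: sort_sorted => l l'; apply: leq_total.
Qed.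

End OnePartition.

Lemma partition_of_blocks m L : L \in usplits m (iota 0 n) ->
  exists2 P, partition P [set: 'I_n] & perm_eq (blocks P) L.
Proof.
rewrite mem_usplits; last exact: iota_ltn_sorted.
move=> /and5P[_ HL SL PL _].
have UL : uniq (flatten L) by rewrite (perm_uniq PL) iota_uniq.
pose P := [set S | set_block S \in L].
have bl l : l \in L -> set_block [set i | val i \in l] = l.
  move=> Hl; apply: (irr_sorted_eq ltn_trans ltnn) => [||x].
  - exact: sorted_set_block.
  - exact: (allP SL).
  apply/idP/idP => [Hx|xl].
    have Hxn := set_block_lt Hx.
    by move: Hx; rewrite -[x]/(val (Ordinal Hxn)) mem_set_block inE.
  have Hxn : (x < n)%N.
    have : x \in flatten L by apply/flattenP; exists l.
    by rewrite (perm_mem PL) mem_iota.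
  by rewrite -[x]/(val (Ordinal Hxn)) mem_set_block inE.
exists P; last first.
  apply: uniq_perm.
  - by rewrite map_inj_uniq ?enum_uniq //; exact: set_block_inj.
  - by have := uniq_blocks HL UL; apply: map_uniq.
  move=> l; apply/mapP/idP => [[S]|Hl]; first by rewrite mem_enum inE => HS ->.
  by exists [set i | val i \in l]; rewrite ?mem_enum ?inE ?bl.
apply/and3P; split.
- apply/eqP/setP => i; rewrite inE; apply/bigcupP.
  have : val i \in flatten L by rewrite (perm_mem PL) mem_iota /=.
  case/flattenP => l Hl il; exists [set j | val j \in l]; rewrite inE ?bl //.
- apply/trivIsetP => S S'; rewrite !inE => HS HS'; apply: contraR.
  move=> /pred0Pn[i] /= /andP[iS iS']; apply/eqP/set_block_inj.
  by apply: (uniq_flatten_eq UL HS HS' (x := val i)); rewrite mem_set_block.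
rewrite inE /set_block enum_set0; apply: contraTN HL => /= H.
by apply/allPn; exists [::].
Qed.

(** The enumeration of a partition lists its blocks in an unspecified order; invariance of [Psi]
    allows sorting them by least element. *)
Lemma sum_partitions (V : nmodType) (Psi : seq (seq nat) -> V) :
  (forall L L', perm_eq L L' -> uniq (flatten L) -> Psi L = Psi L') ->
  \sum_(P : {set {set 'I_n}} | partition P [set: 'I_n]) Psi (blocks P) =
  \sum_(m < n.+1) \sum_(L <- usplits m (iota 0 n)) Psi L.
Proof.
move=> HPsi; pose canon P := sort (relpre (head 0%N) leq) (blocks P).
have Hs : sorted ltn (iota 0 n) by apply: iota_ltn_sorted.
transitivity (\sum_(L <- [seq canon P | P <- enum [pred P | partition P [set: 'I_n]]]) Psi L).
  rewrite big_map big_enum; apply: eq_bigr => P HP.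
  rewrite (HPsi _ (canon P)) //; first by rewrite perm_sym perm_sort.
  by rewrite (perm_uniq (blocks_perm HP)) iota_uniq.
rewrite -(big_mkord xpredT (fun m => \sum_(L <- usplits m (iota 0 n)) Psi L)).
rewrite -(big_allpairs_dep (h := fun (m : nat) (L : seq (seq nat)) => L)).
apply: perm_big; apply: uniq_perm.
- rewrite map_inj_in_uniq ?enum_uniq // => P P' _ _ E.
  have Hp : perm_eq (blocks P) (blocks P').
    apply: (@perm_trans _ (canon P)); first by rewrite perm_sym perm_sort.
    by rewrite E perm_sort.
  apply/setP => S; have := perm_mem Hp (set_block S).
  by rewrite !mem_map ?mem_enum //; exact: set_block_inj.
- apply: allpairs_uniq_dep; first exact: iota_uniq.
    by move=> m _; apply: uniq_usplits.
  move=> _ _ /allpairsPdep[m [L [_ H1 ->]]] /allpairsPdep[m' [L' [_ H2 ->]]] /= E.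
  move: H1 H2; rewrite !mem_usplits // => /and5P[/eqP <- _ _ _ _] /and5P[/eqP <- _ _ _ _].
  by rewrite E.
move=> L; apply/mapP/allpairsPdep.
  case=> P; rewrite mem_enum inE => HP ->; exists #|P|, (canon P); split=> //.
    rewrite mem_index_iota /= ltnS cardE -(size_map set_block).
    have := size_flatten_nonnil (T := ParType (fun _ : nat => false)) (blocks_nonnil HP).
    by move/leq_trans; apply; rewrite (perm_size (blocks_perm HP)) size_iota.
  exact: blocks_usplits.
case=> m [L' [_ HL ->]]; have [P HP Pe] := partition_of_blocks HL.
exists P; first by rewrite mem_enum inE.
apply: (irr_sorted_eq head_lt_trans (fun l => ltnn _)).
- by move: HL; rewrite mem_usplits // => /and5P[].
- by have := blocks_usplits HP; rewrite mem_usplits // => /and5P[].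
by move=> l; rewrite mem_sort (perm_mem Pe).
Qed.

End SetPartitions.

Section CrossSym.
Variable pd : nat -> bool.

Lemma cross_consl x u v : cross pd (x :: u) v =
  \big[addb/false]_(y <- v | (y < x)%N) (pd x && pd y) (+) cross pd u v.
Proof. by rewrite /cross big_cons. Qed.

Lemma cross_consr x u v : cross pd v (x :: u) =
  \big[addb/false]_(y <- v | (x < y)%N) (pd x && pd y) (+) cross pd v u.
Proof.
rewrite /cross [X in _ = X (+) _]big_mkcond -big_split /=.
by apply: eq_bigr => y _; rewrite big_cons; case: ifP => //= _; rewrite andbC.
Qed.

Lemma cross_catr u v v' : cross pd u (v ++ v') = cross pd u v (+) cross pd u v'.
Proof. by rewrite /cross -big_split; apply: eq_bigr => x _; rewrite big_cat. Qed.

(** Each pair of distinct positions is inverted in exactly one of the two orders. *)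
Lemma cross_sym u v : uniq (u ++ v) -> cross pd u v = cross pd v u (+)
  (\big[addb/false]_(x <- u) pd x && \big[addb/false]_(y <- v) pd y).
Proof.
elim: u => [_|x u IH].
  by rewrite big_nil addbF /cross big_nil; elim: v => [|y v IHv];
     rewrite ?big_nil // big_cons big_nil -IHv.
move=> /= /andP[xv /IH E]; rewrite cross_consl cross_consr E big_cons.
move: xv; rewrite mem_cat negb_or => /andP[_ xv].
have -> : \big[addb/false]_(y <- v | (y < x)%N) (pd x && pd y) =
    \big[addb/false]_(y <- v | (x < y)%N) (pd x && pd y) (+)
    (pd x && \big[addb/false]_(y <- v) pd y).
  elim: v xv {IH E} => [|y v IHv]; first by rewrite !big_nil andbF.
  rewrite inE negb_or => /andP[xy /IHv H]; rewrite !big_cons H.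
  by case: ltngtP xy => // _ _; case: (pd x); case: (pd y);
    case: (\big[_/_]_(_ <- v | _) _); case: (\big[_/_]_(_ <- v) _).
move: (\big[_/_]_(_ <- v | _) _) (cross _ v u) => c d.
by case: c; case: d; case: (pd x); case: (\big[_/_]_(_ <- v) _);
  case: (\big[_/_]_(_ <- u) _).
Qed.

End CrossSym.

Section CumulantSum.
Variables (K : fieldType) (A B : algType K) (g : grading A).
Hypothesis HA : graded_comm_alg g.
Variables (gr : int -> pser B -> Prop).
Hypothesis HR : superring gr.
Variable f : pser A -> pser B.

Definition exp_word (w : seq (letter g)) : pser B := f (ps_const (wprod w)).

Hypothesis f_deg : has_wdeg gr 0 exp_word.

Section Blocks.
Variables (t : nat -> letter g).
Let pd i := lpar (t i).

Definition signed_prod (L : seq (seq nat)) : pser B :=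
  sg (inversions pd (flatten L)) (\prod_(l <- L) exp_word (map t l)).

Lemma wpar_positions s : wpar (map t s) = \big[addb/false]_(x <- s) pd x.
Proof. by elim: s => [|x s IH]; rewrite ?big_nil // big_cons /= IH. Qed.

Lemma signed_prod_deg (L : seq (seq nat)) :
  gr (wdeg (map t (flatten L))) (\prod_(l <- L) exp_word (map t l)).
Proof.
rewrite map_flatten -(big_map (map t) xpredT exp_word).
exact: prod_wdeg.
Qed.

(** Exchanging two groups of blocks changes the sign of the flattened list exactly as supercommuting
    the corresponding factors does. *)
Lemma signed_prod_perm L L' : perm_eq L L' -> uniq (flatten L) ->
  signed_prod L = signed_prod L'.
Proof.
move=> P U; pose Q X := uniq (flatten X) -> signed_prod L = signed_prod X.
have Q1 : Q L by [].
suff /(_ _ _ P Q1) : forall s1 s2, perm_eq s1 s2 -> Q s1 -> Q s2.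
  by apply; rewrite -(perm_uniq (perm_flatten P)).
apply: catCA_perm_ind => s1 s2 s3 H U'.
have U1 : uniq (flatten (s1 ++ s2 ++ s3)).
  by rewrite (perm_uniq (perm_flatten (_ : perm_eq _ (s2 ++ s1 ++ s3)))) // perm_catCA.
rewrite H // /signed_prod !flatten_cat !inversions_cat !cross_catr !big_cat /= !mulrA.
rewrite (sr_C HR (signed_prod_deg s1) (signed_prod_deg s2)) sgMl sgA; congr sg.
move: U1; rewrite !flatten_cat catA cat_uniq => /andP[/(cross_sym pd) -> _].
rewrite -!wpar_wdeg !wpar_positions.
case: (\big[_/_]_(_ <- flatten s1) _); case: (\big[_/_]_(_ <- flatten s2) _);
case: (cross pd _ _); case: (cross pd _ _); case: (cross pd _ _);
case: (inversions _ _); case: (inversions _ _); by case: (inversions _ _).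
Qed.

End Blocks.

Lemma exp_word_block_sym : block_sym (fun L => \prod_(l <- L) exp_word l).
Proof. exact: (block_sym_prod HR f_deg). Qed.

Lemma cumulant_cum (w : seq (letter g)) m : tagged w -> ~~ nilp w ->
  cumulant g f (map (@lval _ g) w) m = cum exp_word w m.
Proof.
move=> Tw w0; set a := map _ w.
pose l0 : letter g := Letter (graded_0 HA (gdeg g 0)).
pose t i := nth l0 w i.
have nth_a i : nth 0 a i = lval (t i).
  rewrite /t; case: (ltnP i (size w)) => Hi; first by rewrite (nth_map l0).
  by rewrite !nth_default // size_map.
have par_t i : lpar (t i) = par (gdeg g (nth 0 a i)).
  rewrite nth_a; congr par; rewrite /t.
  case: (ltnP i (size w)) => Hi; last by rewrite nth_default.
  have := congr1 (fun s => nth 0 s i) Tw.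
  by rewrite (nth_map l0) // -map_comp (nth_map l0).
have mapt : map t (iota 0 (size a)) = w.
  by rewrite size_map -/(mkseq t (size w)) mkseq_nth.
have sa : size a = size w by rewrite size_map.
have EU (i : nat) (Phi : seq (seq (letter g)) -> pser B) : US i Phi w =
    \sum_(L <- usplits i (iota 0 (size w)))
      sg (inversions (fun i => lpar (t i)) (flatten L)) (Phi (map (map t) L)).
  rewrite -sa -{1}mapt; apply: US_usplits => //; exact: iota_ltn_sorted.
pose Psi L := sg (odd (size L).-1) (signed_prod t L m *+ (size L).-1`!).
transitivity (\sum_(P : {set {set 'I_(size a)}} | partition P [set: 'I_(size a)])
    Psi (blocks P)).
  apply: eq_bigr => P HP; rewrite /Psi /blocks size_map -cardE.
  rewrite -signr_odd mulrAC -!scalerA sgE; congr sg.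
  rewrite scalerA mulrC -scalerA scaler_nat; congr (_ *+ _).
  rewrite ksign_inversions sgE /signed_prod ps_sg.
  rewrite (@eq_inversions _ (fun i => lpar (t i))); last by move=> i; rewrite par_t.
  congr sg; congr (_ m); rewrite big_map; apply: eq_bigr => T _.
  rewrite /exp_word; congr (f (ps_const _)).
  rewrite /wprod /set_block !big_map; apply: eq_bigr => i _.
  by rewrite nth_a.
rewrite sum_partitions; last first.
  by move=> L L' P U; rewrite /Psi (signed_prod_perm t P U) (perm_size P).
(* A nonempty word has no decomposition into zero blocks; dropping this term aligns the index with
   that of [cum]. *)
rewrite sa big_ord_recl [X in X + _]big1_seq ?add0r; last first.
  by move=> L; case: (w) w0.
rewrite /cum ps_sumE; apply: eq_bigr => i _.
rewrite ps_sg ps_Mn EU ps_sumE -sumrMnl sg_sum; apply: eq_big_seq => L.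
rewrite mem_usplits; last exact: iota_ltn_sorted.
move=> /and5P[/eqP sL _ _ _ _]; rewrite /Psi sL /= big_map.
by [].
Qed.

End CumulantSum.

Section SeriesModule.
Variables (K : fieldType) (V : lmodType K).
Implicit Types x y : pser V.

Definition ps_scalar (c : K) x : pser V := fun n => c *: x n.

Lemma ps_scalarA c d x : ps_scalar c (ps_scalar d x) = ps_scalar (c * d) x.
Proof. by apply: funext => n; rewrite /ps_scalar scalerA. Qed.
Lemma ps_scalar1 : left_id 1 ps_scalar.
Proof. by move=> x; apply: funext => n; rewrite /ps_scalar scale1r. Qed.
Lemma ps_scalarDr : right_distributive ps_scalar +%R.
Proof. by move=> c x y; apply: funext => n; rewrite /ps_scalar !ps_D scalerDr. Qed.
Lemma ps_scalarDl x : {morph ps_scalar^~ x : c d / c + d}.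
Proof. by move=> c d; apply: funext => n; rewrite /ps_scalar ps_D scalerDl. Qed.

HB.instance Definition _ := GRing.Zmodule_isLmodule.Build K (pser V)
  ps_scalarA ps_scalar1 ps_scalarDr ps_scalarDl.

Lemma ps_Z c x n : (c *: x) n = c *: x n.
Proof. by []. Qed.

End SeriesModule.

Lemma ps_scaleAl (K : fieldType) (A : algType K) (c : K) (x y : pser A) :
  (c *: x) * y = c *: (x * y).
Proof.
apply: funext => n; rewrite ps_Z !ps_M scaler_sumr.
by apply: eq_bigr => i _; rewrite ps_Z scalerAl.
Qed.

Lemma ps_scaleAr (K : fieldType) (A : algType K) (c : K) (x y : pser A) :
  x * (c *: y) = c *: (x * y).
Proof.
apply: funext => n; rewrite ps_Z !ps_M scaler_sumr.
by apply: eq_bigr => i _; rewrite ps_Z scalerAr.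
Qed.

Definition linmap (K : fieldType) (V W : lmodType K) (f : V -> W) :=
  forall c x y, f (c *: x + y) = c *: f x + f y.

Lemma linmap_add (K : fieldType) (V W : lmodType K) (f : V -> W) :
  linmap f -> addmap f.
Proof. by move=> Hf x y; have := Hf 1 x y; rewrite !scale1r. Qed.

Lemma Mn_inj (K : fieldType) (V : lmodType K) n (x y : V) : [pchar K] =i pred0 ->
  (0 < n)%N -> x *+ n = y *+ n -> x = y.
Proof.
move=> charK n0; rewrite -!scaler_nat => /scalerI; apply.
by rewrite ((pcharf0P K).1 charK) -lt0n.
Qed.

Section LinearSeries.
Variables (K : fieldType) (V W : lmodType K) (f : pser V -> pser W).
Hypothesis f_lin : ps_linear f.

Lemma ps_const_D (U : zmodType) (x y : U) : ps_const (x + y) = ps_const x + ps_const y.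
Proof. by apply: funext => -[|n]; rewrite ps_D //= addr0. Qed.

Lemma ps_scale_const (U : lmodType K) c (x : pser U) : ps_scale (ps_const c) x = c *: x.
Proof.
apply: funext => n; rewrite /ps_scale ps_Z big_ord_recl subn0.
by rewrite big1 ?addr0 // => i _; rewrite scale0r.
Qed.

Definition ps_t : pser K := fun n => (n == 1%N)%:R.

Lemma ps_scale_t (U : lmodType K) (x : pser U) n :
  ps_scale ps_t x n = if n is m.+1 then x m else 0.
Proof.
rewrite /ps_scale; case: n => [|n]; first by rewrite big_ord1 scale0r.
rewrite big_ord_recl scale0r add0r big_ord_recl scale1r subSS subn0.
by rewrite big1 ?addr0 // => i _; rewrite scale0r.
Qed.

Lemma ps_linear_map : linmap f.
Proof.
move=> c x y; apply: funext => n; rewrite -!ps_scale_const.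
exact: (f_lin (ps_const c) x y n).
Qed.

(** Write x as its constant term plus t times the shifted series, pull t out by linearity, and
    induct on the coefficient. In particular, linearity over K[[t]] forces t-adic continuity. *)
Lemma ps_linear_op x : f x = ps_op (tcoef f) x.
Proof.
apply: funext => n; elim: n x => [|n IH] x; rewrite /ps_op.
  rewrite big_ord1 /tcoef -[LHS](_ :
    f (fun m => ps_scale ps_t (fun m => x m.+1) m + ps_const (x 0%N) m) 0%N = _).
    by rewrite f_lin ps_scale_t add0r.
  by congr (f _ _); apply: funext => -[|m]; rewrite ps_scale_t /= ?add0r ?addr0.
rewrite -[LHS](_ : f (fun m => ps_scale ps_t (fun m => x m.+1) m + ps_const (x 0%N) m) n.+1 = _).
  rewrite f_lin ps_scale_t IH /ps_op [RHS]big_ord_recr /= subnn; congr (_ + _).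
  by apply: eq_bigr => i _; rewrite subSn // -ltnS.
by congr (f _ _); apply: funext => -[|m]; rewrite ps_scale_t /= ?add0r ?addr0.
Qed.

Lemma tcoef_lin n : linmap (tcoef f n).
Proof.
move=> c x y; rewrite /tcoef -ps_Z -ps_D -ps_linear_map; congr (f _ _).
by apply: funext => -[|m]; rewrite ps_D ps_Z //= scaler0 addr0.
Qed.

Lemma tcoef_add n : addmap (tcoef f n).
Proof. exact: linmap_add (tcoef_lin n). Qed.

Lemma tcoef_deg k (gV : grading V) (gW : grading W) e n i x :
  (forall j, gV j 0) -> ps_degree k gV gW e f -> gV i x ->
  gW (i + (e + n%:Z * (k - 1))) (tcoef f n x).
Proof.
move=> g0 Hd Hx; rewrite addrA; apply: Hd => -[|m] /=; last exact: g0.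
by rewrite mul0r addr0.
Qed.

End LinearSeries.

Section KKLinear.
Variables (K : fieldType) (A : algType K) (g : grading A).
Hypothesis HA : graded_comm_alg g.
Let HR := graded_superring HA.

Lemma KK_Z p (c : K) (D : A -> A) (w : seq (letter g)) :
  KK p (fun x => c *: D x) w = c *: KK p D w.
Proof.
elim: w p D => //= l w IH p D; rewrite -IH; apply: eq_KK => x.
by rewrite /ad scalerBr -scalerAr sgZ.
Qed.

Lemma KK_word_lin p (D : A -> A) : linmap D -> word_lin (KK p D : seq (letter g) -> A).
Proof.
move=> HD c a b b' s1 s2 [E d1 d2]; elim: s1 p D HD => [|l s1 IH] p D HD /=.
  rewrite -d1 -d2 -KK_Z -KK_D; apply: eq_KK => x.
  rewrite /ad /= E -d1 -d2 !mulrDl -!scalerAl HD sgD opprD scalerBr sgZ.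
  by rewrite addrACA.
apply: IH => d x y; rewrite /ad mulrDr -scalerAr HD HD mulrDr -scalerAr sgD -sgZ.
by rewrite scalerBr opprD addrACA.
Qed.

(** The summand of [KK_S2] with nothing inside D does not occur in the definition; it is killed by D
    1 = 0. Retagging comes first because the signs of the definition use [gdeg]. *)
Lemma koszul_KK e (D : A -> A) (w : seq (letter g)) : linmap D -> op_deg g e D ->
  D 1 = 0 -> koszul g D (map (@lval _ g) w) = KK (par e) D w.
Proof.
move=> lD dD D1; have aD := linmap_add lD.
have [w' Ew Tw] := tagged_exists (@letters_homogeneous _ _ g w).
rewrite -Ew -(word_lin_retag HA (KK_word_lin (par e) lD) Ew).
rewrite (KK_S2 HR _ aD dD) //.
transitivity (\sum_(1 <= i < (size (map (@lval _ g) w')).+1)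
    \sum_(s in unshuffles (size (map (@lval _ g) w')) [:: i; (size (map (@lval _ g) w') - i)%N])
    ksign g (map (@lval _ g) w') (plist s) *:
      (fun u v => sg (odd (size v)) (D (\prod_(x <- u) x) * \prod_(x <- v) x))
      (take i (pick_seq (map (@lval _ g) w') (plist s)))
      (drop i (pick_seq (map (@lval _ g) w') (plist s)))).
  apply: eq_bigr => i _; apply: eq_bigr => s _ /=.
  have sz b n (r : 'S_n) : size (pick_seq b (plist r)) = n.
    by rewrite size_map size_plist.
  by rewrite -scalerA -signr_odd sgE size_drop sz.
rewrite (sum_unshuffles_S2 HA Tw (@par_compat_id _ _ _) 1%N
  (fun u v => sg (odd (size v)) (D (\prod_(x <- u) x) * \prod_(x <- v) x))).
apply: eq_S2 => -[|b u] v _; first by rewrite wprod_nil D1 mul0r sg0.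
by rewrite size_map /wprod !big_map.
Qed.

End KKLinear.

(** * Derived Poisson structures and morphisms *)

Section TaylorOfWords.
Variables (K : fieldType) (A B : algType K) (gA : grading A) (gB : grading B).
Hypotheses (HA : graded_comm_alg gA) (HB : graded_comm_alg gB).
Variable k : int.
Hypothesis k_odd : odd `|k|%N.

Lemma par_1k : par (1 - k) = false.
Proof. by rewrite parD parN /par k_odd. Qed.

Lemma homogeneous_shift m (a : seq A) : homogeneous (shift m gA) a -> homogeneous gA a.
Proof. by move=> Ha x /Ha [i Hi]; exists (i + m). Qed.

Lemma gdeg_shift m i (x : A) : x != 0 -> gA i x -> gdeg (shift m gA) x = i - m.
Proof.
move=> x0 Hi; have H : gA (gdeg (shift m gA) x + m) x.
  rewrite /gdeg; case: classical_sets.xgetP => [j _ //|/(_ (i - m))].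
  by rewrite /shift subrK.
by rewrite (gdeg_uniq HA x0 Hi H) addrK.
Qed.

Lemma word_lin_mem0 (V : lmodType K) (F : seq (letter gA) -> V) w :
  word_lin F -> 0 \in map (@lval _ gA) w -> F w = 0.
Proof.
move=> HF H0; suff H s : F (s ++ w) = 0 by exact: (H [::]).
elim: w H0 s => // l w IH; rewrite inE => /orP[/eqP l0|/IH H] s.
  by rewrite (word_lin_0 _ _ HF).
by rewrite -cat_rcons H.
Qed.

(** In the degree condition, n arguments in A[1-k] contribute n (k - 1) and the value takes one k -
    1 back. *)
Lemma taylor_of_words e (F : seq (letter gA) -> B) (q : seq A -> B) :
  (forall w, ~~ nilp w -> q (map (@lval _ gA) w) = F w) ->
  word_lin F -> word_sym F ->
  (forall w, ~~ nilp w -> gB (wdeg w + (size w).-1%:Z * (k - 1) + e) (F w)) ->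
  taylor_family (shift (1 - k) gA) (shift (1 - k) gB) e q.
Proof.
move=> Hq Flin Fsym Fdeg.
have words a : homogeneous (shift (1 - k) gA) a ->
    exists2 w : seq (letter gA), map (@lval _ gA) w = a & tagged w.
  by move/homogeneous_shift/tagged_exists.
split.
- move=> a a0 /words[w Ew Tw]; have w0 : ~~ nilp w.
    by rewrite /nilp -(size_map (@lval _ gA)) Ew -lt0n.
  (* An argument 0 has an arbitrary degree, but it makes the value 0, which lies in every degree. *)
  rewrite -Ew Hq //; case: (boolP (0 \in a)) => [H0|H0].
    by rewrite (word_lin_mem0 Flin) ?Ew //; exact: (graded_0 HB).
  have := Fdeg w w0; rewrite /shift; congr (gB _ _).
  have -> : \sum_(x <- map (@lval _ gA) w) gdeg (shift (1 - k) gA) x =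
      wdeg w - (size w)%:Z * (1 - k).
    rewrite big_map; move: H0; rewrite -Ew.
    elim: (w) => [|l w' IH]; first by rewrite big_nil wdeg_nil mul0r.
    rewrite inE eq_sym negb_or => /andP[l0 /IH H]; rewrite big_cons H wdeg_cons.
    rewrite (gdeg_shift _ l0 (lgr l)) /= -[in RHS]add1n PoszD; ring.
  case: (w) w0 => // l w' _ /=; rewrite -addn1 PoszD; ring.
- move=> s1 s2 i c x y /words[w1 <- _] /words[w2 <- _] Hx Hy.
  have HZ : gA (i + (1 - k)) (c *: x + y) by exact: (graded_linear (gca_graded HA)).
  pose lx : letter gA := Letter (Hx : gA (i + (1 - k)) x).
  pose ly : letter gA := Letter (Hy : gA (i + (1 - k)) y).
  pose lz : letter gA := Letter HZ.
  have L : lin_letters c lz lx ly by [].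
  have E (l : letter gA) : q (map (@lval _ gA) w1 ++ lval l :: map (@lval _ gA) w2) =
      F (w1 ++ l :: w2).
    by rewrite -map_cons -map_cat Hq //; case: (w1).
  by rewrite (E lx) (E ly) (E lz); exact: Flin L.
move=> s1 s2 i j x y /words[w1 <- _] /words[w2 <- _] Hx Hy.
pose lx : letter gA := Letter (Hx : gA (i + (1 - k)) x).
pose ly : letter gA := Letter (Hy : gA (j + (1 - k)) y).
have E (l l' : letter gA) :
    q (map (@lval _ gA) w1 ++ lval l :: lval l' :: map (@lval _ gA) w2) =
    F (w1 ++ l :: l' :: w2).
  by rewrite -!map_cons -map_cat Hq //; case: (w1).
rewrite (E lx ly) (E ly lx) Fsym sgZsign; congr sg.
by rewrite /= (parD i) (parD j) !par_1k !addbF.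
Qed.

End TaylorOfWords.

(** * The derived Poisson algebra of a derived BV algebra *)

Section PoissonOfBV.
Variables (K : fieldType) (A : algType K) (g : grading A) (k : int).
Hypothesis charK : [pchar K] =i pred0.
Hypothesis k_odd : odd `|k|%N.
Hypothesis HA : graded_comm_alg g.
Variable D : pser A -> pser A.
Hypothesis HD : derived_BV k g D.
Let HR := graded_superring HA.
Implicit Types (w u v : seq (letter g)).

Lemma bv_lin n : linmap (tcoef D n).
Proof. exact: tcoef_lin (dbv_linear HD) n. Qed.

Lemma bv_add n : addmap (tcoef D n).
Proof. exact: linmap_add (bv_lin n). Qed.

Lemma bv_deg n : op_deg g (1 + n%:Z * (k - 1)) (tcoef D n).
Proof. by move=> i x Hx; apply: tcoef_deg Hx; [exact: graded_0|exact: dbv_degree HD]. Qed.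

Lemma bv_par n : true = par (1 + n%:Z * (k - 1)).
Proof. by rewrite par_shift. Qed.

Lemma bv_koszul n w : koszul g (tcoef D n) (map (@lval _ g) w) = KK true (tcoef D n) w.
Proof.
by rewrite [in RHS](bv_par n) (koszul_KK HA _ (bv_lin n) (bv_deg n) (dbv_one HD n)).
Qed.

Lemma bv_order n w : (n < (size w).-1)%N -> KK true (tcoef D n) w = 0.
Proof.
move=> Hn; rewrite -bv_koszul; apply: (dbv_order HD); rewrite ?size_map //.
  by case: (size w) Hn => // -[].
exact: letters_homogeneous.
Qed.

Lemma Poisson_str_KK w : Poisson_str g D (map (@lval _ g) w) =
  KK true (tcoef D (size w).-1) w.
Proof. by rewrite /Poisson_str size_map bv_koszul. Qed.

Lemma bv_square n x :
  \sum_(j < n.+1) tcoef D j (tcoef D (n - j)%N x) = 0.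
Proof.
have := dbv_square HD (ps_const x) n.
by rewrite (ps_linear_op (dbv_linear HD) (D _)).
Qed.

Definition bv_letter n u : letter g := KK_letter HR true (bv_deg n) u.

(** The coefficient of t^n in Delta^2 = 0. By [KK_KK] the nested brackets differ from the composite
    operators by the products [T] of two brackets, which cancel in pairs. *)
Lemma bv_jacobi n w :
  \sum_(j < n.+1) S2 (fun u v => KK true (tcoef D j) (bv_letter (n - j) u :: v)) w = 0.
Proof.
move: w; pose T w := \sum_(j < n.+1)
  S2 (fun u v => sg (~~ wpar u) (KK true (tcoef D (n - j)%N) u * KK true (tcoef D j) v)) w.
(* The operators being odd, exchanging the two factors gives T = - T, and 2 is invertible. *)
have T0 w : T w = 0.
  apply: (@Mn_inj _ _ 2 _ _ charK) => //; rewrite mul0rn mulr2n.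
  apply/eqP; rewrite addr_eq0; apply/eqP; rewrite -sumrN /T.
  under eq_bigr => j _.
    rewrite S2C; under eq_S2 => u v _.
      rewrite (sr_C HR (KK_deg HR true (bv_deg _) v) (KK_deg HR true (bv_deg _) u)).
      over.
    over.
  rewrite /= (sum_ord_rev (fun i j => S2 (fun u v => sg (wpar u && wpar v) (sg (~~ wpar v)
    (sg (par (wdeg v + (1 + j%:Z * (k - 1))) && par (wdeg u + (1 + i%:Z * (k - 1))))
      (KK true (tcoef D i) u * KK true (tcoef D j) v)))) w)).
  apply: eq_bigr => j _; rewrite S2N; apply: eq_S2 => u v _.
  rewrite !sgA -[RHS]/(sg true _) sgA; congr sg.
  by rewrite (parD (wdeg v)) (parD (wdeg u)) -!bv_par -!wpar_wdeg; case: (wpar u); case: (wpar v).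
apply: (conv_inj (G := @wprod _ g)); first exact: wprod_nil.
move=> w; transitivity (\sum_(j < n.+1) conv (fun w =>
    S2 (fun u v => KK true (tcoef D j) (bv_letter (n - j) u :: v)) w) (@wprod _ g) w).
  by rewrite /conv -S2_sum; apply: eq_S2 => u v _; rewrite mulr_suml.
transitivity (\sum_(j < n.+1) (tcoef D j (tcoef D (n - j)%N (wprod w)) -
  conv (fun w => S2 (fun u v => sg (~~ wpar u)
    (KK true (tcoef D (n - j)%N) u * KK true (tcoef D j) v)) w) (@wprod _ g) w)).
  apply: eq_bigr => j _.
  rewrite (KK_KK HR w (bv_deg (n - j)) (bv_add j) (bv_add _) (bv_deg j) (bv_par j) (bv_par _)).
  congr (_ - _); apply: eq_S2 => u v _; congr (_ * _); apply: eq_S2 => u1 u2 _.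
  by rewrite /= addbT.
rewrite sumrB bv_square sub0r.
transitivity (- conv T (@wprod _ g) w).
  by congr (- _); rewrite /conv -S2_sum; apply: eq_S2 => u v _; rewrite mulr_suml.
rewrite /conv !S2_0 ?oppr0 // => u v _; first by rewrite mul0r.
by rewrite T0 mul0r.
Qed.

Lemma Poisson_str_taylor :
  taylor_family (shift (1 - k) g) (shift (1 - k) g) 1 (Poisson_str g D).
Proof.
apply: (@taylor_of_words _ _ _ _ _ HA HA k k_odd 1
  (fun w => KK true (tcoef D (size w).-1) w)).
- by move=> w _; exact: Poisson_str_KK.
- move=> c a b b' s1 s2 L.
  have -> s : (size (s1 ++ b :: s)).-1 = (size (s1 ++ a :: s)).-1 by rewrite !size_cat.
  have -> s : (size (s1 ++ b' :: s)).-1 = (size (s1 ++ a :: s)).-1 by rewrite !size_cat.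
  exact: (@KK_word_lin _ _ _ true _ (bv_lin _) c a b b' s1 s2 L).
- move=> s1 s2 a b.
  have -> : (size (s1 ++ b :: a :: s2)).-1 = (size (s1 ++ a :: b :: s2)).-1.
    by rewrite !size_cat.
  exact: KK_sym (bv_add _) _ _ _ _.
move=> w _; have := KK_deg HR true (bv_deg (size w).-1) w.
by rewrite [1 + _]addrC addrA.
Qed.

(** In [KK_der] the bracket with one more argument is below its order and vanishes. *)
Lemma Poisson_str_mder : multiderivation k g (Poisson_str g D).
Proof.
move=> a i j b c /tagged_exists[w <- Tw] Hb Hc.
have Hbc := gca_mul HA Hb Hc.
pose lb := Letter Hb; pose lc := Letter Hc; pose lbc := Letter Hbc.
have E (l : letter g) : Poisson_str g D (rcons (map (@lval _ g) w) (lval l)) =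
    KK true (tcoef D (size w)) (rcons w l).
  by rewrite -map_rcons Poisson_str_KK size_rcons.
rewrite (E lb) (E lc) (E lbc).
rewrite (KK_der HR w (bv_add _) (bv_deg _) (bv_par _) (erefl : lval lbc = lval lb * lval lc) erefl).
rewrite [X in _ + X]bv_order ?addr0 ?size_rcons // sgZsign; congr (_ + sg _ _).
by rewrite size_map -(tagged_deg Tw) par_shift // parD -wpar_wdeg /= addbC.
Qed.

(** Take [bv_jacobi] at t^(n-1), n = |w|. By the order condition a term with indices i + j = n - 1
    survives only if i >= |u| - 1 and j >= |v|; since |u| + |v| = n, one term is left. *)
Lemma Poisson_str_derived_Poisson : derived_Poisson k g (Poisson_str g D).
Proof.
split; last exact: Poisson_str_mder.
split; first exact: Poisson_str_taylor.
move=> a a0 /homogeneous_shift/tagged_exists[w Ew Tw].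
rewrite -Ew in a0 *; rewrite size_map in a0.
rewrite /insertion (sum_unshuffles_S2 HA Tw (par_compat_shift HA (par_1k k_odd)) 1%N
  (fun b c => Poisson_str g D (Poisson_str g D b :: c))).
rewrite -[RHS](bv_jacobi (size w).-1 w) -S2_sum; apply: eq_S2 => u v /shuffle_size Hs.
have Ej j i : KK true (tcoef D j) (bv_letter i u :: v) = 0 \/
   [/\ (size u).-1 <= i, size v <= j & ~~ nilp u]%N.
  have l0 : KK true (tcoef D i) u = 0 -> KK true (tcoef D j) (bv_letter i u :: v) = 0.
    move=> H; exact: (word_lin_0 [::] v (KK_word_lin true (bv_lin j)) (l := bv_letter i u)).
  case: (ltnP i (size u).-1) => [/bv_order/l0|Hi]; first by left.
  case: (ltnP j (size v)) => Hj; first by left; apply: bv_order.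
  have [/nilP u0|u0] := boolP (nilp u); last by right.
  by left; apply: l0; rewrite u0 /= (dbv_one HD).
case: ifPn => [u0|]; last first.
  case: u Ej {Hs} => // Ej _; rewrite big1 // => j _.
  by case: (Ej j ((size w).-1 - j)%N) => // -[].
have Hv : (size v < (size w).-1.+1)%N by rewrite -Hs; lia.
rewrite (bigD1 (Ordinal Hv)) //= big1 ?addr0 => [|j jv].
  rewrite Poisson_str_KK.
  have -> : ((size w).-1 - size v = (size u).-1)%N by rewrite -Hs; lia.
  by rewrite -[_ :: _]/(map (@lval _ g) (bv_letter (size u).-1 u :: v)) Poisson_str_KK.
have {}jv : (j : nat) != size v by [].
case: (Ej j ((size w).-1 - j)%N) => // -[H1 H2 _].
exfalso; move: H1 H2 jv (ltn_ord j) u0; move: (nat_of_ord j) => m; rewrite -Hs.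
by move: (size u) (size v) => a' b'; lia.
Qed.

End PoissonOfBV.

(** * Multilinearity and symmetry of cumulants *)

Section CumulantLetters.
Variables (K : fieldType) (A B : algType K) (g : grading A).
Hypothesis charK : [pchar K] =i pred0.
Variable G : seq (letter g) -> pser B.
Hypothesis G_sym : block_sym (fun L => \prod_(l <- L) G l).

Lemma conv_lin (F F' : seq (letter g) -> pser B) :
  word_lin F -> word_lin F' -> word_lin (conv F F').
Proof.
move=> HF HF'; apply: word_lin_S2 => [u|v] c a b b' s1 s2 L.
  by rewrite (HF' c a b b' s1 s2 L) mulrDr ps_scaleAr.
by rewrite (HF c a b b' s1 s2 L) mulrDl ps_scaleAl.
Qed.

Lemma conv_sym (F F' : seq (letter g) -> pser B) :
  word_sym F -> word_sym F' -> word_sym (conv F F').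
Proof.
move=> HF HF'; apply: word_sym_S2 => [u|v] s1 s2 a b.
  by rewrite (HF' s1 s2 a b) sgMr.
by rewrite (HF s1 s2 a b) sgMl.
Qed.

Let cat_nonnil (s1 s2 : seq (letter g)) a : nilp (s1 ++ a :: s2) = false.
Proof. by case: s1. Qed.

Lemma cpow_lin m : word_lin G -> word_lin (cpow (off_nil G) m).
Proof.
move=> HG; elim: m => [|m IH].
  by move=> c a b b' s1 s2 L /=; rewrite /conv1 !cat_nonnil scaler0 addr0.
apply: conv_lin IH => c a b b' s1 s2 L; rewrite /off_nil !cat_nonnil.
exact: HG L.
Qed.

Lemma cpow_sym m : word_sym G -> word_sym (cpow (off_nil G) m).
Proof.
move=> HG; elim: m => [|m IH].
  by move=> s1 s2 a b /=; rewrite /conv1 !cat_nonnil sg0.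
apply: conv_sym IH => s1 s2 a b; rewrite /off_nil !cat_nonnil.
exact: HG.
Qed.

(** [US] singles out the first letter, which hides symmetry. Multiplied by m! it becomes a
    convolution power, where symmetry is visible, and m! is cancelled in characteristic zero. *)
Let US_fact m w :
  US m (fun L => \prod_(l <- L) G l) w *+ m`! = cpow (off_nil G) m w.
Proof. by rewrite -OS_prod OS_US. Qed.

Lemma cum_lin : word_lin G -> word_lin (cum G).
Proof.
move=> HG c a b b' s1 s2 L; rewrite /cum scaler_sumr.
have -> : size (s1 ++ b :: s2) = size (s1 ++ a :: s2) by rewrite !size_cat.
have -> : size (s1 ++ b' :: s2) = size (s1 ++ a :: s2) by rewrite !size_cat.
pose t m s : pser B := sg (odd m) (US m.+1 (fun L => \prod_(l <- L) G l) s *+ m`!).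
have E m : t m (s1 ++ a :: s2) = c *: t m (s1 ++ b :: s2) + t m (s1 ++ b' :: s2).
  rewrite /t sgZ -scalerMnr -sgD -mulrnDl; congr (sg _ (_ *+ _)).
  apply: (Mn_inj charK (fact_gt0 m.+1)).
  by rewrite mulrnDl scalerMnr !US_fact; exact: cpow_lin HG _ _ _ _ _ _ L.
by rewrite -/(t _ _) (eq_bigr _ (fun (m : 'I__) _ => E m)) big_split.
Qed.

Lemma cum_sym : word_sym G -> word_sym (cum G).
Proof.
move=> HG s1 s2 a b; rewrite /cum sg_sum.
have -> : size (s1 ++ b :: a :: s2) = size (s1 ++ a :: b :: s2) by rewrite !size_cat.
apply: eq_bigr => m _; rewrite sgA addbC -sgA [X in _ = sg _ X]sgMn; congr (sg _ (_ *+ _)).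
apply: (Mn_inj charK (fact_gt0 m.+1)).
by rewrite -sgMn !US_fact; exact: cpow_sym.
Qed.

End CumulantLetters.

Lemma blocks_size (T : parType) (L : seq (seq T)) : all (fun l => ~~ nilp l) L ->
  (sumn [seq (size l).-1 | l <- L] + size L)%N = size (flatten L).
Proof.
elim: L => //= l L IH /andP[Hl /IH H]; rewrite size_cat -H.
by move: Hl; rewrite /nilp -lt0n; lia.
Qed.

Lemma blocks_size_le (T : parType) (L : seq (seq T)) : all (fun l => ~~ nilp l) L ->
  all (fun l => size l + size L <= (size (flatten L)).+1)%N L.
Proof.
elim: L => //= l L IH /andP[Hl L0]; rewrite size_cat.
have Ls := size_flatten_nonnil L0; move: Hl; rewrite /nilp -lt0n => Hl.
apply/andP; split; first by move: (size l) (size L) (size (flatten L)) Ls Hl; lia.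
apply: sub_all (IH L0) => l' /=.
by move: (size l) (size l') (size L) (size (flatten L)) Ls Hl; lia.
Qed.

Section LeadingBrackets.
Variables (K : fieldType) (A B : algType K) (gA : grading A) (gB : grading B).
Variable k : int.
Hypothesis k_odd : odd `|k|%N.
Variable F : seq (letter gA) -> pser B.
Hypothesis F_deg : has_wdeg (ps_homog k gB) 0 F.

(* The coefficient of t^(n-1) in F(l), n = |l|. *)
Definition lead_letter (l : seq (letter gA)) : letter gB :=
  coef_letter (word_letter F_deg l) (size l).-1.

Lemma lead_letter_par l : lpar (lead_letter l) = wpar l.
Proof. by rewrite wpar_wdeg; apply: par_shift. Qed.

(** The m blocks contribute the orders |l| - 1, in total |w| - m, and the operator contributes r.
    The vanishing hypothesis concerns words short enough to be one of m blocks of w, so it can come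
    from an induction on length. *)
Lemma bracket_lead m (D : nat -> B -> B) p r w :
  (forall j, addmap (D j)) ->
  (forall j c, (j < r)%N -> size c = m -> KK p (D j) (c : seq (letter gB)) = 0) ->
  (forall u M, (size u + m <= (size w).+1)%N -> (M < (size u).-1)%N -> F u M = 0) ->
  let b := US m (fun L => KK p (ps_op D) (map (word_letter F_deg) L)) w in
  (forall M, (M + m < r + size w)%N -> b M = 0) /\
  ((m <= size w)%N ->
   b (r + (size w - m))%N = US m (fun L => KK p (D r) (map lead_letter L)) w).
Proof.
move=> aD Dv Fv b.
have main L : is_blocks m L w ->
   (forall M, (M + m < r + size w)%N ->
      KK p (ps_op D) (map (word_letter F_deg) L) M = 0) /\
   KK p (ps_op D) (map (word_letter F_deg) L) (r + (size w - m))%N =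
     KK p (D r) (map lead_letter L).
  case=> Lm L0 Lw _; pose x := [seq (word_letter F_deg l, (size l).-1) | l <- L].
  have E1 : map fst x = map (word_letter F_deg) L by rewrite -map_comp.
  have E2 : sumn (map snd x) = (size w - m)%N.
    by rewrite -map_comp -Lw -(blocks_size L0) Lm addnK.
  have E3 : [seq coef_letter y.1 y.2 | y <- x] = map lead_letter L by rewrite -map_comp.
  have mw : (m <= size w)%N by rewrite -Lm -Lw; exact: size_flatten_nonnil.
  have V : vanish_below x.
    have : all (fun l => size l + m <= (size w).+1)%N L.
      by rewrite -Lm -Lw; exact: blocks_size_le.
    rewrite /x; elim: (L) => //= l L' IH /andP[Hl /IH HL']; split=> // j Hj.
    exact: Fv Hj.
  have [|H1 H2] := KK_lead k_odd (p := p) (r := r) (w := x) aD _ V.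
    by move=> j c Hj Hc; apply: Dv; rewrite // Hc size_map.
  rewrite E1 E2 in H1 H2; split; last by rewrite H2 E3.
  by move=> M HM; apply: H1; lia.
split=> [M HM|_]; rewrite /b (US_morph (f := fun y : pser B => y _)) //.
  by apply: US_0 => L /main[H _]; apply: H.
by apply: eq_US => L /main[_].
Qed.

End LeadingBrackets.

(** * Cumulants of a unital map as functions on words *)

Section ExpWord.
Variables (K : fieldType) (A B : algType K) (gA : grading A) (gB : grading B) (k : int).
Hypothesis charK : [pchar K] =i pred0.
Hypothesis k_odd : odd `|k|%N.
Hypotheses (HA : graded_comm_alg gA) (HB : graded_comm_alg gB).
Variable f : pser A -> pser B.
Hypothesis f_lin : ps_linear f.
Hypothesis f_deg : ps_degree k gA gB 0 f.
Hypothesis f_one : forall n, f (ps_const 1) n = ps_const (1 : B) n.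
Let HRB := ps_superring HB k_odd.
Let G : seq (letter gA) -> pser B := @exp_word K A B gA f.

Lemma wprod_deg (w : seq (letter gA)) : gA (wdeg w) (wprod w).
Proof.
elim: w => [|l w IH]; first by rewrite wdeg_nil wprod_nil; exact: gca_one HA.
by rewrite wdeg_cons wprod_cons; apply: (gca_mul HA) => //; exact: lgr.
Qed.

Lemma exp_word_deg : has_wdeg (ps_homog k gB) 0 G.
Proof. by move=> w; apply/f_deg/(ps_const_homog HA)/wprod_deg. Qed.

Lemma exp_word_nil : G [::] = 1.
Proof. by apply: funext => n; rewrite /G /exp_word wprod_nil f_one. Qed.

Lemma exp_word_prod_sym : block_sym (fun L => \prod_(l <- L) G l).
Proof. exact: (exp_word_block_sym HRB exp_word_deg). Qed.

Lemma exp_word_cum b w : conv (fun u => cum G (b :: u)) G w = G (b :: w).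
Proof. exact: (conv_cum _ _ exp_word_nil exp_word_prod_sym). Qed.

Lemma exp_word_lin : word_lin G.
Proof.
move=> c a b b' s1 s2 [E _ _].
rewrite /G /exp_word -(ps_linear_map f_lin); congr f.
apply: funext => -[|n]; rewrite ps_D ps_Z /=; last by rewrite scaler0 addr0.
rewrite /wprod !big_cat !big_cons /= E.
by rewrite mulrDl mulrDr -scalerAl -scalerAr.
Qed.

Lemma exp_word_sym : word_sym G.
Proof.
move=> s1 s2 a b; rewrite /G /exp_word -(addmap_sg (linmap_add (ps_linear_map f_lin))).
congr f; apply: funext => -[|n]; rewrite ps_sg /= ?sg0 //.
rewrite /wprod !big_cat !big_cons /= !mulrA -[_ * lval a * _]mulrA.
by rewrite (sr_C (graded_superring HA) (lgr a) (lgr b)) sgMr !sgMl !mulrA.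
Qed.

Lemma cum_deg : has_wdeg (ps_homog k gB) 0 (cum G).
Proof. exact: (cum_wdeg HRB exp_word_deg). Qed.

Lemma cum_word_lin : word_lin (cum G).
Proof. exact: (cum_lin charK exp_word_prod_sym exp_word_lin). Qed.

Lemma cum_word_sym : word_sym (cum G).
Proof. exact: (cum_sym charK exp_word_prod_sym exp_word_sym). Qed.

Lemma cumulant_word w m : ~~ nilp w ->
  cumulant gA f (map (@lval _ gA) w) m = cum G w m.
Proof.
move=> w0; have [w' Ew Tw] := tagged_exists (@letters_homogeneous _ _ gA w).
rewrite -Ew (cumulant_cum HA HRB exp_word_deg) //.
  by rewrite (word_lin_retag HA cum_word_lin Ew).
by rewrite /nilp -(size_map (@lval _ gA)) Ew size_map.
Qed.

Lemma Poisson_mor_word w : ~~ nilp w ->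
  Poisson_mor gA f (map (@lval _ gA) w) = cum G w (size w).-1.
Proof. by move=> w0; rewrite /Poisson_mor cumulant_word // size_map. Qed.

(** Both sides have the same convolution with G, as the product bc w is the same in both readings: c
    lies in the cumulant of b, or G(c::v) is expanded once more. *)
Lemma cum_merge (b c bc : letter gA) w :
  lval bc = lval b * lval c -> ldeg bc = ldeg b + ldeg c ->
  cum G (bc :: w) = cum G (b :: c :: w) +
    S2 (fun u v => sg (lpar c && wpar u) (cum G (b :: u) * cum G (c :: v))) w.
Proof.
move=> Ev Ed; move: w; apply: (conv_inj exp_word_nil) => w.
rewrite exp_word_cum convDl.
have -> : G (bc :: w) = G (b :: c :: w).
  by rewrite /G /exp_word !wprod_cons Ev mulrA.
rewrite -exp_word_cum [LHS]/conv S2_cons; congr (_ + _).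
transitivity (S2 (fun u v => S2 (fun v1 v2 =>
    sg (lpar c && wpar u) (cum G (b :: u) * cum G (c :: v1) * G v2)) v) w).
  apply: eq_S2 => u v _; rewrite -exp_word_cum /conv -S2_sg; congr sg.
  rewrite (S2_morph (f := fun x => cum G (b :: u) * x)); last first.
    by move=> x y; rewrite mulrDr.
  by apply: eq_S2 => v1 v2 _; rewrite mulrA.
rewrite -S2A; apply: eq_S2 => u v _.
rewrite (S2_morph (f := fun x => x * G v)); last by move=> x y; rewrite mulrDl.
by apply: eq_S2 => u1 u2 _; rewrite sgMl.
Qed.

Lemma cum_rcons w (l : letter gA) :
  cum G (rcons w l) = sg (lpar l && wpar w) (cum G (l :: w)).
Proof.
suff H s : cum G (s ++ rcons w l) = sg (lpar l && wpar w) (cum G (s ++ l :: w)) by exact: (H [::]).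
elim: w s => [|x w IH] s; first by rewrite andbF.
rewrite rcons_cons -cat_rcons IH cat_rcons cum_word_sym sgA; congr sg => /=.
by case: (par _); case: (par _); case: wpar.
Qed.

Hypothesis f_order : forall a, (2 <= size a)%N -> homogeneous gA a ->
  forall m, (m < (size a).-1)%N -> cumulant gA f a m = 0.

Lemma cum_order w m : (m < (size w).-1)%N -> cum G w m = 0.
Proof.
move=> Hm; have w2 : (2 <= size w)%N by move: (size w) Hm => -[|[]].
rewrite -cumulant_word; last by rewrite /nilp; case: (size w) w2.
by apply: f_order; rewrite ?size_map //; exact: letters_homogeneous.
Qed.

Lemma Poisson_mor_taylor :
  taylor_family (shift (1 - k) gA) (shift (1 - k) gB) 0 (Poisson_mor gA f).
Proof.
apply: (@taylor_of_words _ _ _ _ _ HA HB k k_odd 0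
  (fun w => cum G w (size w).-1)).
- by move=> w w0; exact: Poisson_mor_word.
- move=> c a b b' s1 s2 L.
  have -> : (size (s1 ++ b :: s2)).-1 = (size (s1 ++ a :: s2)).-1 by rewrite !size_cat.
  have -> : (size (s1 ++ b' :: s2)).-1 = (size (s1 ++ a :: s2)).-1 by rewrite !size_cat.
  have E : cum G (s1 ++ a :: s2) = c *: cum G (s1 ++ b :: s2) + cum G (s1 ++ b' :: s2).
    by apply: cum_word_lin.
  by rewrite E ps_D ps_Z.
- move=> s1 s2 a b.
  have -> : (size (s1 ++ b :: a :: s2)).-1 = (size (s1 ++ a :: b :: s2)).-1.
    by rewrite !size_cat.
  by rewrite -ps_sg cum_word_sym.
by move=> w _; have := cum_deg w (size w).-1; rewrite !addr0.
Qed.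

(** The coefficient of t^n in [cum_merge], n = |a|: the cumulant of n + 2 arguments is divisible by
    t^(n+1), and only leading coefficients contribute to the products. *)
Lemma Poisson_mor_mul (a : seq A) d e b c :
  homogeneous gA a -> gA d b -> gA e c ->
  Poisson_mor gA f (rcons a (b * c)) =
  \sum_(0 <= i < (size a).+1) \sum_(s in unshuffles (size a) [:: i; (size a - i)%N])
      ksign gA (a ++ [:: b; c])
          (take i (plist s) ++ size a :: drop i (plist s) ++ [:: (size a).+1]) *:
        (Poisson_mor gA f (rcons (pick_seq a (take i (plist s))) b) *
         Poisson_mor gA f (rcons (pick_seq a (drop i (plist s))) c)).
Proof.
move=> Ha Hb Hc.
have [w0 Ew0 Tw0] : exists2 w0 : seq (letter gA), map (@lval _ gA) w0 = a ++ [:: b; c] & tagged w0.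
  apply: tagged_exists => x; rewrite mem_cat => /orP[/Ha//|].
  by rewrite !inE => /orP[]/eqP->; [exists d|exists e].
have sw0 : size w0 = (size a).+2 by rewrite -(size_map (@lval _ gA)) Ew0 size_cat addn2.
pose l0 : letter gA := Letter (graded_0 HA (gdeg gA 0)).
pose t i := nth l0 w0 i.
pose n := size a; pose w := map t (iota 0 n); pose lb := t n; pose lc := t n.+1.
have nth_t i : nth 0 (a ++ [:: b; c]) i = lval (t i).
  rewrite -Ew0 /t; case: (ltnP i (size w0)) => Hi; first by rewrite (nth_map l0).
  by rewrite !nth_default // size_map.
have par_t i : par (gdeg gA (nth 0 (a ++ [:: b; c]) i)) = lpar (t i).
  rewrite nth_t; congr par; rewrite /t.
  case: (ltnP i (size w0)) => Hi; last by rewrite nth_default.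
  have := congr1 (fun s => nth 0 s i) Tw0.
  by rewrite (nth_map l0) // -map_comp (nth_map l0).
have Ew : map (@lval _ gA) w = a.
  apply: (@eq_from_nth _ 0); first by rewrite !size_map size_iota.
  move=> i; rewrite !size_map size_iota => Hi.
  by rewrite -map_comp (nth_map 0%N) ?size_iota // nth_iota //= add0n -nth_t nth_cat Hi.
have Eb : lval lb = b by rewrite -nth_t nth_cat ltnn subnn.
have Ec : lval lc = c by rewrite -nth_t nth_cat ltnNge leqnSn /= subSnn.
have Hbc : gA (ldeg lb + ldeg lc) (b * c).
  by rewrite -Eb -Ec; apply: (gca_mul HA); exact: lgr.
pose lbc : letter gA := Letter Hbc.
have sw : size w = n by rewrite size_map size_iota.
rewrite -{1}Ew -[b * c]/(lval lbc) -map_rcons Poisson_mor_word; last by case: (w).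
rewrite cum_rcons size_rcons /= sw ps_sg.
rewrite (@cum_merge lb lc lbc w) //; last by rewrite /= Eb Ec.
rewrite ps_D (@cum_order (lb :: lc :: w)) ?add0r; last by rewrite /= sw.
pose Phi u v := cum G (rcons u lb) (size u) * cum G (rcons v lc) (size v).
transitivity (S2 (fun u v => sg (lpar lb && wpar v) (Phi u v)) w).
  rewrite (S2_morph (f := fun x : pser B => x n)) // S2_sg.
  apply: eq_S2 => u v Huv; have /esym Es := shuffle_size Huv; rewrite sw in Es.
  rewrite ps_sg ps_M.
  have Hu : (size u < n.+1)%N by rewrite Es ltnS leq_addr.
  rewrite (bigD1 (Ordinal Hu)) //= big1 ?addr0 => [|i iu].
    rewrite /Phi !cum_rcons !ps_sg sgMl sgMr !sgA.
    have -> : (n - size u = size v)%N by rewrite Es addKn.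
    congr sg; rewrite (shuffle_par Huv) parD /=.
    by case: (par _); case: (par _); case: wpar; case: wpar.
  have {}iu : (i : nat) != size u by [].
  case: (ltngtP i (size u)) iu => // Hi _.
    by rewrite cum_order ?mul0r.
  rewrite [X in _ * X]cum_order ?mulr0 //=.
  by move: Hi Es (ltn_ord i); move: (nat_of_ord i) => m; move: (size u) (size v); lia.
rewrite /w (S2_splits (pd := fun i => lpar (t i))) //; last exact: iota_ltn_sorted.
pose kk u v := ksign gA (a ++ [:: b; c]) (u ++ n :: v ++ [:: n.+1]).
pose FF u v := kk u v *: (Poisson_mor gA f (rcons (pick_seq a u) b) *
         Poisson_mor gA f (rcons (pick_seq a v) c)).
transitivity (\sum_(p <- splits2 (iota 0 n)) FF p.1 p.2); last first.
  by rewrite (sum_unshuffles_all n FF 0).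
apply: eq_big_seq => -[u v] Hp /=.
have Hm x : x \in u ++ v -> (x < n)%N.
  by rewrite (perm_mem (splits2_perm Hp)) mem_iota.
have Epick s : (forall x, x \in s -> (x < n)%N) -> pick_seq a s = map (@lval _ gA) (map t s).
  move=> Hs; rewrite /pick_seq -map_comp; apply/eq_in_map => x /Hs xn /=.
  by rewrite -nth_t nth_cat -/n xn.
rewrite /FF Epick => [|x xu]; last by apply: Hm; rewrite mem_cat xu.
rewrite Epick => [|x xv]; last by apply: Hm; rewrite mem_cat xv orbT.
rewrite -{1}Eb -{1}Ec -!map_rcons !Poisson_mor_word; [|by case: (v)|by case: (u)].
rewrite !map_rcons !size_rcons /= -/(Phi _ _) /kk ksign_inversions sgE sgA; congr sg.
(* The positions of b and c exceed all those of a, so besides the crossings of u with v only those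
   of b with v produce a sign. *)
rewrite (eq_inversions _ par_t) inversions_cat /= inversions_cat.
move: (Hp); rewrite mem_splits2; last exact: iota_ltn_sorted.
move=> /and3P[Su Sv _]; rewrite !inversions_sorted //= ?big_nil !addbF.
rewrite big_cat /= big_cons big_nil ltnNge leqnSn /= addbF.
have -> : cross (fun i => lpar (t i)) v [:: n.+1] = false.
  rewrite /cross big1_seq // => x /= xv; rewrite big_cons big_nil.
  have : (x < n)%N by apply: Hm; rewrite mem_cat xv orbT.
  by move=> xn; rewrite ltnNge (leq_trans (ltnW xn) (leqnSn n)).
rewrite addbF (_ : n :: v ++ _ = [:: n] ++ v ++ [:: n.+1]) // !cross_catr.
have Hu x : x \in u -> (x < n)%N by move=> xu; apply: Hm; rewrite mem_cat xu.
have cr m : (n <= m)%N -> cross (fun i => lpar (t i)) u [:: m] = false.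
  move=> nm; rewrite /cross big1_seq // => x /= /Hu xn; rewrite big_cons big_nil.
  by rewrite ltnNge (leq_trans (ltnW xn) nm).
rewrite !cr // !addbF /=; congr (_ (+) _).
have Hv x : x \in v -> (x < n)%N by move=> xv; apply: Hm; rewrite mem_cat xv orbT.
elim: (v) Hv => [|x v' IH] Hv; first by rewrite big_nil /= andbF.
rewrite big_cons Hv ?mem_head // -IH; last by move=> y yv; apply: Hv; rewrite inE yv orbT.
by rewrite /= andb_addr.
Qed.

End ExpWord.

Section CompositionWords.
Variables (K : fieldType) (A B : algType K) (gA : grading A) (gB : grading B).
Hypothesis charK : [pchar K] =i pred0.
Hypothesis HA : graded_comm_alg gA.

(** Passing to unordered decompositions absorbs 1/m!. F is compared with [lead] on words that can be
    one of at least [lo] blocks of w, which is what a recursion on length provides. *)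
Lemma composition_US (U : lmodType K) g' lo (q : seq B -> U) (F : seq A -> B)
    (Q : nat -> seq (letter gB) -> U) (lead : seq (letter gA) -> letter gB)
    (w : seq (letter gA)) :
  tagged w -> par_compat gA g' ->
  (forall l, ~~ nilp l -> (size l + lo <= (size w).+1)%N ->
     F (map (@lval _ gA) l) = lval (lead l)) ->
  (forall l, lpar (lead l) = wpar l) ->
  (forall M, (lo <= size M)%N -> q (map (@lval _ gB) M) = Q (size M) M) ->
  (forall m, word_sym (Q m)) ->
  composition g' lo q F (map (@lval _ gA) w) =
  \sum_(lo <= m < (size w).+1) US m (fun L => Q m (map lead L)) w.
Proof.
move=> Tw Hg' HF Hlead Hq Qsym; rewrite (composition_OS HA Tw Hg') size_map.
apply: eq_big_nat => m /andP[lom _].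
transitivity ((m`!)%:R^-1 *: (OS m (fun L => Q m (map lead L)) w)).
  congr (_ *: _); apply: eq_OS => L [Lm L0 Lw _].
  have E : [seq F (map (@lval _ gA) l) | l <- L] = map (@lval _ gB) (map lead L).
    have := blocks_size_le L0; rewrite Lm Lw; move: L0 {Lm Lw}.
    elim: L => //= l L IH /andP[l0 /IH{}IH] /andP[Hl /IH ->].
    by rewrite HF // (leq_trans _ Hl) // leq_add2l.
  by rewrite E Hq ?size_map Lm.
rewrite OS_US => [|L1 u v L2]; last first.
  by rewrite !map_cat /= Qsym !Hlead.
rewrite -scaler_nat scalerA mulVf ?scale1r //.
by rewrite ((pcharf0P K).1 charK) -lt0n fact_gt0.
Qed.

End CompositionWords.

(** * The derived Poisson morphism of a derived BV morphism *)

Section PoissonOfMorphism.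
Variables (K : fieldType) (A B : algType K) (gA : grading A) (gB : grading B) (k : int).
Hypothesis charK : [pchar K] =i pred0.
Hypothesis k_odd : odd `|k|%N.
Hypotheses (HA : graded_comm_alg gA) (HB : graded_comm_alg gB).
Variables (DA : pser A -> pser A) (DB : pser B -> pser B).
Hypotheses (HDA : derived_BV k gA DA) (HDB : derived_BV k gB DB).
Variable f : pser A -> pser B.
Hypothesis Hf : derived_BV_morphism k gA gB DA DB f.
Let HRB := ps_superring HB k_odd.
Let G : seq (letter gA) -> pser B := @exp_word K A B gA f.
Let F := cum G.
Let F_deg : has_wdeg (ps_homog k gB) 0 F :=
  cum_deg k_odd HA HB (dbvm_degree Hf).
Let G_nil : G [::] = 1 := exp_word_nil gA (dbvm_one Hf).
Let G_cons b w : conv (fun u => F (b :: u)) G w = G (b :: w) :=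
  exp_word_cum k_odd HA HB (dbvm_degree Hf) (dbvm_one Hf) b w.
Let D := tcoef DB.

(** With [mor_insertion], the two sides of the equation of an L-infinity morphism before passing to
    leading coefficients in t. *)
Definition mor_bracket w : pser B := brackets F_deg true (ps_op D) w.

Lemma mor_bracket_conv w : conv mor_bracket G w = DB (G w).
Proof.
rewrite (ps_linear_op (dbv_linear HDB)).
apply: (brackets_conv HRB F_deg G_nil G_cons (e := 1)) => //.
  by apply: ps_op_addmap => j; exact: (bv_add HDB).
by apply: (ps_op_deg HB) => j; exact: (bv_deg HB HDB).
Qed.

Let X j w : pser B := S2 (fun u v => F (bv_letter HA HDA j u :: v)) w.

Definition mor_insertion w : pser B := fun N => \sum_(j < N.+1) X j w (N - j)%N.

Lemma X_conv j w : conv (X j) G w = f (ps_const (tcoef DA j (wprod w))).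
Proof.
rewrite /conv; under eq_S2 => u v _.
  rewrite (S2_morph (f := fun x => x * G v)); last by move=> x y; rewrite mulrDl.
  over.
rewrite S2A.
rewrite -(conv_KK (graded_superring HA) w (bv_add HDA j) (bv_deg HA HDA j) (bv_par k_odd j)).
rewrite /conv (S2_morph (f := fun x => f (ps_const x))); last first.
  move=> x y; rewrite ps_const_D.
  exact: (linmap_add (ps_linear_map (dbvm_linear Hf))).
by apply: eq_S2 => u v _; rewrite -[LHS]/(conv _ _ _) G_cons /G /exp_word wprod_cons.
Qed.

Lemma mor_insertion_conv w : conv mor_insertion G w = DB (G w).
Proof.
have -> : DB (G w) = f (DA (ps_const (wprod w))).
  by apply: funext => n; rewrite (dbvm_comm Hf).
rewrite (ps_linear_op (dbvm_linear Hf)); apply: funext => N.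
rewrite /conv (S2_morph (f := fun x : pser B => x N)) //.
transitivity (S2 (fun u v => \sum_(j < N.+1) (X j u * G v) (N - j)%N) w).
  apply: eq_S2 => u v _; rewrite ps_M /mor_insertion.
  under eq_bigr => i _ do rewrite mulr_suml.
  rewrite -(sum_triangle (fun j i l => X j u i * G v l)).
  by apply: eq_bigr => j _; rewrite ps_M.
rewrite S2_sum /ps_op (sum_ord_rev (fun j i => tcoef f j (DA (ps_const (wprod w)) i))).
apply: eq_bigr => j _.
rewrite -(S2_morph (f := fun x : pser B => x (N - j)%N) (fun u v => X j u * G v)) //.
by rewrite -[S2 _ w]/(conv (X j) G w) X_conv.
Qed.

(** Convolved with G, they become the two sides of Delta_B f = f Delta_A at the product of w. *)
Lemma mor_bracket_insertion w : mor_bracket w = mor_insertion w.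
Proof.
move: w; apply: (conv_inj G_nil) => w.
by rewrite mor_bracket_conv mor_insertion_conv.
Qed.

Lemma mor_order w m : (m < (size w).-1)%N -> F w m = 0.
Proof.
exact: (cum_order charK k_odd HA HB (dbvm_linear Hf) (dbvm_degree Hf) (dbvm_order Hf)).
Qed.

Lemma mor_bracket_lead w : ~~ nilp w -> mor_bracket w (size w).-1 =
  \sum_(1 <= m < (size w).+1)
    US m (fun L => KK true (D m.-1) (map (lead_letter F_deg) L)) w.
Proof.
move=> w0; rewrite /mor_bracket /brackets /bracket_sum ps_sumE.
rewrite -(big_mkord xpredT (fun m => US m (fun L =>
    KK true (ps_op D) (map (word_letter F_deg) L)) w (size w).-1)).
rewrite big_ltn //= (negbTE w0) add0r; apply: eq_big_nat => m /andP[m0 mw].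
have -> : ((size w).-1 = m.-1 + (size w - m))%N.
  by move: m0 mw; move: (size w); lia.
apply: (bracket_lead k_odd F_deg (r := m.-1) _ _ _).2 => //.
- by move=> j; exact: (bv_add HDB).
- by move=> j c Hj Hc; apply: (bv_order k_odd HB HDB); rewrite Hc.
by move=> u M _; exact: mor_order.
Qed.

(** The inner bracket needs j >= |u| - 1, the cumulant of |v| + 1 arguments needs order at least
    |v|, and these bounds add up to |w| - 1. *)
Lemma mor_insertion_lead w : ~~ nilp w -> mor_insertion w (size w).-1 =
  S2 (fun u v => if (1 <= size u)%N then
    F (bv_letter HA HDA (size u).-1 u :: v) (size v) else 0) w.
Proof.
move=> w0; rewrite /mor_insertion.
transitivity (S2 (fun u v => \sum_(j < (size w).-1.+1)
    F (bv_letter HA HDA j u :: v) ((size w).-1 - j)%N) w).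
  rewrite S2_sum; apply: eq_bigr => j _.
  exact: (S2_morph (f := fun x : pser B => x _)).
apply: eq_S2 => u v /shuffle_size Hs.
have lin0 j : KK true (tcoef DA j) u = 0 -> F (bv_letter HA HDA j u :: v) = 0.
  move=> H.
  exact: (word_lin_0 [::] v (cum_word_lin charK k_odd HA HB (dbvm_linear Hf)
    (dbvm_degree Hf)) (l := bv_letter HA HDA j u)).
case: ifPn => [u0|]; last first.
  case: u lin0 {Hs} => // lin0 _; rewrite big1 // => j _.
  by rewrite lin0 // /= (dbv_one HDA).
have Hu : ((size u).-1 < (size w).-1.+1)%N.
  by move: u0; rewrite -Hs; move: (size u) (size v); lia.
have E : ((size w).-1 - (size u).-1 = size v)%N.
  by move: u0; rewrite -Hs; move: (size u) (size v); lia.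
rewrite (bigD1 (Ordinal Hu)) //= big1 ?addr0 ?E // => j ju.
have {}ju : (j : nat) != (size u).-1 by [].
case: (ltngtP j (size u).-1) ju => // Hj _.
  by rewrite lin0 //; exact: (bv_order k_odd HA HDA).
rewrite mor_order //=; move: Hj (ltn_ord j) u0; move: (nat_of_ord j) => m.
by rewrite -Hs; move: (size u) (size v); lia.
Qed.

Lemma Poisson_mor_Linfty1 :
  Linfty1_morphism (shift (1 - k) gA) (shift (1 - k) gB)
    (Poisson_str gA DA) (Poisson_str gB DB) (Poisson_mor gA f).
Proof.
have morE l : ~~ nilp l -> Poisson_mor gA f (map (@lval _ gA) l) = F l (size l).-1.
  exact: (Poisson_mor_word charK k_odd HA HB (dbvm_linear Hf) (dbvm_degree Hf)).
split.
  exact: (Poisson_mor_taylor charK k_odd HA HB (dbvm_linear Hf) (dbvm_degree Hf)).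
move=> a a0 /homogeneous_shift/tagged_exists[w Ew Tw].
have w0 : ~~ nilp w by rewrite /nilp -(size_map (@lval _ gA)) Ew -lt0n.
have Hg := par_compat_shift HA (par_1k k_odd).
rewrite -Ew (composition_US charK HA (Q := fun m M => KK true (D m.-1) M)
  (lead := lead_letter F_deg) Tw Hg); first 1 last.
- by move=> l l0 _; rewrite morE.
- exact: (lead_letter_par k_odd F_deg).
- by move=> M _; rewrite (Poisson_str_KK k_odd HB HDB).
- by move=> m; apply: KK_sym (graded_superring HB) _ _ (bv_add HDB _).
rewrite -mor_bracket_lead // mor_bracket_insertion mor_insertion_lead //.
rewrite /insertion (sum_unshuffles_S2 HA Tw Hg 1%N
  (fun b c => Poisson_mor gA f (Poisson_str gA DA b :: c))).
apply: eq_S2 => u v _; case: ifP => // u0.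
rewrite (Poisson_str_KK k_odd HA HDA).
rewrite -[X in Poisson_mor gA f X]/(map (@lval _ gA) (bv_letter HA HDA (size u).-1 u :: v)).
by rewrite morE.
Qed.

Lemma Poisson_mor_derived_Poisson :
  derived_Poisson_morphism k gA gB (Poisson_str gA DA) (Poisson_str gB DB)
    (Poisson_mor gA f).
Proof.
split; first exact: Poisson_mor_Linfty1.
move=> a d e b c Ha Hb Hc.
exact: (Poisson_mor_mul charK k_odd HA HB (dbvm_linear Hf) (dbvm_degree Hf)
  (dbvm_one Hf) (dbvm_order Hf) Ha Hb Hc).
Qed.

End PoissonOfMorphism.

(** * Perturbation and transfer *)

Section SeriesMaps.
Variable K : fieldType.

Lemma ps_scaleE (U : lmodType K) c (x y : pser U) :
  (fun m => ps_scale c x m + y m) = ps_scale c x + y.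
Proof. by []. Qed.

Lemma ps_linear_op_of (V W : lmodType K) (D : nat -> V -> W) :
  (forall j, linmap (D j)) -> ps_linear (ps_op D).
Proof.
move=> lD c x y n; rewrite ps_scaleE.
have aD j := linmap_add (lD j).
rewrite (ps_op_addmap aD) ps_D; congr (_ + _); rewrite /ps_op /ps_scale.
have Dsum j m : D j (\sum_(i < m.+1) c i *: x (m - i)%N) =
    \sum_(i < m.+1) c i *: D j (x (m - i)%N).
  rewrite (addmap_sum (aD j)); apply: eq_bigr => i _.
  by have := lD j (c i) (x (m - i)%N) 0; rewrite (addmap0 (aD j)) !addr0.
under eq_bigr => j _ do rewrite Dsum.
rewrite (sum_triangle (fun j i l => c i *: D j (x l))).
under [RHS]eq_bigr => i _ do rewrite scaler_sumr.
rewrite (sum_triangle (fun i j l => c i *: D j (x l))).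
by apply: eq_bigr => m _; rewrite (sum_ord_rev (fun i j => c j *: D i (x (n - m)%N))).
Qed.

Lemma ps_linear_comp (U V W : lmodType K) (f : pser V -> pser W) (f' : pser U -> pser V) :
  ps_linear f -> ps_linear f' -> ps_linear (f \o f').
Proof.
move=> Hf Hf' c x y n; rewrite /= -Hf; congr (f _ n).
by apply: funext => m; exact: Hf'.
Qed.

Lemma ps_ext_linear (V W : lmodType K) (f : {linear V -> W}) : ps_linear (ps_ext f).
Proof.
move=> c x y n; rewrite /ps_ext raddfD raddf_sum; congr (_ + _).
by apply: eq_bigr => i _; exact: linearZ_LR.
Qed.

Lemma ps_linear_D (V W : lmodType K) (f f' : pser V -> pser W) :
  ps_linear f -> ps_linear f' -> ps_linear (fun x n => f x n + f' x n).
Proof.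
move=> Hf Hf' c x y n; rewrite Hf Hf' addrACA; congr (_ + _).
rewrite /ps_scale -big_split; apply: eq_bigr => i _.
by rewrite scalerDr.
Qed.

Definition plus_coef (V W : zmodType) (D : pser V -> pser W) j (x : V) : W :=
  if j is 0 then 0 else tcoef D j x.

Lemma plus_part_op (V W : zmodType) (D : pser V -> pser W) :
  plus_part D = ps_op (plus_coef D).
Proof.
apply: funext => x; apply: funext => n; rewrite /plus_part /ps_op.
rewrite big_ord_recl add0r big_add1 big_mkord.
by apply: eq_bigr.
Qed.

Lemma plus_coef_lin (V W : lmodType K) (D : pser V -> pser W) j :
  ps_linear D -> linmap (plus_coef D j).
Proof.
case: j => [|j] HD c x y /=; first by rewrite scaler0 addr0.
exact: tcoef_lin.
Qed.

End SeriesMaps.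

(** * The perturbation lemma on power series *)

Section Perturbation.
Variables (K : fieldType) (V W : lmodType K).
Variables (dV : {linear V -> V}) (dW : {linear W -> W}).
Variables (sigma : {linear V -> W}) (tau : {linear W -> V}) (h : {linear V -> V}).
Variable D : pser V -> pser V.
Hypothesis D_lin : ps_linear D.
Hypothesis D_0 : forall a, tcoef D 0%N a = dV a.
Let delta := plus_part D.
Let E := perturbed_tau tau h D.

Lemma delta_lin : ps_linear delta.
Proof.
by rewrite /delta plus_part_op; apply: ps_linear_op_of => j; apply: plus_coef_lin.
Qed.

Let delta_add : addmap delta := linmap_add (ps_linear_map delta_lin).
Let ext_add (U U' : lmodType K) (f : {linear U -> U'}) : addmap (ps_ext f) :=
  linmap_add (ps_linear_map (ps_ext_linear f)).

(** [delta] raises the order in t by one. This makes h delta contracting and the perturbation series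
    finite in each coefficient. *)
Lemma delta_below x y v : (forall m, (m < v)%N -> x m = y m) ->
  forall m, (m < v.+1)%N -> delta x m = delta y m.
Proof.
move=> H m Hm; apply: eq_big_nat => i /andP[i0 im]; rewrite H //.
by move: i0 im Hm; lia.
Qed.

Lemma delta_vanish x v : (forall m, (m < v)%N -> x m = 0) ->
  forall m, (m < v.+1)%N -> delta x m = 0.
Proof.
move=> H m Hm; rewrite (@delta_below x (0 : pser V) v) //.
by rewrite (addmap0 delta_add).
Qed.

Lemma delta_split x : D x = ps_ext dV x + delta x.
Proof.
rewrite (ps_linear_op D_lin); apply: funext => n; rewrite ps_D /delta plus_part_op /ps_op.
by rewrite !big_ord_recl add0r /= subn0 D_0.
Qed.

Lemma h_delta_unique z : z = ps_ext h (delta z) -> z = 0.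
Proof.
move=> Hz; apply: funext => n; rewrite ps_0; have [v] := ubnP n.
elim: v n => // v IH n Hn; rewrite Hz /ps_ext.
rewrite (@delta_vanish z v) ?linear0 //.
Qed.

Let iterT n y := iter n (ps_ext h \o delta) y.

Let iterT_vanish n y m : (m < n)%N -> iterT n y m = 0.
Proof.
elim: n m => // n IH m Hm; rewrite /iterT iterS /= /ps_ext.
by rewrite (@delta_vanish _ n) ?linear0.
Qed.

Let iterT_sum y N n : (n < N)%N ->
  ps_sum (fun i => iterT i y) n = (\sum_(i < N) iterT i y) n.
Proof.
move=> Hn; rewrite ps_sumE /ps_sum.
rewrite -!(big_mkord xpredT (fun i => iterT i y n)).
rewrite [RHS](big_cat_nat (n := n.+1)) //= [X in _ + X]big1_seq ?addr0 // => m.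
by rewrite mem_index_iota => /andP[_ /andP[Hm _]]; apply: iterT_vanish.
Qed.

Lemma perturbed_tauE x : E x = ps_ext tau x + ps_ext h (delta (E x)).
Proof.
apply: funext => n; rewrite ps_D; set y := ps_ext tau x.
(* The coefficient n of [delta] sees only lower coefficients, for which n iterates suffice;
   additivity then applies to a finite sum. *)
have -> : ps_ext h (delta (E x)) n = ps_ext h (delta (\sum_(i < n) iterT i y)) n.
  congr (h _); apply: (@delta_below _ _ n) => // m Hm.
  exact: iterT_sum.
rewrite -[ps_ext h (delta _)]/((ps_ext h \o delta) _).
rewrite (addmap_sum (addmap_comp (ext_add h) delta_add)) ps_sumE.
rewrite -[E x n]/(ps_sum (fun i => iterT i y) n) (@iterT_sum _ n.+1) // ps_sumE.
by rewrite big_ord_recl.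
Qed.

Lemma perturbed_diffE x : perturbed_diff dW sigma tau h D x =
  ps_ext dW x + ps_ext sigma (delta (E x)).
Proof.
apply: funext => n; rewrite ps_D /perturbed_diff; congr (_ + _).
set y := ps_ext tau x.
rewrite -[LHS]/(\sum_(i < n.+1) (ps_ext sigma \o delta) (iterT i y) n).
rewrite -(ps_sumE _ _ (fun i : 'I_n.+1 => (ps_ext sigma \o delta) (iterT i y)) n).
rewrite -(addmap_sum (addmap_comp (ext_add sigma) delta_add)).
congr (sigma _); apply: (@delta_below _ _ n) => // m Hm.
by rewrite -(@iterT_sum y n.+1) // ltnW.
Qed.

(** Uniqueness of the fixed point characterizes breve tau: its linearity, its value at 1 and its
    compatibility with the differentials all follow by exhibiting a second fixed point. *)
Lemma h_delta_fix t u u' : u = t + ps_ext h (delta u) ->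
  u' = t + ps_ext h (delta u') -> u = u'.
Proof.
move=> Hu Hu'; apply/eqP; rewrite -subr_eq0; apply/eqP; apply: h_delta_unique.
rewrite (addmapB delta_add) (addmapB (ext_add h)) {1}Hu {1}Hu' opprD.
by rewrite addrACA subrr add0r.
Qed.

Lemma perturbed_tau_lin : ps_linear E.
Proof.
move=> c x y n; rewrite ps_scaleE.
suff H : E (ps_scale c x + y) = ps_scale c (E x) + E y by rewrite H.
have lin (U U' : lmodType K) (f : pser U -> pser U') (x' y' : pser U) :
    ps_linear f -> f (ps_scale c x' + y') = ps_scale c (f x') + f y'.
  by move=> Hf; apply: funext => m; exact: (Hf c x' y' m).
apply: (h_delta_fix (perturbed_tauE _)).
rewrite (lin _ _ _ _ _ (ps_ext_linear tau)) (lin _ _ _ _ _ delta_lin).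
rewrite (lin _ _ _ _ _ (ps_ext_linear h)) addrACA -perturbed_tauE.
congr (_ + _); rewrite {1}perturbed_tauE; apply: funext => m.
by rewrite ps_D /ps_scale -big_split; apply: eq_bigr => i _; rewrite ps_D scalerDr.
Qed.

Lemma perturbed_diff_lin : ps_linear (perturbed_diff dW sigma tau h D).
Proof.
rewrite (_ : perturbed_diff _ _ _ _ _ =
    (fun x n => ps_ext dW x n + (ps_ext sigma \o (delta \o E)) x n)).
  apply: ps_linear_D; first exact: ps_ext_linear.
  apply: ps_linear_comp; first exact: ps_ext_linear.
  by apply: ps_linear_comp; [exact: delta_lin|exact: perturbed_tau_lin].
by apply: funext => x; rewrite perturbed_diffE.
Qed.

Variables (gV : grading V) (gW : grading W).
Hypothesis Hctr : contraction gV gW dV dW sigma tau h.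
Hypothesis dV_sq : forall a, dV (dV a) = 0.
Hypothesis D_sq : forall x n, D (D x) n = 0.

Lemma sigma_perturbed_tau x : ps_ext sigma (E x) = x.
Proof.
rewrite perturbed_tauE; apply: funext => n; rewrite /ps_ext raddfD /=.
by rewrite (ctr_sigma_h Hctr) addr0 (ctr_retract Hctr).
Qed.

Lemma h_perturbed_tau x : ps_ext h (E x) = 0.
Proof.
rewrite perturbed_tauE; apply: funext => n; rewrite /ps_ext raddfD /=.
by rewrite (ctr_h_sq Hctr) addr0 (ctr_h_tau Hctr).
Qed.

Lemma delta_square x : ps_ext dV (delta x) = - delta (D x).
Proof.
have : D (D x) = 0 by apply: funext => n; rewrite D_sq.
have dd : ps_ext dV (ps_ext dV x) = 0 by apply: funext => n; rewrite /ps_ext dV_sq.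
rewrite {1}delta_split {1}delta_split (ext_add dV) dd add0r => /eqP.
by rewrite addr_eq0 => /eqP.
Qed.

(** Both sides solve u = tau(Delta' x) + h Delta_+ u. For D(E x) this uses d h = tau sigma - 1 - h d
    and d Delta_+ = - Delta_+ D, a form of Delta^2 = 0. *)
Lemma perturbed_tau_dg x : D (E x) = E (perturbed_diff dW sigma tau h D x).
Proof.
have Hhom y : ps_ext dV (ps_ext h y) =
    ps_ext tau (ps_ext sigma y) + - y + - ps_ext h (ps_ext dV y).
  apply: funext => n; rewrite !ps_D !ps_N /ps_ext -(ctr_homotopy Hctr (y n)).
  by rewrite addrAC subrr add0r.
have Htau y : ps_ext dV (ps_ext tau y) = ps_ext tau (ps_ext dW y).
  by apply: funext => n; rewrite /ps_ext (ctr_tau_dg Hctr).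
apply: (h_delta_fix (t := ps_ext tau (perturbed_diff dW sigma tau h D x)));
  last exact: perturbed_tauE.
rewrite {1}delta_split {1}perturbed_tauE perturbed_diffE !ext_add.
rewrite Htau Hhom delta_square (addmapN (ext_add h)) opprK.
rewrite -!addrA; congr (_ + (_ + _)).
by rewrite addrCA addNr addr0.
Qed.

(** Since sigma is a left inverse of breve tau, Delta'^2 is sigma Delta^2 breve tau. *)
Lemma perturbed_diff_square x :
  perturbed_diff dW sigma tau h D (perturbed_diff dW sigma tau h D x) = 0.
Proof.
rewrite -[LHS]sigma_perturbed_tau -!perturbed_tau_dg.
have -> : D (D (E x)) = 0 by apply: funext => n; rewrite D_sq.
exact: addmap0 (ext_add sigma).
Qed.

End Perturbation.

(** * Brackets of a derivation *)

Section DerivationBrackets.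
Variables (R : pzRingType) (gr : int -> R -> Prop).
Hypothesis HR : superring gr.
Variable d : R -> R.
Hypothesis d_add : addmap d.
Hypothesis d_deg : op_deg gr 1 d.
Hypothesis d_der : forall i a b, gr i a -> d (a * b) = d a * b + sg (par i) (a * d b).

Lemma der_one : d 1 = 0.
Proof.
have := d_der 1 (sr_1 HR); rewrite !mulr1 mul1r /= => /eqP.
by rewrite -subr_eq0 opprD addrA subrr sub0r oppr_eq0 => /eqP.
Qed.

(** The commutator of d with a letter is multiplication by its differential, which supercommutes
    with the next letter. *)
Lemma KK_der2 a b (w : seq (letter gr)) : KK true d (a :: b :: w) = 0.
Proof.
rewrite /= -[RHS](KK_0 (~~ par (ldeg a) (+) par (ldeg b)) w).
have E x : ad true d a x = d (lval a) * x.
  by rewrite /ad (d_der _ (lgr a)) addrK.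
apply: eq_KK => x; rewrite /ad -/(ad true d a _) -/(ad true d a _) !E mulrA.
rewrite (sr_C HR (d_deg (lgr a)) (lgr b)) sgMl parD /= mulrA.
by rewrite addbC subrr.
Qed.

Section Exponential.
Variables (S : Type) (grS : int -> S -> Prop).
Variables (F G : seq (letter grS) -> R).
Hypothesis F_deg : has_wdeg gr 0 F.
Hypothesis F_nil : F [::] = 0.
Hypothesis G_nil : G [::] = 1.
Hypothesis G_cons : forall b w, conv (fun u => F (b :: u)) G w = G (b :: w).

(** Of the brackets of d only the one with a single block survives. *)
Lemma exp_derivation w : conv (fun u => d (F u)) G w = d (G w).
Proof.
rewrite -(brackets_conv HR F_deg G_nil G_cons w d_add d_deg (p := true)) //.
apply: eq_conv => // u _; rewrite /brackets /bracket_sum.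
pose t m := US m (fun L => KK true d (map (word_letter F_deg) L)) u.
rewrite -(big_mkord xpredT t) big_ltn //.
have -> : t 0%N = 0 by rewrite /t /= der_one if_same.
have t2 m : (2 <= m)%N -> t m = 0.
  move=> Hm; apply: US_0 => L [+ _ _ _].
  by move: m Hm => [|[|m]] // _; case: L => [//|l [//|l' L]] _; exact: KK_der2.
rewrite add0r; case: u @t t2 => [|b u] t t2.
  by rewrite big_geq // F_nil (addmap0 d_add).
rewrite big_ltn // big1_seq ?addr0 => [|m]; last first.
  by rewrite mem_index_iota => /andP[_ /andP[Hm _]]; apply: t2.
by rewrite /t US1 /= /ad /= mulr1 der_one mulr0 sg0 subr0.
Qed.

End Exponential.
End DerivationBrackets.

Section SeriesDerivation.
Variables (K : fieldType) (A : algType K) (g : grading A) (k : int).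
Hypothesis k_odd : odd `|k|%N.
Variable d : {linear A -> A}.
Hypothesis d_der : derivation g d.
Hypothesis d_deg : has_degree g g 1 d.

Lemma ps_ext_addmap (V W : lmodType K) (f : {linear V -> W}) : addmap (ps_ext f).
Proof. exact: linmap_add (ps_linear_map (ps_ext_linear f)). Qed.

Lemma derivation_sg i a b : g i a -> d (a * b) = d a * b + sg (par i) (a * d b).
Proof. by move=> Ha; rewrite (d_der _ Ha) sign_par sgE. Qed.

Lemma ps_ext_der i a b : ps_homog k g i a ->
  ps_ext d (a * b) = ps_ext d a * b + sg (par i) (a * ps_ext d b).
Proof.
move=> Ha; apply: funext => n; rewrite ps_D ps_sg !ps_M /ps_ext ps_M raddf_sum sg_sum.
rewrite -big_split; apply: eq_bigr => m _.
by rewrite /= (derivation_sg _ (Ha m)) par_shift.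
Qed.

Lemma ps_ext_op_deg : op_deg (ps_homog k g) 1 (ps_ext d).
Proof.
move=> i x Hx n; rewrite /ps_ext addrAC; exact: d_deg.
Qed.

End SeriesDerivation.

(** * The kernel of h in a semifull contraction *)

Section SemifullContraction.
Variables (K : fieldType) (A B : algType K) (gA : grading A) (gB : grading B).
Variables (dA : {linear A -> A}) (dB : {linear B -> B}).
Hypotheses (hA : dg_comm_alg gA dA) (hB : dg_comm_alg gB dB).
Variables (sigma : {linear A -> B}) (tau : {linear B -> A}) (h : {linear A -> A}).
Hypothesis hctr : contraction gA gB dA dB sigma tau h.
Hypothesis hsf : semifull gA dA sigma tau h.

Lemma ker_h_split x : h x = 0 -> x = tau (sigma x) - h (dA x).
Proof.
move=> hx; have := ctr_homotopy hctr x; rewrite hx linear0 addr0 => ->.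
by rewrite opprB addrC subrK.
Qed.

(** The semifull conditions have the factors in the other order; decomposing both into homogeneous
    parts allows commuting them. *)
Lemma tau_h_mul x a : h (tau x * h a) = 0 /\ sigma (tau x * h a) = 0.
Proof.
have [s [c [Hc ->]]] := graded_span (gca_graded (dg_alg hB)) x.
have [s' [c' [Hc' ->]]] := graded_span (gca_graded (dg_alg hA)) a.
rewrite !raddf_sum mulr_suml !raddf_sum.
have E i j : tau (c i) * h (c' j) =
    sg (par (i + 0) && par (j - 1)) (h (c' j) * tau (c i)).
  apply: (sr_C (graded_superring (dg_alg hA))).
    exact: (ctr_tau_deg hctr).
  exact: (ctr_h_deg hctr).
split; apply: big1 => i _; rewrite mulr_sumr raddf_sum big1 // => j _; rewrite E.
  by rewrite /= (addmap_sg (addmap_lin h)) (sf_h_ht hsf) sg0.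
by rewrite /= (addmap_sg (addmap_lin sigma)) (sf_s_ht hsf) sg0.
Qed.

(** By the homotopy relation an element of Ker h is a sum of values of tau and h, and each of the
    four resulting products is covered by the semifull conditions. *)
Lemma ker_h_mul x y : h x = 0 -> h y = 0 ->
  h (x * y) = 0 /\ sigma (x * y) = sigma x * sigma y.
Proof.
move=> /ker_h_split -> /ker_h_split ->.
move: (sigma x) (sigma y) (dA x) (dA y) => x1 y1 x2 y2.
rewrite !mulrBl !mulrBr !raddfB /= !(ctr_retract hctr) !(ctr_sigma_h hctr).
rewrite !(tau_h_mul _ _).1 !(tau_h_mul _ _).2 (sf_h_hh hsf) (sf_h_ht hsf) (sf_h_tt hsf).
by rewrite (sf_s_hh hsf) (sf_s_ht hsf) (sf_s_tt hsf) !(oppr0, addr0).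
Qed.

Lemma semifull_tau_one : tau 1 = 1.
Proof.
have d1 : dA 1 = 0.
  have HR := graded_superring (dg_alg hA).
  apply: (der_one HR (d := dA)) => i a b Ha.
  by rewrite (dg_der hA _ Ha) sign_par sgE.
have := ctr_homotopy hctr 1; rewrite (sf_h_one hsf) d1 !linear0 addr0 (sf_s_one hsf).
by move/eqP; rewrite eq_sym subr_eq0 => /eqP.
Qed.

Lemma ps_ker_h_mul (x y : pser A) : ps_ext h x = 0 -> ps_ext h y = 0 ->
  ps_ext h (x * y) = 0 /\ ps_ext sigma (x * y) = ps_ext sigma x * ps_ext sigma y.
Proof.
move=> hx hy.
have hxn n : h (x n) = 0 by exact: (congr1 (fun z : pser A => z n) hx).
have hyn n : h (y n) = 0 by exact: (congr1 (fun z : pser A => z n) hy).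
split; apply: funext => n; rewrite {1}/ps_ext !ps_M raddf_sum.
  by rewrite big1 // => i _; exact: (ker_h_mul (hxn _) (hyn _)).1.
by apply: eq_bigr => i _; exact: (ker_h_mul (hxn _) (hyn _)).2.
Qed.

Lemma ps_ker_h_split (x : pser A) : ps_ext h x = 0 ->
  x = ps_ext tau (ps_ext sigma x) - ps_ext h (ps_ext dA x).
Proof.
move=> hx; apply: funext => n; rewrite ps_D ps_N; apply: ker_h_split.
exact: (congr1 (fun z : pser A => z n) hx).
Qed.

End SemifullContraction.

(** * The transferred structure and its leading coefficients *)

Section Transfer.
Variables (K : fieldType) (charK : [pchar K] =i pred0).
Variables (k : int) (k_odd : odd `|k|%N).
Variables (A B : algType K) (gA : grading A) (gB : grading B).
Variables (dA : {linear A -> A}) (dB : {linear B -> B}).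
Hypotheses (hA : dg_comm_alg gA dA) (hB : dg_comm_alg gB dB).
Variables (sigma : {linear A -> B}) (tau : {linear B -> A}) (h : {linear A -> A}).
Hypothesis hctr : contraction gA gB dA dB sigma tau h.
Variable Delta : pser A -> pser A.
Hypothesis hDelta : derived_BV k gA Delta.
Hypothesis hDelta0 : forall a, tcoef Delta 0%N a = dA a.
Hypothesis hsf : semifull gA dA sigma tau h.

Let HA := dg_alg hA.
Let HB := dg_alg hB.
Let HRA := ps_superring HA k_odd.
Let HRB := ps_superring HB k_odd.
Let D_lin := dbv_linear hDelta.
Let delta := plus_part Delta.
Let E := perturbed_tau tau h Delta.
Let Delta' := perturbed_diff dB sigma tau h Delta.
Let H := ps_ext h.
Let Sg := ps_ext sigma.

Let delta_add : addmap delta := linmap_add (ps_linear_map (delta_lin D_lin)).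
Let EE x : E x = ps_ext tau x + H (delta (E x)) := perturbed_tauE tau h D_lin x.

Let delta_van x v : (forall m, (m < v)%N -> x m = 0) ->
  forall m, (m < v.+1)%N -> delta x m = 0.
Proof. by move=> Hx m; apply: (delta_vanish D_lin). Qed.

Let delta_deg : ps_degree k gA gA 1 delta.
Proof.
rewrite /delta plus_part_op; apply: (ps_op_deg HA) => -[|j] i x Hx /=.
  exact: (graded_0 HA).
exact: (bv_deg HA hDelta).
Qed.

Lemma transfer_tau_deg : ps_degree k gB gA 0 E.
Proof.
move=> p x Hx n; rewrite addr0; have [v] := ubnP n; elim: v n => // v IH n Hn.
rewrite EE ps_D; apply: (sr_D (graded_superring HA)).
  by rewrite -[p + _]addr0; apply: (ctr_tau_deg hctr); exact: Hx.
have -> : p + n%:Z * (k - 1) = p + n%:Z * (k - 1) + 1 + (-1) by rewrite addrK.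
apply: (ctr_h_deg hctr).
(* Homogeneity of [E x] is known below n only; the truncation [y] is homogeneous as a whole and has
   the same coefficient n after [delta]. *)
pose y m : A := if (m < n)%N then E x m else 0.
rewrite /delta (@delta_below _ _ _ _ y n) //; last by move=> m Hm; rewrite /y Hm.
rewrite addrAC; apply: delta_deg => m; rewrite /y; case: ifP => Hm.
  by apply: IH; apply: leq_trans Hm _; rewrite -ltnS.
exact: (graded_0 HA).
Qed.

Let delta_one : delta (ps_const 1) = 0.
Proof.
rewrite /delta plus_part_op; apply: funext => n; apply: big1 => -[[|j] Hj] _ //=.
case: (n - j.+1)%N => [|m] /=; first exact: (dbv_one hDelta).
by apply: addmap0; exact: (tcoef_add D_lin).
Qed.

Lemma transfer_tau_one n : E (ps_const 1) n = ps_const (1 : A) n.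
Proof.
suff -> : E (ps_const 1) = ps_const 1 by [].
apply: (h_delta_fix D_lin (EE _)); rewrite -/delta delta_one.
apply: funext => -[|m]; rewrite ps_D /ps_ext /= !linear0 addr0 //.
by rewrite (semifull_tau_one hA hctr hsf).
Qed.

Let E_lin : ps_linear E := perturbed_tau_lin tau h D_lin.
Let G : seq (letter gB) -> pser A := @exp_word K B A gB E.
Let e : seq (letter gB) -> pser B := fun w => ps_const (wprod w).
Let F := cum G.
Let F_deg : has_wdeg (ps_homog k gA) 0 F := cum_deg k_odd HB HA transfer_tau_deg.
Let G_nil : G [::] = 1 := exp_word_nil gB transfer_tau_one.
Let G_cons b w : conv (fun u => F (b :: u)) G w = G (b :: w) :=
  exp_word_cum k_odd HB HA transfer_tau_deg transfer_tau_one b w.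

Let e_nil : e [::] = 1.
Proof. by rewrite /e wprod_nil. Qed.

Let HG w : H (G w) = 0.
Proof. exact: (h_perturbed_tau D_lin hctr). Qed.

Let SG w : Sg (G w) = e w.
Proof. exact: (sigma_perturbed_tau D_lin hctr). Qed.

Let H_add : addmap H := ps_ext_addmap h.
Let S_add : addmap Sg := ps_ext_addmap sigma.

(** [conv_stable] with Z = Ker h, which is closed under multiplication by the values of G. *)
Let ker_conv (F1 : seq (letter gB) -> pser A) :
  (forall w, H (conv F1 G w) = 0) -> forall w, H (F1 w) = 0.
Proof.
apply: (conv_stable (Z := fun x => H x = 0)) => //.
- by move=> x y Hx Hy; rewrite H_add Hx Hy addr0.
- by move=> x Hx; rewrite (addmapN H_add) Hx oppr0.
by move=> x v Hx; exact: (ps_ker_h_mul hA hB hctr hsf Hx (HG v)).1.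
Qed.

Let sigma_conv (F1 : seq (letter gB) -> pser A) w :
  (forall u, H (F1 u) = 0) -> Sg (conv F1 G w) = conv (fun u => Sg (F1 u)) e w.
Proof.
move=> HF1; rewrite /conv (S2_morph _ _ S_add); apply: eq_S2 => u v _.
by rewrite [LHS](ps_ker_h_mul hA hB hctr hsf (HF1 u) (HG v)).2 -SG.
Qed.

Lemma h_cum w : H (F w) = 0.
Proof.
case: w => [|b w]; first by rewrite /F cum_nil (addmap0 H_add).
by move: w; apply: ker_conv => w; rewrite G_cons HG.
Qed.

(** Convolution with e is injective, and the function concentrated on the letter b already convolves
    to e(b::w). *)
Lemma sigma_cum (b : letter gB) w :
  Sg (F (b :: w)) = if nilp w then ps_const (lval b) else (0 : pser B).
Proof.
move: w; apply: (conv_inj e_nil) => w.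
rewrite -(@sigma_conv (fun u => F (b :: u)) w (fun u => h_cum (b :: u))).
rewrite G_cons SG /e wprod_cons /conv S2_nill /= S2_0 ?addr0 => [|u v _].
  by apply: funext => n; rewrite ps_const_M; case: n => [//|n]; exact: esym (mulr0 _).
by case: (nilp u) => //; rewrite mul0r.
Qed.

Let e_cons b w : conv (fun u => Sg (F (b :: u))) e w = e (b :: w).
Proof.
by rewrite -(@sigma_conv (fun u => F (b :: u)) w (fun u => h_cum (b :: u))) G_cons SG.
Qed.

Let SF_deg : has_wdeg (ps_homog k gB) 0 (fun w => Sg (F w)).
Proof.
move=> w n; rewrite /Sg /ps_ext -[X in gB X]addr0; apply: (ctr_sigma_deg hctr).
exact: F_deg.
Qed.

Let q w : pser A := brackets F_deg true delta w.

Let q_conv w : conv q G w = delta (G w).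
Proof. exact: (brackets_conv HRA F_deg G_nil G_cons w delta_add delta_deg (p := true)). Qed.

Let dF_conv w : conv (fun u => ps_ext dA (F u)) G w = ps_ext dA (G w).
Proof.
apply: (exp_derivation HRA _ _ _ F_deg _ G_nil G_cons).
- exact: ps_ext_addmap.
- exact: ps_ext_op_deg (dg_deg hA).
- by move=> i a b; apply: ps_ext_der; [exact: k_odd|exact: dg_der hA].
- exact: cum_nil.
Qed.

(** After convolution with G the two parts become tau e - G, by the homotopy relation on Ker h, and
    G - tau e, by the fixed-point equation for breve tau. *)
Let h_dF_q w : H (ps_ext dA (F w) + q w) = 0.
Proof.
apply: (ker_conv (F1 := fun w => ps_ext dA (F w) + q w)) => {}w.
rewrite convDl dF_conv q_conv H_add.
have -> : H (ps_ext dA (G w)) = ps_ext tau (e w) - G w.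
  have := ps_ker_h_split hctr (HG w); rewrite -/Sg SG -/H => {2}->.
  by rewrite opprB addrC subrK.
have -> : H (delta (G w)) = G w - ps_ext tau (e w).
  by rewrite [X in _ = X - _](EE (e w)) [RHS]addrC addKr.
by rewrite addrA subrK subrr.
Qed.

Lemma cum_split w : F w = ps_ext tau (Sg (F w)) + H (q w).
Proof.
rewrite {1}(ps_ker_h_split hctr (h_cum w)); congr (_ + _).
by apply/esym/eqP; rewrite -addr_eq0 -H_add addrC h_dF_q.
Qed.

(** [sigma_conv] is applied to d_A F + q, which lies in Ker h; the derivation part is then computed
    on B by [exp_derivation] and subtracted. *)
Let sigma_q_conv w : conv (fun u => Sg (q u)) e w = Sg (delta (G w)).
Proof.
have := @sigma_conv (fun u => ps_ext dA (F u) + q u) w h_dF_q.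
rewrite convDl dF_conv q_conv S_add.
have Sd x : Sg (ps_ext dA x) = ps_ext dB (Sg x).
  by apply: funext => n; exact: (ctr_sigma_dg hctr).
have -> : conv (fun u => Sg (ps_ext dA (F u) + q u)) e w =
    ps_ext dB (e w) + conv (fun u => Sg (q u)) e w.
  transitivity (conv (fun u => ps_ext dB (Sg (F u)) + Sg (q u)) e w).
    by apply: eq_conv => // u _; rewrite S_add Sd.
  rewrite convDl; congr (_ + _).
  apply: (exp_derivation HRB _ _ _ SF_deg _ e_nil e_cons).
  - exact: ps_ext_addmap.
  - exact: ps_ext_op_deg (dg_deg hB).
  - by move=> i a b; apply: ps_ext_der; [exact: k_odd|exact: dg_der hB].
  - by rewrite /F cum_nil (addmap0 S_add).
by rewrite Sd SG => /addrI.
Qed.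

Let term m w : pser A := US m (fun L => KK true delta (map (word_letter F_deg) L)) w.

(** The one-block bracket is [delta (F w)] because Delta_+ kills 1. *)
Let q_terms w n : ~~ nilp w ->
  q w n = delta (F w) n + \sum_(2 <= m < (size w).+1) term m w n.
Proof.
move=> w0; rewrite /q /brackets /bracket_sum ps_sumE.
rewrite -(big_mkord xpredT (fun m => term m w n)).
rewrite big_ltn // [X in X + _](_ : _ = 0) ?add0r; last by rewrite /term /= (negbTE w0).
rewrite big_ltn; last by case: (w) w0.
congr (_ + _); rewrite /term US1 (negbTE w0) /= /ad /= mulr1.
by rewrite [delta 1]delta_one mulr0 sg0 subr0.
Qed.

(** With two or more blocks each block is a proper subword, so vanishing on shorter words
    suffices. *)
Let higher_terms w :
  (forall u m, (size u < size w)%N -> (m < (size u).-1)%N -> F u m = 0) ->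
  (forall n, (n < (size w).-1)%N -> \sum_(2 <= m < (size w).+1) term m w n = 0) /\
  \sum_(2 <= m < (size w).+1) term m w (size w).-1 =
  \sum_(2 <= m < (size w).+1)
    US m (fun L => KK true (tcoef Delta m.-1) (map (lead_letter F_deg) L)) w.
Proof.
move=> IH.
have lead m : (1 < m)%N -> (m <= size w)%N ->
    (forall n, (n < (size w).-1)%N -> term m w n = 0) /\
    term m w (size w).-1 =
      US m (fun L => KK true (tcoef Delta m.-1) (map (lead_letter F_deg) L)) w.
  move=> m1 mw; rewrite /term /delta plus_part_op.
  have [j|j c Hj Hc|u n Hu Hn|H1 /(_ mw) H2] :=
      bracket_lead k_odd F_deg (m := m) (D := plus_coef Delta) (p := true) (r := m.-1) (w := w).
  - exact: linmap_add (plus_coef_lin j D_lin).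
  - case: j Hj => [|j] Hj; first by rewrite -[RHS](KK_0 true c); apply: eq_KK.
    rewrite -[RHS](bv_order k_odd HA hDelta (n := j.+1) (w := c)); first exact: eq_KK.
    by rewrite Hc.
  - by apply: IH Hn; move: (size u) (size w) Hu m1 mw; lia.
  split=> [n Hn|].
    by apply: H1; move: (size w) Hn m1 mw; lia.
  have Es : ((size w).-1 = m.-1 + (size w - m))%N.
    by move: (size w) m1 mw; lia.
  rewrite {1}Es H2; apply: eq_US => L _; apply: eq_KK => x.
  (* As m >= 2, the index m.-1 is positive, where the coefficients of Delta_+ and Delta agree. *)
  by case: (m) m1 => [|[|]].
split=> [n Hn|].
  by rewrite big_nat big1 // => m /andP[m1 mw]; exact: (lead m m1 mw).1.
by apply: eq_big_nat => m /andP[m1 mw]; exact: (lead m m1 mw).2.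
Qed.

Let sigma_cum2 w : (1 < size w)%N -> Sg (F w) = 0.
Proof. by case: w => [|b [|c w]] // _; rewrite sigma_cum. Qed.

Lemma transfer_order w m : (m < (size w).-1)%N -> F w m = 0.
Proof.
have [n] := ubnP (size w); elim: n w m => // n IH w m Hn Hm.
have w2 : (1 < size w)%N by move: (size w) Hm => -[|[]].
have w0 : ~~ nilp w by rewrite /nilp -lt0n ltnW.
have Hn' : (size w <= n)%N by rewrite -ltnS.
have [Hh _] := @higher_terms w (fun u m' Hu => IH u m' (leq_trans Hu Hn')).
(* Inner induction on the order in t, which handles the one-block term. *)
suff main v : (v <= (size w).-1)%N -> forall m, (m < v)%N -> F w m = 0.
  exact: (main (size w).-1).
elim: v => // v IHv Hv m' Hm'.
rewrite cum_split sigma_cum2 // ps_D [X in X + _]linear0 add0r.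
rewrite /H /ps_ext q_terms // Hh ?(leq_trans Hm' Hv) // addr0.
by rewrite (delta_van (IHv (ltnW Hv)) Hm') linear0.
Qed.

Lemma bracket_vanish w m : (1 < size w)%N -> (m < (size w).-1)%N -> q w m = 0.
Proof.
move=> w2 Hm; have w0 : ~~ nilp w by rewrite /nilp -lt0n ltnW.
have [Hh _] := @higher_terms w (fun u m _ => @transfer_order u m).
rewrite q_terms // Hh // addr0.
by apply: (delta_van (v := (size w).-1)); [exact: transfer_order|exact: ltnW].
Qed.

Lemma bracket_leading w : (1 < size w)%N -> q w (size w).-1 =
  \sum_(2 <= m < (size w).+1)
    US m (fun L => KK true (tcoef Delta m.-1) (map (lead_letter F_deg) L)) w.
Proof.
move=> w2; have w0 : ~~ nilp w by rewrite /nilp -lt0n ltnW.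
have [_ Hh] := @higher_terms w (fun u m _ => @transfer_order u m).
rewrite q_terms // Hh (delta_van (v := (size w).-1)) ?add0r //.
exact: transfer_order.
Qed.

Let Delta'_lin : ps_linear Delta' := perturbed_diff_lin dB sigma tau h D_lin.

Let Delta'E x : Delta' x = ps_ext dB x + Sg (delta (E x)) :=
  perturbed_diffE dB sigma tau h D_lin x.

Let Delta'_deg : ps_degree k gB gB 1 Delta'.
Proof.
move=> p x Hx; rewrite Delta'E => n; rewrite ps_D.
apply: (sr_D (graded_superring HB)).
  exact: (ps_ext_op_deg (dg_deg hB) Hx).
rewrite -[_ + _ * _]addr0; apply: (ctr_sigma_deg hctr).
by apply: delta_deg; rewrite -[p]addr0; apply: transfer_tau_deg.
Qed.

Let Delta'_coef_deg n : op_deg gB (1 + n%:Z * (k - 1)) (tcoef Delta' n).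
Proof.
by move=> i x Hx; apply: tcoef_deg Hx; [exact: graded_0 HB|exact: Delta'_deg].
Qed.

Let der_dB i a b : gB i a -> dB (a * b) = dB a * b + sg (par i) (a * dB b).
Proof. exact: derivation_sg (dg_der hB) _ _ _. Qed.

Let Delta'_one n : tcoef Delta' n 1 = 0.
Proof.
have E1 : E (ps_const 1) = ps_const 1 by apply: funext => m; exact: transfer_tau_one.
rewrite /tcoef Delta'E E1 delta_one (addmap0 S_add) addr0 /ps_ext.
case: n => [|n] /=; last exact: linear0.
exact: (der_one (graded_superring HB) der_dB).
Qed.

(** Convolved with products, both sides give the coefficient j + 1 of Delta' at the product; d_B
    enters the coefficient 0 only. *)
Lemma KK_transfer j (w : seq (letter gB)) : KK true (tcoef Delta' j.+1) w = sigma (q w j.+1).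
Proof.
move: w; apply: (conv_inj (@wprod_nil _ gB)) => w.
rewrite (conv_KK (graded_superring HB) w (tcoef_add Delta'_lin _)
  (Delta'_coef_deg j.+1) (bv_par k_odd _)).
transitivity (conv (fun u => Sg (q u)) e w j.+1); last first.
  rewrite /conv (S2_morph (f := fun x : pser B => x j.+1)) //.
  by apply: eq_S2 => u v _; rewrite /e ps_M_const.
rewrite sigma_q_conv /tcoef Delta'E ps_D /ps_ext /= linear0 add0r.
by [].
Qed.

Lemma KK_transfer0 (w : seq (letter gB)) : (1 < size w)%N -> KK true (tcoef Delta' 0) w = 0.
Proof.
case: w => [|a [|b w]] // _.
transitivity (KK true dB (a :: b :: w)).
  apply: eq_KK => x; rewrite /tcoef Delta'E ps_D.
  rewrite [X in _ + X](_ : _ = 0) ?addr0 //.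
  by rewrite /Sg /ps_ext (delta_van (v := 0)) // linear0.
apply: (KK_der2 (graded_superring HB)) => //.
exact: dg_deg hB.
Qed.

Let koszul_transfer n (w : seq (letter gB)) : koszul gB (tcoef Delta' n) (map (@lval _ gB) w) =
  KK true (tcoef Delta' n) w.
Proof.
by rewrite (koszul_KK HB w (tcoef_lin Delta'_lin n) (Delta'_coef_deg n)) // -bv_par.
Qed.

Lemma transfer_derived_BV : derived_BV k gB Delta'.
Proof.
split; [exact: Delta'_lin|exact: Delta'_deg|exact: Delta'_one| |].
  move=> x n; rewrite /Delta' (perturbed_diff_square D_lin hDelta0 hctr (dg_sq hA)) //.
  exact: dbv_square hDelta.
move=> a a2 /tagged_exists[w Ew _] m; rewrite -Ew size_map => Hm.
rewrite -Ew size_map in a2; rewrite koszul_transfer.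
case: m Hm => [|m] Hm; first exact: KK_transfer0.
by rewrite KK_transfer bracket_vanish // linear0.
Qed.

Lemma transfer_derived_BV_morphism : derived_BV_morphism k gB gA Delta' Delta E.
Proof.
split; [exact: E_lin|exact: transfer_tau_deg|exact: transfer_tau_one| |].
  move=> x n; rewrite /Delta' /E (perturbed_tau_dg D_lin hDelta0 hctr (dg_sq hA)) //.
  exact: dbv_square hDelta.
move=> a a2 /tagged_exists[w Ew _] m; rewrite -Ew size_map => Hm.
rewrite (cumulant_word charK k_odd HB HA E_lin transfer_tau_deg).
  exact: transfer_order.
by move: a2; rewrite -Ew size_map /nilp -lt0n; apply: ltnW.
Qed.

Let morE w : ~~ nilp w -> Poisson_mor gB E (map (@lval _ gB) w) = F w (size w).-1.
Proof. exact: (Poisson_mor_word charK k_odd HB HA E_lin transfer_tau_deg). Qed.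

Let leadE w : (1 < size w)%N -> F w (size w).-1 = h (q w (size w).-1).
Proof. by move=> w2; rewrite cum_split sigma_cum2 // ps_D [X in X + _]linear0 add0r. Qed.

(** A general linear [f] serves both h, for the morphism, and sigma, for the structure; [F'] is
    compared with the cumulants on shorter words because the recursion has reached only these. *)
Let composition_transfer (U : lmodType K) (f : {linear A -> U}) w
    (F' : seq B -> A) : tagged w -> (1 < size w)%N ->
  (forall l, (0 < size l)%N -> (size l < size w)%N ->
     F' (map (@lval _ gB) l) = F l (size l).-1) ->
  composition (shift (1 - k) gB) 2 (fun b => f (Poisson_str gA Delta b)) F'
    (map (@lval _ gB) w) = f (q w (size w).-1).
Proof.
move=> Tw w2 HF'.
rewrite (composition_US charK HB (Q := fun m M => f (KK true (tcoef Delta m.-1) M))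
  (lead := lead_letter F_deg) Tw (par_compat_shift HB (par_1k k_odd))).
- rewrite bracket_leading // raddf_sum; apply: eq_bigr => m _.
  by apply/esym/US_morph; exact: addmap_lin.
- move=> l l0 Hl; apply: HF'; first by rewrite lt0n.
  by move: (size l) (size w) Hl; lia.
- exact: (lead_letter_par k_odd F_deg).
- by move=> M _; rewrite (Poisson_str_KK k_odd HA hDelta).
- move=> m s1 s2 a b; rewrite (KK_sym (graded_superring HA)).
    exact: addmap_sg (addmap_lin f) _ _.
  exact: bv_add hDelta _.
Qed.

(** N is fuel: in the composite the blocks are proper subwords, evaluated with one unit less, so any
    N at least the length gives the same value. *)
Lemma transfer_mor_cum N w : (0 < size w)%N -> (size w <= N)%N ->
  transfer_rec (shift (1 - k) gB) tau h (Poisson_str gA Delta) N (map (@lval _ gB) w) =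
  F w (size w).-1.
Proof.
elim: N w => [|N IH] w w0 wN; first by case: (w) w0 wN.
rewrite /= size_map; case: ifP => w1.
  case: w w0 w1 {wN} => [|b [|c w]] // _ _ /=.
  rewrite cum_split sigma_cum /= ps_D /= /ps_ext /H /ps_ext /=.
  (* Delta_+ has no constant term, so on a single letter only tau remains. *)
  have -> : q [:: b] 0%N = 0.
    by rewrite q_terms // big_geq // addr0 (delta_van (v := 0)).
  by rewrite linear0 addr0.
have w2 : (1 < size w)%N by rewrite ltnNge w1.
have [w' Ew Tw] := tagged_exists (@letters_homogeneous _ _ gB w).
have Es : size w' = size w by rewrite -(size_map (@lval _ gB)) Ew size_map.
rewrite -Ew (@composition_transfer _ h) ?Es //.
  rewrite -Es -leadE ?Es //; congr (_ _).
  exact: (word_lin_retag HB (cum_word_lin charK k_odd HB HA E_lin transfer_tau_deg) Ew).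
move=> l l0 Hl; apply: IH => //.
by move: (size l) (size w) Hl wN; lia.
Qed.

Lemma Poisson_mor_transfer a : (0 < size a)%N -> homogeneous gB a ->
  Poisson_mor gB E a =
  transfer_mor (shift (1 - k) gB) tau h (Poisson_str gA Delta) a.
Proof.
move=> a0 /tagged_exists[w Ew _]; rewrite -Ew size_map in a0 *.
by rewrite morE ?/nilp -?lt0n // /transfer_mor size_map transfer_mor_cum.
Qed.

Lemma Poisson_str_transfer a : (0 < size a)%N -> homogeneous gB a ->
  Poisson_str gB Delta' a =
  transfer_str (shift (1 - k) gB) dB sigma tau h (Poisson_str gA Delta) a.
Proof.
move=> a0 /tagged_exists[w Ew Tw]; rewrite -Ew size_map in a0 *.
rewrite /Poisson_str koszul_transfer /transfer_str size_map; case: ifP => w1.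
  case: w a0 w1 {Ew Tw} => [|b [|c w]] // _ _ /=.
  rewrite /ad mulr1 Delta'_one mulr0 sg0 subr0 /tcoef Delta'E ps_D.
  by rewrite [X in _ + X]/Sg [X in _ + X]/ps_ext (delta_van (v := 0)) // linear0 addr0.
have w2 : (1 < size w)%N by rewrite ltnNge w1.
rewrite (@composition_transfer _ sigma) // => [|l l0 _].
  (* The length is at least 2, so the index is a successor, as [KK_transfer] requires. *)
  by case: (size w) (KK_transfer (size w).-2 w) w2 => [|[|n]].
by rewrite /transfer_mor size_map transfer_mor_cum.
Qed.

End Transfer.

Theorem theorem2p14 (K : fieldType) (charK : [pchar K] =i pred0)
    (k : int) (k_odd : odd `|k|%N)
    (A B : algType K) (gA : grading A) (gB : grading B)
    (dA : {linear A -> A}) (dB : {linear B -> B})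
    (hA : dg_comm_alg gA dA) (hB : dg_comm_alg gB dB)
    (sigma : {linear A -> B}) (tau : {linear B -> A}) (h : {linear A -> A})
    (hctr : contraction gA gB dA dB sigma tau h)
    (Delta : pser A -> pser A) (hDelta : derived_BV k gA Delta)
    (hDelta0 : forall a, tcoef Delta 0%N a = dA a)
    (hsf : semifull gA dA sigma tau h) :
  let Delta' := perturbed_diff dB sigma tau h Delta in
  let tau' := perturbed_tau tau h Delta in
  let q := Poisson_str gA Delta in
  [/\ derived_BV k gB Delta',
      derived_BV_morphism k gB gA Delta' Delta tau',
      derived_Poisson k gB (Poisson_str gB Delta') /\
      derived_Poisson_morphism k gB gA (Poisson_str gB Delta') q
        (Poisson_mor gB tau'),
      forall a : seq B, (0 < size a)%N -> homogeneous gB a ->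
        Poisson_str gB Delta' a =
        transfer_str (shift (1 - k) gB) dB sigma tau h q a
    & forall a : seq B, (0 < size a)%N -> homogeneous gB a ->
        Poisson_mor gB tau' a =
        transfer_mor (shift (1 - k) gB) tau h q a].
Proof.
move=> Delta' tau' q.
have Delta'_BV := transfer_derived_BV k_odd hA hB hctr hDelta hDelta0 hsf.
have tau'_BV := transfer_derived_BV_morphism charK k_odd hA hB hctr hDelta hDelta0 hsf.
split=> //.
- split; first exact (Poisson_str_derived_Poisson charK k_odd (dg_alg hB) Delta'_BV).
  exact (Poisson_mor_derived_Poisson charK k_odd (dg_alg hB) (dg_alg hA)
    Delta'_BV hDelta tau'_BV).
- exact (Poisson_str_transfer charK k_odd hA hB hctr hDelta hsf).
- exact (Poisson_mor_transfer charK k_odd hA hB hctr hDelta hsf).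
Qed.
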